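(* For each $p\ge 1$ there exist constants $m_p>0$ and $C(p)<\infty$ such that for every dyadic integer $N$, $$\big\|\,1_{\|P_{\le N}u\|_{L^2(\mathbb T)}^2<m_p}\,e^{f_N(u)}\big\|^p_{L^p(H^{1/2-}(\mathbb T),d\mu)}\le C(p),$$ and consequently $$\|\Psi_N(u)\|^p_{L^p(H^{1/2-}(\mathbb T),d\mu)}\le C(p),$$ where $\Psi_N(u)=1_{\|P_{\le N}u\|_{L^2(\mathbb T)}^2<m_p}\,e^{f_N(u)-\frac12\int_{\mathbb T}|P_{\le N}u(x)|^6dx}$.
   Context: $\mathbb T=\mathbb R/2\pi\mathbb Z$, with the convention $\int_{\mathbb T}f\,dx:=\frac1{2\pi}\int_0^{2\pi}f(x)\,dx$, so $\|u\|_{L^2(\mathbb T)}^2=\sum_n|\widehat u(n)|^2$ for $u(x)=\sum_n\widehat u(n)e^{inx}$. $\langle n\rangle=(1+n^2)^{1/2}$. $H^{1/2-}(\mathbb T)=\bigcap_{s<1/2}H^s(\mathbb T)$. Let $\{g_n\}_{n\in\mathbb Z}$ be i.i.d. complex Gaussians with mean $0$ and $\mathbb E|g_n|^2=1$ (real and imaginary parts independent $N(0,\frac12)$). $\mu$ is the law on $H^{1/2-}(\mathbb T)$ of the random function $u(x)=\sum_{n\in\mathbb Z}\frac{g_n}{\langle n\rangle}e^{inx}$. $P_{\le N}u=\sum_{|n|\le N}\widehat u(n)e^{inx}$. A dyadic integer is an integer that is a power of $2$. The (real-valued) function $f_N$ is $$f_N(u)=-\frac{3i}{2}\int_{\mathbb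 T}\overline{P_{\le N}u}^{\,2}\,P_{\le N}u\;\partial_x(P_{\le N}u)\,dx .$$ *)

(* Defs.v *)
From HB Require Import structures.
From mathcomp Require Import all_boot all_order all_algebra.
From mathcomp Require Import all_classical all_reals all_analysis.
From mathcomp Require Import complex.

Set Implicit Arguments.
Unset Strict Implicit.
Unset Printing Implicit Defensive.

Import Order.TTheory GRing.Theory Num.Theory.
Import numFieldNormedType.Exports.

Local Open Scope classical_set_scope.
Local Open Scope complex_scope.
Local Open Scope ring_scope.

(* Functions on the torus R / 2 pi Z are 2 pi-periodic functions R -> R[i];
   complex integrals and derivatives are taken componentwise. *)

Section torus.
Context {R : realType}.
Implicit Types (v w : R -> R[i]) (n : int) (x : R).

Definition Tset : set R := `[0, 2 * pi].

Definition intT (f : R -> R) : R :=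
  (2 * pi)^-1 * \int[lebesgue_measure]_(x in Tset) f x.

Definition cintT v : R[i] :=
  intT (fun x => complex.Re (v x)) +i* intT (fun x => complex.Im (v x)).

Definition dx v : R -> R[i] := fun x =>
  derive1 (fun y => complex.Re (v y)) x +i*
  derive1 (fun y => complex.Im (v y)) x.

Definition cabs (z : R[i]) : R := ComplexField.Normc.normc z.

Definition expi (t : R) : R[i] := cos t +i* sin t.

Definition jap n : R := Num.sqrt (1 + n%:~R ^+ 2).

Definition fcoef v n : R[i] := cintT (fun x => v x * expi (- (n%:~R * x))).

(* k ranges over 0, ..., 2N, so that n = k - N ranges over -N, ..., N *)
Definition Plow (N : nat) v : R -> R[i] := fun x =>
  \sum_(k < N.*2.+1) let n := k%:Z - N%:Z in fcoef v n * expi (n%:~R * x).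

Definition L2norm2 v : R := intT (fun x => cabs (v x) ^+ 2).

Definition in_L2 v : Prop :=
  [/\ forall x, v (x + 2 * pi) = v x,
      measurable_fun setT (fun x => complex.Re (v x)),
      measurable_fun setT (fun x => complex.Im (v x)) &
      (\int[lebesgue_measure]_(x in Tset) (cabs (v x) ^+ 2)%:E < +oo)%E].

Definition Hs_norm2 (s : R) v : \bar R :=
  \esum_(n in [set: int]) (jap n `^ (2 * s) * cabs (fcoef v n) ^+ 2)%:E.

(* Since s = 0 is allowed, the intersection of the H^s consists of L^2
   functions. *)
Definition in_Hhalfm v : Prop :=
  in_L2 v /\ forall s : R, s < 2^-1 -> (Hs_norm2 s v < +oo)%E.

(* The complex number whose real part is taken is real: since conj(w)^2 w w' = |w|^2 conj(w) w' has
   real part (|w|^4)' / 4, its integral over a period is purely imaginary.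
   Hence Re drops nothing. *)
Definition fN (N : nat) v : R :=
  let w := Plow N v in
  complex.Re (- (3%:R * (0 +i* 1) / 2%:R) *
              cintT (fun x => ((w x)^*) ^+ 2 * w x * dx w x)).

Definition PsiN (m : R) (N : nat) v : R :=
  \1_[set v' | L2norm2 (Plow N v') < m] v *
  expR (fN N v - 2^-1 * intT (fun x => cabs (Plow N v x) ^+ 6)).

Lemma in_Hhalfm0 : in_Hhalfm (fun=> 0).
Proof.
have cabs0 : cabs 0 = 0 :> R by exact: ComplexField.Normc.normc0.
split.
  split; [by []|by []|by []|]; rewrite integral0_eq ?ltry// => x _.
  by rewrite cabs0 expr0n.
move=> s _; rewrite /Hs_norm2 esum1 ?ltry// => n _.
suff -> : fcoef (fun=> 0) n = 0 by rewrite cabs0 expr0n/= mulr0.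
rewrite /fcoef /cintT /intT /Rintegral.
by rewrite !integral0_eq ?mulr0// => x _; rewrite mul0r.
Qed.

End torus.

(* Elements of H^{1/2-} are represented by functions rather than by classes
   modulo a.e. equality. The sigma-algebra used below is generated by the
   Fourier coefficients, hence does not separate a.e. equal representatives; on
   classes it is the Borel sigma-algebra of the separable Frechet space
   H^{1/2-}. *)
Record Hhalfm (R : realType) := MkHhalfm {
  Hfun :> R -> R[i] ;
  HfunP : in_Hhalfm Hfun }.

HB.instance Definition _ (R : realType) := gen_eqMixin (Hhalfm R).
HB.instance Definition _ (R : realType) := gen_choiceMixin (Hhalfm R).
HB.instance Definition _ (R : realType) :=
  isPointed.Build (Hhalfm R) (MkHhalfm in_Hhalfm0).

Definition toRR {R : realType} (z : R[i]) : (R * R)%type :=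
  (complex.Re z, complex.Im z).

Definition Hcylinder (R : realType) : set (set (Hhalfm R)) :=
  [set A | exists n (B : set (R * R)), measurable B /\
     A = [set u : Hhalfm R | B (toRR (fcoef u n))]].

Definition Hspace (R : realType) := g_sigma_algebraType (@Hcylinder R).

HB.instance Definition _ (R : realType) := Measurable.on (Hspace R).

Section gaussian.
Context {R : realType} {d : measure_display} {Om : measurableType d}.
Variable P : probability Om R.

Definition independent_family (I : eqType) {d'} {E : measurableType d'}
    (X : I -> Om -> E) : Prop :=
  forall (s : seq I) (B : I -> set E), uniq s ->
    (forall i, measurable (B i)) ->
    P (\bigcap_(i in [set` s]) X i @^-1` B i) =
    (\prod_(i <- s) P (X i @^-1` B i))%E.

Definition independent2 {d1 d2} {E1 : measurableType d1}
    {E2 : measurableType d2} (X : Om -> E1) (Y : Om -> E2) : Prop :=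
  forall A B, measurable A -> measurable B ->
    P (X @^-1` A `&` Y @^-1` B) = (P (X @^-1` A) * P (Y @^-1` B))%E.

(* The second parameter of normal_prob is the standard deviation. *)
Definition is_normal (m s : R) (X : Om -> R) : Prop :=
  measurable_fun setT X /\
  forall A, measurable A -> P (X @^-1` A) = normal_prob m s A.

Definition complex_gaussian (Z : Om -> R[i]) : Prop :=
  let X := fun w => complex.Re (Z w) in
  let Y := fun w => complex.Im (Z w) in
  [/\ is_normal 0 (Num.sqrt 2^-1) X, is_normal 0 (Num.sqrt 2^-1) Y &
      independent2 X Y].

Definition iid_complex_gaussians (g : int -> Om -> R[i]) : Prop :=
  (forall n, complex_gaussian (g n)) /\
  independent_family (fun n w => toRR (g n w)).

End gaussian.

(* The random series converges in H^{1/2-} only almost surely, so its sum U is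
   prescribed, through its Fourier coefficients, outside a null event. *)
Definition is_mu (R : realType) (mu : probability (Hspace R) R) : Prop :=
  exists (d : measure_display) (Om : measurableType d) (P : probability Om R)
    (g : int -> Om -> R[i]) (U : {mfun Om >-> Hspace R}),
    [/\ iid_complex_gaussians P g,
        {ae P, forall w, forall n, fcoef (U w) n = g n w / (jap n)%:C} &
        forall A, measurable A -> mu A = distribution P U A].

Definition dyadic (N : nat) : Prop := exists k : nat, N = (2 ^ k)%N.

(* Main.v *)
(* In terms of the Fourier coefficients a_n of u, f_N is 3/4 times the sum over
   k of k |b_k|^2, where b is the self-convolution of (a_n)_{|n| <= N}. The modes
   n and -n are switched on together, for n = 1, 2, ..., and the change of f_N
   is computed exactly at each step: a term linear in (g_n, g_-n), which is
   killed to first order by the symmetry g |-> -g; a term proportional to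
   |a_n|^2 - |a_-n|^2, killed to first order by the exchange of n and -n; and a
   term carrying the momentum of the lower modes, which is summable. Second
   order effects are compensated, which turns exp(2 p f_N - Q) into a
   supermartingale, on the event that the mass is small. By Cauchy-Schwarz with
   weights (1 + |n|)^{-3/4}, the compensator Q is bounded by a constant plus a
   multiple of the sextic functional
     W = sum_n (1 + |n|)^{1/2} |a_n|^2 D_n^2,
     D_n = sum_{|j| <= n} (1 + |j|)^{3/4} |a_j|^2,
   and exp(c W) is integrable for small mass: adding to c W the Lyapunov terms
   A D_n^2 / (1 + n)^{1/2} and B D_n / (1 + n)^{3/4}, whose decay in n absorbs the
   growth of W, gives a second supermartingale. Finally
   2 exp(p f_N) <= exp(2 p f_N - Q) + exp(Q). *)
From HB Require Import structures.
Require Import Defs.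
From mathcomp Require Import all_boot all_order all_algebra.
From mathcomp Require Import all_classical all_reals all_analysis.
From mathcomp Require Import measurable_realfun.
From mathcomp Require Import complex.
From mathcomp Require Import ring lra zify.
Set Implicit Arguments.
Unset Strict Implicit.
Unset Printing Implicit Defensive.
Import Order.TTheory GRing.Theory Num.Theory.
Import numFieldNormedType.Exports.
Local Open Scope classical_set_scope.
Local Open Scope ring_scope.

(** [f_N] has degree four in a Gaussian field, so its exponential is integrable only under a mass
    cutoff, and even there it has no deterministic bound uniform in N. Power count of one step, with
    G = |g_n|^2 + |g_-n|^2: on the cutoff the term in |a_n|^2 - |a_-n|^2 is of order m G / n, which
    is not summable in n while its square is; hence the averaging over the exchange. The linear term
    is compensated by a quantity comparable to its conditional variance, which is random and
    unbounded; hence the second supermartingale, which controls exp(Q). There D_n is at most m (1 +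
    n)^{3/4} on the cutoff, so an increment of W is at most a multiple of m G: the powers of n
    cancel exactly, and only a small m, depending on p, keeps the exponentials within the Gaussian
    moment E exp(G / 2). The same count works for every weight exponent strictly between 2/3 and 1;
    with 3/4, all weights are integer powers of (1 + n)^{1/4}. *)

(** * Finite sums over symmetric windows of frequencies *)

Definition window (n : nat) : seq int :=
  [seq k%:Z - n%:Z | k <- iota 0 n.*2.+1].

Lemma mem_window n j : (j \in window n) = (`|j| <= n)%N.
Proof.
apply/mapP/idP => [[k]|jn].
  by rewrite mem_iota => /andP[_]; lia.
by exists (absz (j + n%:Z)); rewrite ?mem_iota; lia.
Qed.

Lemma uniq_window n : uniq (window n).
Proof. by rewrite map_inj_uniq ?iota_uniq// => i j; lia. Qed.

Section window_sums.
Context {V : nmodType}.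
Implicit Types F G : int -> V.

Lemma big_window_ord n F :
  \sum_(j <- window n) F j = \sum_(k < n.*2.+1) F (k%:Z - n%:Z).
Proof. by rewrite big_map -[X in iota 0 X]subn0 -/(index_iota 0 _) big_mkord. Qed.

Lemma big_seq_support (I : eqType) (s t : seq I) (F : I -> V) :
  uniq s -> uniq t ->
  (forall j, j \in s -> j \notin t -> F j = 0) ->
  (forall j, j \in t -> j \notin s -> F j = 0) ->
  \sum_(j <- s) F j = \sum_(j <- t) F j.
Proof.
move=> us ut st ts.
rewrite (bigID (mem t)) [RHS](bigID (mem s))/=.
rewrite [X in _ + X]big_seq_cond [X in _ + X]big1 => [|j /andP[]]; last exact: st.
rewrite [X in _ = _ + X]big_seq_cond [X in _ = _ + X]big1 => [|j /andP[]]; last exact: ts.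
rewrite !addr0 -big_filter -[RHS]big_filter; apply: perm_big.
apply: uniq_perm; rewrite ?filter_uniq// => j.
by rewrite !mem_filter andbC.
Qed.

Lemma big_window_support n m F :
  (forall j, (n < `|j|)%N || (m < `|j|)%N -> F j = 0) ->
  \sum_(j <- window n) F j = \sum_(j <- window m) F j.
Proof.
move=> F0; apply: big_seq_support; [exact: uniq_window|exact: uniq_window| |] => j _;
  rewrite mem_window -ltnNge => h; apply: F0; rewrite h ?orbT//.
Qed.

Lemma big_windowS n F : \sum_(j <- window n.+1) F j =
  \sum_(j <- window n) F j + (F n.+1%:Z + F (- n.+1%:Z)).
Proof.
transitivity (\sum_(j <- rcons (rcons (window n) n.+1%:Z) (- n.+1%:Z)) F j).
  apply: perm_big; apply: uniq_perm => [||j]; first exact: uniq_window.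
    rewrite !rcons_uniq mem_rcons inE !mem_window (uniq_window n).
    by rewrite !andbT; lia.
  by rewrite mem_rcons inE mem_rcons inE mem_window mem_window; lia.
by rewrite -!cats1 !big_cat !big_seq1 addrA.
Qed.

Lemma big_window0 F : \sum_(j <- window 0) F j = F 0.
Proof. by rewrite big_seq1. Qed.

Lemma big_window_delta n i F :
  ((n < `|i|)%N -> F i = 0) ->
  \sum_(j <- window n) (if j == i then F j else 0) = F i.
Proof.
move=> Fi; have [ni|ni] := leqP `|i| n.
  rewrite (bigD1_seq i)/=; [|by rewrite mem_window|exact: uniq_window].
  rewrite eqxx big1 ?addr0// => j.
  by move=> /negbTE ->.
rewrite Fi//; rewrite big_seq big1// => j; rewrite mem_window => jn.
by case: eqP => // ji; move: jn; rewrite ji leqNgt ni.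
Qed.

Lemma big_window_shift n m i F :
  (forall j, (m < `|j|)%N -> F j = 0) -> (m + `|i| <= n)%N ->
  \sum_(j <- window n) F (j - i) = \sum_(j <- window m) F j.
Proof.
move=> F0 mn; rewrite -(big_map (fun j => j - i) predT F).
apply: big_seq_support; [|exact: uniq_window| |].
- by rewrite map_inj_uniq; [exact: uniq_window|move=> j k; lia].
- by move=> j _; rewrite mem_window -ltnNge; exact: F0.
- move=> j; rewrite mem_window => jm /negP[]; apply/mapP; exists (j + i).
    by rewrite mem_window; lia.
  by rewrite addrK.
Qed.

End window_sums.

(** * Exact change of the quartic energy when the modes n and -n are added *)

Section energy.
Context {R : realType}.
Local Notation C := R[i].
Implicit Types (c : int -> C) (z : C).

(** [L] only makes the sums finite: once it is at least twice the largest frequency present, no term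
    is lost, so one value of [L] serves all steps of the induction on modes. *)
Definition conv L c (k : int) : C := \sum_(j <- window L) c j * c (k - j).

Definition energy L c : C :=
  \sum_(k <- window L) k%:~R * (conv L c k * (conv L c k)^*).

(** Half the derivative of the energy with respect to the conjugate of [c i], hence the coefficient
    of the linear term when mode i is switched on. *)
Definition cubic L c (i : int) : C :=
  \sum_(k <- window L) k%:~R * (conv L c k * (c (k - i))^*).

Definition mass L c : C := \sum_(k <- window L) c k * (c k)^*.

Definition momentum L c : C := \sum_(k <- window L) k%:~R * (c k * (c k)^*).

Definition updc (n : nat) z1 z2 c : int -> C := fun j =>
  if j == n%:Z then z1 else if j == - n%:Z then z2 else c j.

Definition trunc (n : nat) c : int -> C := fun j =>
  if (`|j| <= n)%N then c j else 0.

Let dlt (i j : int) z : C := if j == i then z else 0.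

Lemma conv_support L c m k : (forall j, (m < `|j|)%N -> c j = 0) ->
  (m.*2 < `|k|)%N -> conv L c k = 0.
Proof.
move=> c0 mk; rewrite /conv big1// => j _.
have [jm|jm] := ltnP m `|j|; first by rewrite c0// mul0r.
by rewrite [X in _ * X]c0 ?mulr0//; lia.
Qed.

Variables (L n : nat) (c : int -> C) (z1 z2 : C).
Hypotheses (n0 : (0 < n)%N) (nL : (n.*2 <= L)%N).
Hypothesis c0 : forall j, (n <= `|j|)%N -> c j = 0.
Local Notation c' := (updc n z1 z2 c).

Let n1 : n%:Z == - n%:Z = false. Proof. by apply/eqP; lia. Qed.

Let c'E j : c' j = c j + (dlt n j z1 + dlt (- n%:Z) j z2).
Proof.
rewrite /updc /dlt; have [->|jn] := eqVneq j n%:Z.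
  by rewrite n1 addr0 c0 ?add0r//; lia.
have [->|jn'] := eqVneq j (- n%:Z); last by rewrite !addr0.
by rewrite add0r c0 ?add0r//; lia.
Qed.

Let sum_dlt (i : int) z (F : int -> C) : (`|i| <= L)%N ->
  \sum_(j <- window L) dlt i j z * F j = z * F i.
Proof.
move=> iL; transitivity (\sum_(j <- window L) (if j == i then z * F j else 0)).
  by apply: eq_bigr => j _; rewrite /dlt; case: ifP; rewrite ?mul0r.
by rewrite (big_window_delta (F := fun j => z * F j))//; lia.
Qed.

Let sum_dltr (i : int) z k : (`|i| <= L)%N ->
  \sum_(j <- window L) c j * dlt i (k - j) z = z * c (k - i).
Proof.
move=> iL.
transitivity (\sum_(j <- window L) (if j == k - i then z * c j else 0)).
  apply: eq_bigr => j _; rewrite /dlt.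
  have -> : (k - j == i) = (j == k - i) by apply/eqP/eqP; lia.
  by case: ifP; rewrite ?mulr0// mulrC.
rewrite (big_window_delta (F := fun j => z * c j))// => Lk.
by rewrite c0 ?mulr0//; lia.
Qed.

(** [beta] and [gamma] are the parts of the new convolution that are linear and quadratic in (z1,
    z2). *)
Let beta k := 2 * (z1 * c (k - n%:Z) + z2 * c (k + n%:Z)).
Let gamma k := dlt (n.*2)%:Z k (z1 ^+ 2) + (dlt 0 k (2 * z1 * z2)
  + dlt (- (n.*2)%:Z) k (z2 ^+ 2)).

Lemma conv_updc k : conv L c' k = conv L c k + beta k + gamma k.
Proof.
rewrite /conv.
transitivity (\sum_(j <- window L) (c j * c (k - j) +
   (dlt n j z1 * c (k - j) + dlt (- n%:Z) j z2 * c (k - j)) +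
   (c j * dlt n (k - j) z1 + c j * dlt (- n%:Z) (k - j) z2) +
   (dlt n j z1 * (dlt n (k - j) z1 + dlt (- n%:Z) (k - j) z2) +
    dlt (- n%:Z) j z2 * (dlt n (k - j) z1 + dlt (- n%:Z) (k - j) z2)))).
  by apply: eq_bigr => j _; rewrite !c'E; ring.
have nL1 : (`|n%:Z| <= L)%N by lia.
have nL2 : (`|- n%:Z| <= L)%N by lia.
rewrite !big_split/= !sum_dlt// !sum_dltr// opprK.
rewrite /beta /gamma /dlt.
have -> : (k - n%:Z == n%:Z) = (k == (n.*2)%:Z) by apply/eqP/eqP; lia.
have -> : (k - n%:Z == - n%:Z) = (k == 0) by apply/eqP/eqP; lia.
have -> : (k + n%:Z == n%:Z) = (k == 0) by apply/eqP/eqP; lia.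
have -> : (k + n%:Z == - n%:Z) = (k == - (n.*2)%:Z) by apply/eqP/eqP; lia.
by case: ifP => _; case: ifP => _; case: ifP => _; ring.
Qed.

Let gammac k : (gamma k)^* = dlt (n.*2)%:Z k ((z1^*) ^+ 2) +
  (dlt 0 k (2 * z1^* * z2^*) + dlt (- (n.*2)%:Z) k ((z2^*) ^+ 2)).
Proof.
rewrite /gamma !rmorphD /dlt.
by case: ifP => _; case: ifP => _; case: ifP => _;
  rewrite ?rmorph0 ?rmorphXn ?rmorphM ?rmorphMn ?rmorph1.
Qed.

(** No term of degree three in (z1, z2) survives: [gamma] lives at 0 and at 2n, -2n; at 0 the factor
    k vanishes, and at 2n, -2n both [conv L c] and [beta] vanish, because c is supported in ]-n,
    n[. *)
Let density k : k%:~R * (conv L c' k * (conv L c' k)^*) =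
  k%:~R * (conv L c k * (conv L c k)^*) +
  2 * z1^* * (k%:~R * (conv L c k * (c (k - n%:Z))^*)) +
  2 * z2^* * (k%:~R * (conv L c k * (c (k + n%:Z))^*)) +
  (2 * z1 * (k%:~R * ((conv L c k)^* * c (k - n%:Z))) +
  2 * z2 * (k%:~R * ((conv L c k)^* * c (k + n%:Z)))) +
  4 * (z1 * z1^*) * (k%:~R * (c (k - n%:Z) * (c (k - n%:Z))^*)) +
  4 * (z2 * z2^*) * (k%:~R * (c (k + n%:Z) * (c (k + n%:Z))^*)) +
  (dlt (n.*2)%:Z k (n.*2%:R * (z1 * z1^*) ^+ 2) -
   dlt (- (n.*2)%:Z) k (n.*2%:R * (z2 * z2^*) ^+ 2)).
Proof.
have conjD3 (x y z : C) : (x + y + z)^* = x^* + y^* + z^* by rewrite !rmorphD.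
rewrite conv_updc.
rewrite conjD3 gammac /beta.
have -> : (2 * (z1 * c (k - n%:Z) + z2 * c (k + n%:Z)))^* =
   2 * (z1^* * (c (k - n%:Z))^* + z2^* * (c (k + n%:Z))^*).
  by rewrite rmorphM/= conjC_nat; congr (_ * _); rewrite rmorphD !rmorphM.
(* The points k - n and k + n, at distance 2 n, are not both in the support of
   c, which is contained in ]- n, n[. *)
have cc : c (k - n%:Z) * (c (k + n%:Z))^* = 0.
  have [h|h] := ltnP `|k - n%:Z| n; last by rewrite c0// mul0r.
  have -> : c (k + n%:Z) = 0 by apply: c0; lia.
  by rewrite conjC0 mulr0.
have cc' : c (k + n%:Z) * (c (k - n%:Z))^* = 0.
  have [h|h] := ltnP `|k - n%:Z| n; last by rewrite [c (k - _)]c0// conjC0 mulr0.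
  by rewrite [c (k + _)]c0 ?mul0r//; lia.
move: cc cc'; set A := conv L c k; set u := c (k - _); set v := c (k + _).
rewrite /gamma /dlt; set Ac := A^*; set uc := u^*; set vc := v^*.
have [k2|k2] := eqVneq k (n.*2)%:Z.
  have A0 : A = 0 by apply: (@conv_support _ _ n.-1) => [j ?|]; [apply: c0; lia|lia].
  have u0 : u = 0 by apply: c0; lia.
  have v0 : v = 0 by apply: c0; lia.
  have -> : k == 0 = false by apply/eqP; lia.
  have -> : k == - (n.*2)%:Z = false by apply/eqP; lia.
  rewrite /Ac /uc /vc A0 u0 v0 k2 !conjC0 => _ _.
  have -> : ((n.*2)%:Z)%:~R = n.*2%:R :> C by [].
  ring.
have [->|k0] := eqVneq k 0.
  have -> : 0 == - (n.*2)%:Z = false by apply/eqP; lia.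
  by move=> _ _; rewrite mulr0z; ring.
have [k2'|k2'] := eqVneq k (- (n.*2)%:Z).
  have A0 : A = 0 by apply: (@conv_support _ _ n.-1) => [j ?|]; [apply: c0; lia|lia].
  have u0 : u = 0 by apply: c0; lia.
  have v0 : v = 0 by apply: c0; lia.
  rewrite /Ac /uc /vc A0 u0 v0 k2' !conjC0 => _ _.
  have -> : (- (n.*2)%:Z)%:~R = - n.*2%:R :> C by rewrite mulrNz.
  ring.
move=> cc cc'.
apply/eqP; rewrite -subr_eq0; apply/eqP.
transitivity (4 * k%:~R * (z1 * z2^* * (u * vc) + z2 * z1^* * (v * uc))).
  by ring.
by rewrite cc cc'; ring.
Qed.

Let sum_shift (i : int) : (`|i| <= n)%N ->
  \sum_(k <- window L) k%:~R * (c (k - i) * (c (k - i))^*) =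
  momentum L c + i%:~R * mass L c.
Proof.
move=> iL; rewrite /momentum /mass mulr_sumr -big_split/=.
transitivity (\sum_(k <- window L) ((k - i) + i)%:~R * (c (k - i) * (c (k - i))^*)).
  by apply: eq_bigr => k _; rewrite subrK.
rewrite (@big_window_shift _ L n.-1 i (fun k => (k + i)%:~R * (c k * (c k)^*))).
- rewrite (@big_window_support _ n.-1 L); last first.
    by move=> j h; rewrite [c j]c0 ?mul0r ?mulr0//; lia.
  by apply: eq_bigr => k _; rewrite intrD mulrDl.
- by move=> j h; rewrite [c j]c0 ?mul0r ?mulr0//; lia.
- lia.
Qed.

Lemma energy_updc : energy L c' = energy L c +
  (2 * z1^* * cubic L c n%:Z + 2 * z2^* * cubic L c (- n%:Z)) +
  (2 * z1 * (cubic L c n%:Z)^* + 2 * z2 * (cubic L c (- n%:Z))^*) +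
  4 * (z1 * z1^*) * (momentum L c + n%:R * mass L c) +
  4 * (z2 * z2^*) * (momentum L c - n%:R * mass L c) +
  (n.*2%:R * (z1 * z1^*) ^+ 2 - n.*2%:R * (z2 * z2^*) ^+ 2).
Proof.
have conjE (i : int) : (cubic L c i)^* =
    \sum_(k <- window L) k%:~R * ((conv L c k)^* * c (k - i)).
  rewrite /cubic rmorph_sum; apply: eq_bigr => k _.
  by rewrite !rmorphM/= conjCK rmorph_int.
rewrite {1}/energy (eq_bigr _ (fun k _ => density k)) !big_split/= -!mulr_sumr.
rewrite !conjE sum_shift; last by lia.
have -> : \sum_(k <- window L) k%:~R * (c (k + n%:Z) * (c (k + n%:Z))^*) =
    momentum L c - n%:R * mass L c.
  have := @sum_shift (- n%:Z); rewrite mulrNz mulNr => <-; last by lia.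
  by under [RHS]eq_bigr do rewrite opprK.
have dE (i : int) z : (`|i| <= L)%N -> \sum_(k <- window L) dlt i k z = z.
  move=> iL; rewrite /dlt (big_window_delta (F := fun=> z))//; lia.
rewrite sumrN !dE; [|lia|lia].
have cE : \sum_(k <- window L) k%:~R * (conv L c k * (c (k + n%:Z))^*) =
    cubic L c (- n%:Z).
  by rewrite /cubic; under [RHS]eq_bigr do rewrite opprK.
have cE' : \sum_(k <- window L) k%:~R * ((conv L c k)^* * c (k + n%:Z)) =
    \sum_(k <- window L) k%:~R * ((conv L c k)^* * c (k - - n%:Z)).
  by under [RHS]eq_bigr do rewrite opprK.
rewrite cE cE' /energy /cubic.
have -> : (n%:Z)%:~R = n%:R :> C by [].
by rewrite !addrA.
Qed.

End energy.

(** * Real form of the increment, in terms of mass and momentum *)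

Section real_energy.
Context {R : realType}.
Local Notation C := R[i].
Implicit Types (c : int -> C) (z : C).

Definition sqn z : R := complex.Re z ^+ 2 + complex.Im z ^+ 2.

Lemma sqn_ge0 z : 0 <= sqn z.
Proof. by rewrite addr_ge0 ?sqr_ge0. Qed.

Lemma ReM (x y : C) : complex.Re (x * y) =
  complex.Re x * complex.Re y - complex.Im x * complex.Im y.
Proof. by case: x => a b; case: y. Qed.

Lemma ImM (x y : C) : complex.Im (x * y) =
  complex.Re x * complex.Im y + complex.Im x * complex.Re y.
Proof. by case: x => a b; case: y. Qed.

Lemma ReD (x y : C) : complex.Re (x + y) = complex.Re x + complex.Re y.
Proof. by case: x => a b; case: y. Qed.

Lemma ImD (x y : C) : complex.Im (x + y) = complex.Im x + complex.Im y.
Proof. by case: x => a b; case: y. Qed.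

Lemma ReN (x : C) : complex.Re (- x) = - complex.Re x.
Proof. by case: x. Qed.

Lemma ImN (x : C) : complex.Im (- x) = - complex.Im x.
Proof. by case: x. Qed.

Lemma Re_conj (x : C) : complex.Re (x^*) = complex.Re x.
Proof. by case: x. Qed.

Lemma Im_conj (x : C) : complex.Im (x^*) = - complex.Im x.
Proof. by case: x. Qed.

Lemma Re_sum (I : Type) (s : seq I) (P : pred I) (F : I -> C) :
  complex.Re (\sum_(i <- s | P i) F i) = \sum_(i <- s | P i) complex.Re (F i).
Proof. by elim/big_rec2: _ => // i x y _ <-; exact: ReD. Qed.

Lemma Im_sum (I : Type) (s : seq I) (P : pred I) (F : I -> C) :
  complex.Im (\sum_(i <- s | P i) F i) = \sum_(i <- s | P i) complex.Im (F i).
Proof. by elim/big_rec2: _ => // i x y _ <-; exact: ImD. Qed.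

Lemma complex_ext (x y : C) : complex.Re x = complex.Re y ->
  complex.Im x = complex.Im y -> x = y.
Proof. by case: x => a b; case: y => ? ? /= -> ->. Qed.

Lemma Re_natr n : complex.Re (n%:R : C) = n%:R.
Proof. by elim: n => // n IH; rewrite -natr1 ReD IH natr1. Qed.

Lemma Im_natr n : complex.Im (n%:R : C) = 0.
Proof. by elim: n => // n IH; rewrite -natr1 ImD IH addr0. Qed.

Lemma Re_intr (n : int) : complex.Re (n%:~R : C) = n%:~R.
Proof. by case: n => n; rewrite ?NegzE ?mulrNz ?ReN Re_natr. Qed.

Lemma Im_intr (n : int) : complex.Im (n%:~R : C) = 0.
Proof. by case: n => n; rewrite ?NegzE ?mulrNz ?ImN Im_natr ?oppr0. Qed.

Definition rmass L c : R := \sum_(k <- window L) sqn (c k).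
Definition rmomentum L c : R := \sum_(k <- window L) k%:~R * sqn (c k).
Definition potential L c : R := 3 / 4 * complex.Re (energy L c).

Lemma mulr_conj_Re z : complex.Re (z * z^*) = sqn z.
Proof. by rewrite ReM Re_conj Im_conj /sqn; ring. Qed.

Lemma mulr_conj_Im z : complex.Im (z * z^*) = 0.
Proof. by rewrite ImM Re_conj Im_conj; ring. Qed.

Lemma Re_mass L c : complex.Re (mass L c) = rmass L c.
Proof. by rewrite Re_sum; apply: eq_bigr => k _; rewrite mulr_conj_Re. Qed.

Lemma Re_momentum L c : complex.Re (momentum L c) = rmomentum L c.
Proof.
rewrite Re_sum; apply: eq_bigr => k _.
by rewrite ReM mulr_conj_Re mulr_conj_Im Re_intr mulr0 subr0.
Qed.

Definition rdot (z w : C) : R :=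
  complex.Re z * complex.Re w + complex.Im z * complex.Im w.

Let Re_dot z w : complex.Re (2 * z^* * w) = 2 * rdot z w.
Proof.
rewrite -mulrA ReM (Re_natr 2) (Im_natr 2) ReM Re_conj Im_conj /rdot.
by ring.
Qed.

Let Re_dot' z w : complex.Re (2 * z * w^*) = 2 * rdot z w.
Proof.
rewrite -mulrA ReM (Re_natr 2) (Im_natr 2) ReM Re_conj Im_conj /rdot.
by ring.
Qed.

Let Re_4sqn z (w : C) : complex.Re (4 * (z * z^*) * w) =
  4 * sqn z * complex.Re w.
Proof.
rewrite -mulrA ReM (Re_natr 4) (Im_natr 4) ReM mulr_conj_Re mulr_conj_Im.
by ring.
Qed.

Let Re_sqn2 n z : complex.Re (n.*2%:R * (z * z^*) ^+ 2) =
  2 * n%:R * sqn z ^+ 2.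
Proof.
rewrite ReM Re_natr Im_natr expr2 ReM mulr_conj_Re mulr_conj_Im -muln2 natrM.
by ring.
Qed.

Let Re_natM n (w : C) : complex.Re (n%:R * w) = n%:R * complex.Re w.
Proof. by rewrite ReM Re_natr Im_natr mul0r subr0. Qed.

(** The quartic terms factor through [sqn z1 - sqn z2] and merge with the mass term. The resulting
    factor [rmass L c + (sqn z1 + sqn z2) / 2] does not exceed the mass after the update, so the
    cutoff controls it. *)
Lemma potential_updc L n c z1 z2 : (0 < n)%N -> (n.*2 <= L)%N ->
  (forall j, (n <= `|j|)%N -> c j = 0) ->
  potential L (updc n z1 z2 c) = potential L c +
   3 * (rdot z1 (cubic L c n%:Z) + rdot z2 (cubic L c (- n%:Z))) +
   (3 * n%:R * (sqn z1 - sqn z2) * (rmass L c + (sqn z1 + sqn z2) / 2) +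
    3 * rmomentum L c * (sqn z1 + sqn z2)).
Proof.
move=> n0 nL c0; rewrite /potential (energy_updc _ _ n0 nL c0).
set T1 := cubic L c n%:Z; set T2 := cubic L c (- n%:Z); set E := energy L c.
rewrite (ReD _ (_ - _)) (ReD _ (4 * (z2 * _) * _)) (ReD _ (4 * (z1 * _) * _)).
rewrite (ReD _ (2 * z1 * _ + _)) (ReD (2 * z1 * _)) (ReD E) (ReD (2 * z1^* * _)).
rewrite (ReD _ (- _)) ReN !Re_dot !Re_dot' !Re_4sqn !Re_sqn2.
rewrite (ReD (momentum L c)) (ReD (momentum L c) (- _)) ReN Re_natM.
rewrite Re_mass Re_momentum.
by field.
Qed.

Lemma rmass_updc L n c z1 z2 : (0 < n)%N -> (n <= L)%N ->
  (forall j, (n <= `|j|)%N -> c j = 0) ->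
  rmass L (updc n z1 z2 c) = rmass L c + (sqn z1 + sqn z2).
Proof.
move=> n0 nL c0; rewrite /rmass.
transitivity (\sum_(k <- window L) (sqn (c k) +
  ((if k == n%:Z then sqn z1 else 0) + (if k == - n%:Z then sqn z2 else 0)))).
  apply: eq_bigr => k _; rewrite /updc; have [->|kn] := eqVneq k n%:Z.
    have -> : n%:Z == - n%:Z = false by apply/eqP; lia.
    by rewrite c0; [rewrite /sqn expr0n/= !add0r addr0|lia].
  have [->|kn'] := eqVneq k (- n%:Z); last by rewrite !addr0.
  by rewrite c0; [rewrite /sqn expr0n/= !add0r|lia].
rewrite !big_split/= (big_window_delta (F := fun=> sqn z1)); last by lia.
by rewrite (big_window_delta (F := fun=> sqn z2))//; lia.
Qed.

(** A crude bound, which serves only to keep the momentum term below a small multiple of G at each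
    step; summability over the steps comes from [momentum_sum]. *)
Lemma norm_rmomentum L n c : (forall j, (n < `|j|)%N -> c j = 0) ->
  `|rmomentum L c| <= n%:R * rmass L c.
Proof.
move=> c0; rewrite (le_trans (ler_norm_sum _ _ _))// /rmass mulr_sumr.
apply: ler_sum => k _; rewrite normrM (ger0_norm (sqn_ge0 _)).
have [kn|kn] := ltnP n `|k|.
  by rewrite c0// /sqn expr0n/= addr0 !mulr0.
rewrite ler_wpM2r ?sqn_ge0// -intr_norm -[n%:R]/((n%:Z)%:~R) ler_int.
by lia.
Qed.

Lemma rmass_ge0 L c : 0 <= rmass L c.
Proof. by apply: sumr_ge0 => k _; exact: sqn_ge0. Qed.

Lemma sqn0 : sqn 0 = 0. Proof. by rewrite /sqn expr0n/= addr0. Qed.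

Lemma rdotNl z w : rdot (- z) w = - rdot z w.
Proof. by rewrite /rdot ReN ImN; ring. Qed.

(** Lagrange's identity: the difference of the two sides is the sum of the squares of the 2 x 2
    minors. *)
Lemma rdot_cauchy (z1 z2 w1 w2 : C) :
  (rdot z1 w1 + rdot z2 w2) ^+ 2 <= (sqn z1 + sqn z2) * (sqn w1 + sqn w2).
Proof.
rewrite /rdot /sqn.
case: z1 => a b; case: z2 => c d; case: w1 => e f; case: w2 => g h /=.
rewrite -subr_ge0.
have -> : (a ^+ 2 + b ^+ 2 + (c ^+ 2 + d ^+ 2)) *
    (e ^+ 2 + f ^+ 2 + (g ^+ 2 + h ^+ 2)) -
    (a * e + b * f + (c * g + d * h)) ^+ 2 =
   (a * f - b * e) ^+ 2 + (a * g - c * e) ^+ 2 + (a * h - d * e) ^+ 2 +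
   (b * g - c * f) ^+ 2 + (b * h - d * f) ^+ 2 + (c * h - d * g) ^+ 2.
  by ring.
by rewrite !addr_ge0 ?sqr_ge0.
Qed.

End real_energy.

(** * Quarter-power weights and their sums *)

Section weights.
Context {R : realType}.

(** The fourth root of 1 + j turns the exponents 1/2, 3/4, 3/2, ... into integer powers, which
    polynomial reasoning based on [wt4] can handle. *)
Definition wt (j : nat) : R := Num.sqrt (Num.sqrt j.+1%:R).

Lemma wt_gt0 j : 0 < wt j.
Proof. by rewrite !sqrtr_gt0. Qed.

Lemma wt_ge0 j : 0 <= wt j.
Proof. exact/ltW/wt_gt0. Qed.

Lemma wt4 j : wt j ^+ 4 = j.+1%:R.
Proof. by rewrite (exprM _ 2 2) !sqr_sqrtr ?sqrtr_ge0. Qed.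

Let le_pow4 (x y : R) : 0 <= x -> 0 <= y -> x ^+ 4 <= y ^+ 4 -> x <= y.
Proof. by move=> x0 y0; rewrite ler_pXn2r. Qed.

Lemma wt_le i j : (i <= j)%N -> wt i <= wt j.
Proof.
move=> ij; apply: le_pow4; rewrite ?wt_ge0//.
by rewrite !wt4 ler_nat.
Qed.

Lemma wt_ge1 j : 1 <= wt j.
Proof. by apply: le_pow4; rewrite ?wt_ge0// wt4 expr1n ler1n. Qed.

(** Discrete form of the fact that 4 (1 + x)^{1/4} has derivative (1 + x)^{-3/4}: factor b^4 - a^4 =
    1 and bound the cofactor of b - a by 4 b^3. *)
Lemma wt_step j : (wt j.+1 ^+ 3)^-1 <= 4 * (wt j.+1 - wt j).
Proof.
have a0 := wt_gt0 j; have b0 := wt_gt0 j.+1; have ab := wt_le (leqnSn j).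
have e : wt j.+1 ^+ 4 - wt j ^+ 4 = 1.
  by rewrite !wt4 -[in j.+2%:R]addn1 natrD; ring.
have a1 := ltW a0; have b1 := ltW b0.
set a := wt j in a0 a1 ab e *; set b := wt j.+1 in b0 b1 ab e *.
rewrite -[leLHS]mul1r ler_pdivrMr ?exprn_gt0//.
apply: (@le_trans _ _ (b ^+ 4 - a ^+ 4)); first by rewrite e.
have -> : b ^+ 4 - a ^+ 4 = (b - a) * (b ^+ 3 + b ^+ 2 * a + b * a ^+ 2 + a ^+ 3).
  by ring.
have -> : 4 * (b - a) * b ^+ 3 = (b - a) * (4 * b ^+ 3) by ring.
rewrite ler_wpM2l ?subr_ge0//.
have h1 : a ^+ 3 <= b ^+ 3 by rewrite lerXn2r.
have h2 : b * a ^+ 2 <= b * b ^+ 2 by rewrite ler_wpM2l// lerXn2r.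
have h3 : b ^+ 2 * a <= b ^+ 2 * b by rewrite ler_wpM2l// exprn_ge0.
have : b * b ^+ 2 = b ^+ 3 by ring.
have : b ^+ 2 * b = b ^+ 3 by ring.
lra.
Qed.

Lemma sum_wt n : \sum_(j <- window n) (wt `|j|%N ^+ 3)^-1 <= 8 * wt n.
Proof.
elim: n => [|n IH].
  rewrite big_window0 /=.
  have w1 := wt_ge1 0.
  apply: (@le_trans _ _ 1); last by lra.
  by rewrite invf_le1 ?exprn_gt0 ?wt_gt0// exprn_ege1.
rewrite big_windowS abszN !absz_nat.
have := wt_step n; lra.
Qed.

(** The natural constant is 3^{3/4}; rounding it up to 3 keeps it an integer. *)
Lemma wt_third n j : (0 < n)%N -> (n <= 3 * j.+1)%N ->
  (wt j ^+ 3)^-1 <= 3 / wt n.-1 ^+ 3.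
Proof.
move=> n0 nj; have a0 := wt_gt0 j; have b0 := wt_gt0 n.-1.
have e : wt n.-1 ^+ 4 <= 3 * wt j ^+ 4.
  by rewrite !wt4 prednK// -natrM ler_nat.
rewrite -[leLHS]mul1r ler_pdivrMr ?exprn_gt0// mulrAC ler_pdivlMr ?exprn_gt0// mul1r.
have [ab|ab] := leP (wt n.-1) (wt j).
  have : wt n.-1 ^+ 3 <= wt j ^+ 3 by rewrite lerXn2r ?nnegrE ?wt_ge0.
  have := exprn_gt0 3 a0; lra.
rewrite leNgt; apply/negP => h; move: e; apply/negP; rewrite -ltNge.
rewrite !(exprS _ 3); set u := wt j ^+ 3 in h *; set v := wt n.-1 ^+ 3 in h *.
have -> : 3 * (wt j * u) = wt j * (3 * u) by ring.
apply: (@lt_trans _ _ (wt j * v)); first by rewrite ltr_pM2l.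
by rewrite ltr_pM2r// exprn_gt0.
Qed.

End weights.

(** * Cauchy-Schwarz and reindexing inequalities for finite sums *)

Section finite_sums.
Context {R : realType}.

(** Assuming w^2 <= V U pointwise avoids square roots of V and U. The square of the sum is expanded,
    and each product w_i w_j is bounded by the mean of V_i U_j and V_j U_i. *)
Lemma cauchy_schwarz_sum (I : eqType) (s : seq I) (w V U : I -> R) :
  (forall i, 0 <= w i) -> (forall i, 0 <= V i) -> (forall i, 0 <= U i) ->
  (forall i, w i ^+ 2 <= V i * U i) ->
  (\sum_(i <- s) w i) ^+ 2 <= (\sum_(i <- s) V i) * (\sum_(i <- s) U i).
Proof.
move=> w0 V0 U0 wVU.
have key i j : w i * w j <= (V i * U j + V j * U i) / 2.
  rewrite -ler_sqr ?nnegrE ?mulr_ge0 ?addr_ge0 ?mulr_ge0//.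
  rewrite exprMn (le_trans (ler_pM _ _ (wVU i) (wVU j))) ?sqr_ge0//.
  have -> : V i * U i * (V j * U j) = (V i * U j) * (V j * U i) by ring.
  set x := V i * U j; set y := V j * U i.
  have : ((x + y) / 2) ^+ 2 - x * y = ((x - y) / 2) ^+ 2 by field.
  have := sqr_ge0 ((x - y) / 2); lra.
rewrite expr2 mulr_suml.
under eq_bigr do rewrite mulr_sumr.
apply: (@le_trans _ _ (\sum_(i <- s) \sum_(j <- s) ((V i * U j + V j * U i) / 2))).
  by apply: ler_sum => i _; apply: ler_sum => j _.
have -> : \sum_(i <- s) \sum_(j <- s) ((V i * U j + V j * U i) / 2) =
  (\sum_(i <- s) \sum_(j <- s) V i * U j + \sum_(i <- s) \sum_(j <- s) V j * U i) / 2.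
  rewrite -big_split/= mulr_suml; apply: eq_bigr => i _.
  by rewrite -big_split/= mulr_suml.
have -> : \sum_(i <- s) \sum_(j <- s) V j * U i = \sum_(i <- s) \sum_(j <- s) V i * U j.
  by rewrite exchange_big.
have -> : \sum_(i <- s) \sum_(j <- s) V i * U j = (\sum_(i <- s) V i) * (\sum_(i <- s) U i).
  rewrite mulr_suml; apply: eq_bigr => i _; by rewrite mulr_sumr.
lra.
Qed.

Lemma ler_sum_inj (I J : eqType) (s : seq I) (t : seq J) (phi : I -> J) (h : J -> R) :
  uniq s -> uniq t -> {in s &, injective phi} -> (forall j, 0 <= h j) ->
  (forall j, j \notin t -> h j = 0) ->
  \sum_(i <- s) h (phi i) <= \sum_(j <- t) h j.
Proof.
move=> us ut inj h0 ht.
rewrite -(big_map phi predT h).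
rewrite (bigID (mem t))/= [X in _ + X]big1 ?addr0 => [|j]; last exact: ht.
rewrite [leRHS](bigID (mem (map phi s)))/=.
have -> : \sum_(j <- [seq phi i | i <- s] | j \in t) h j =
    \sum_(j <- t | j \in [seq phi i | i <- s]) h j.
  rewrite -big_filter -[RHS]big_filter; apply: perm_big.
  apply: uniq_perm; rewrite ?filter_uniq//.
    by rewrite map_inj_in_uniq.
  by move=> j; rewrite !mem_filter andbC.
by rewrite lerDl; apply: sumr_ge0.
Qed.

Lemma ler_sum_seq (I : eqType) (s : seq I) (F G : I -> R) :
  (forall i, i \in s -> F i <= G i) -> \sum_(i <- s) F i <= \sum_(i <- s) G i.
Proof.
by move=> FG; rewrite big_seq [leRHS]big_seq; apply: ler_sum.
Qed.

End finite_sums.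

(** * The cubic coefficients are dominated by the sextic functional *)

Section cubic_bound.
Context {R : realType}.
Local Notation C := R[i].
Local Notation wt := (@wt R).

Definition modc (z : C) : R := Num.sqrt (sqn z).

Lemma modc_ge0 z : 0 <= modc z. Proof. exact: sqrtr_ge0. Qed.

Lemma sqr_modc z : modc z ^+ 2 = sqn z.
Proof. by rewrite sqr_sqrtr// sqn_ge0. Qed.

Lemma modcE z : modc z = ComplexField.Normc.normc z. Proof. by case: z. Qed.

Lemma modcM z w : modc (z * w) = modc z * modc w.
Proof. by rewrite !modcE ComplexField.Normc.normcM. Qed.

Lemma modc0 : modc 0 = 0. Proof. by rewrite modcE ComplexField.Normc.normc0. Qed.

Lemma modc_conj z : modc z^* = modc z.
Proof. by rewrite /modc /sqn Re_conj Im_conj sqrrN. Qed.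

Lemma modc_int (k : int) : modc k%:~R = `|k|%:~R.
Proof. by rewrite /modc /sqn Re_intr Im_intr expr0n addr0 sqrtr_sqr intr_norm. Qed.

Lemma le_modc_sum (I : Type) (s : seq I) (F : I -> C) :
  modc (\sum_(i <- s) F i) <= \sum_(i <- s) modc (F i).
Proof.
elim/big_rec2: _ => [|i x y _ h]; first by rewrite modc0.
have : modc (F i + y) <= modc (F i) + modc y by rewrite !modcE le_normcD.
by lra.
Qed.

(** The factor k costs at most 2n, since the convolution vanishes for |k| > 2n. *)
Lemma modc_cubic L n c i : (forall j, (n <= `|j|)%N -> c j = 0) ->
  modc (cubic L c i) <= (2 * n%:R) * \sum_(k <- window L) \sum_(x <- window L)
    modc (c x) * modc (c (k - x)) * modc (c (k - i)).
Proof.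
move=> c0; rewrite (le_trans (le_modc_sum _ _))// mulr_sumr.
apply: ler_sum => k _; rewrite !modcM modc_int modc_conj.
have [kn|kn] := leqP `|k|%N n.*2; last first.
  have -> : conv L c k = 0 by apply: (@conv_support _ _ _ n) => // j h; apply: c0; lia.
  rewrite modc0 !mul0r !mulr0 mulr_ge0// sumr_ge0// => x _.
  by rewrite !mulr_ge0 ?modc_ge0.
rewrite ler_pM ?mulr_ge0 ?modc_ge0//.
- by rewrite -natrM -[(2 * n)%:R]/(((2 * n)%N%:Z)%:~R) ler_int; lia.
- rewrite -mulr_suml ler_wpM2r ?modc_ge0//.
  rewrite (le_trans (le_modc_sum _ _))//; apply: ler_sum => x _.
  by rewrite modcM.
Qed.

Definition wsq (r : int -> R) (j : int) : R := wt `|j|%N ^+ 3 * r j ^+ 2.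

(** Makes the choice of the small factor symmetric, so that it may vary from term to term inside a
    sum. *)
Lemma ler_mul3_pairs (r x y z : R) : 0 <= r -> 0 <= x -> 0 <= y -> 0 <= z ->
  [|| x <= r, y <= r | z <= r] -> x * y * z <= r * (y * z + x * z + x * y).
Proof.
move=> r0 x0 y0 z0.
have [yz xz xy] : [/\ 0 <= r * (y * z), 0 <= r * (x * z) & 0 <= r * (x * y)].
  by split; rewrite !mulr_ge0.
rewrite !mulrDr => /or3P[xr|yr|zr].
- rewrite -mulrA; have : x * (y * z) <= r * (y * z) by rewrite ler_wpM2r ?mulr_ge0.
  by move: yz xz xy; set u := r * _; set v := r * _; set w := r * _; lra.
- rewrite mulrAC mulrC; have : y * (x * z) <= r * (x * z) by rewrite ler_wpM2r ?mulr_ge0.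
  by move: yz xz xy; set u := r * _; set v := r * _; set w := r * _; lra.
- rewrite mulrC; have : z * (x * y) <= r * (x * y) by rewrite ler_wpM2r ?mulr_ge0.
  by move: yz xz xy; set u := r * _; set v := r * _; set w := r * _; lra.
Qed.

(** Cauchy-Schwarz with weights (1 + |j|)^{-3/4}. With Q = n^{1/4}, one of the three weights in each
    term is at most 3 / Q^3, and the sum over the other two is at most (8 Q)^2; the three positions
    of the small weight give 3 * (3 / Q^3) * 64 Q^2 = 576 / Q. *)
Lemma tau_bound L n i (r : int -> R) : (0 < n)%N -> (n <= L)%N -> (`|i| = n)%N ->
  (forall j, 0 <= r j) -> (forall j, (n <= `|j|)%N -> r j = 0) ->
  (\sum_(k <- window L) \sum_(x <- window L) r x * r (k - x) * r (k - i)) ^+ 2 <=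
  576 / wt n.-1 * \sum_(k <- window L) \sum_(x <- window L)
    wsq r x * wsq r (k - x) * wsq r (k - i).
Proof.
move=> n0 nL ni r0 rn.
pose v j : R := if (`|j| < n)%N then (wt `|j|%N ^+ 3)^-1 else 0.
have v0 j : 0 <= v j by rewrite /v; case: ifP => // _; rewrite invr_ge0 exprn_ge0// wt_ge0.
have T0 j : 0 <= wsq r j by rewrite mulr_ge0 ?sqr_ge0 ?exprn_ge0 ?wt_ge0.
have vT j : v j * wsq r j = r j ^+ 2.
  rewrite /v /wsq; case: ifPn => [_|]; first by rewrite mulKf// expf_neq0// gt_eqF ?wt_gt0.
  by rewrite -leqNgt => /rn ->; rewrite mul0r expr0n.
pose s := [seq (k, x) | k <- window L, x <- window L].
have sE (F : int -> int -> R) : \sum_(k <- window L) \sum_(x <- window L) F k x =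
    \sum_(p <- s) F p.1 p.2 by rewrite big_allpairs.
rewrite !sE.
pose V (p : int * int) := v p.2 * v (p.1 - p.2) * v (p.1 - i).
have V0 p : 0 <= V p by rewrite !mulr_ge0.
apply: (@le_trans _ _ ((\sum_(p <- s) V p) *
    \sum_(p <- s) wsq r p.2 * wsq r (p.1 - p.2) * wsq r (p.1 - i))).
  apply: cauchy_schwarz_sum => p.
  - by apply: mulr_ge0 => //; exact: mulr_ge0.
  - exact: V0.
  - by apply: mulr_ge0 => //; exact: mulr_ge0.
  rewrite /V !exprMn -!vT.
  by rewrite le_eqVlt; apply/orP; left; apply/eqP; ring.
rewrite ler_wpM2r//; first by apply: sumr_ge0 => p _; apply: mulr_ge0 => //; exact: mulr_ge0.
pose Q := wt n.-1.
have Q0 : 0 < Q by exact: wt_gt0.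
have Sv : \sum_(j <- window L) v j <= 8 * Q.
  rewrite (@big_window_support _ L n.-1); last by move=> j h; rewrite /v; case: ifP => //; lia.
  apply: le_trans (sum_wt n.-1); apply: ler_sum => j _.
  by rewrite /v; case: ifP => // _; rewrite invr_ge0 exprn_ge0// wt_ge0.
have shift (phi : int -> int) : injective phi ->
    \sum_(x <- window L) v (phi x) <= 8 * Q.
  move=> inj; apply: le_trans Sv; apply: ler_sum_inj => //.
  - exact: uniq_window.
  - exact: uniq_window.
  - by move=> x y _ _; exact: inj.
  - move=> j; rewrite mem_window -ltnNge /v => Lj.
    by case: ifP => //; lia.
have sub_inj (k : int) : injective (fun x => k - x) by move=> x y; lia.
have subr_inj (k : int) : injective (fun x => x - k) by move=> x y; lia.
(* Since x + (k - x) - (k - i) = i, one of the three indices has absolute value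
   at least n / 3, and its weight is O(1 / Q ^ 3). *)
have VE p : V p <= 3 / Q ^+ 3 * (v (p.1 - p.2) * v (p.1 - i) +
    v p.2 * v (p.1 - i) + v p.2 * v (p.1 - p.2)).
  have Q3 : 0 <= 3 / Q ^+ 3 by rewrite divr_ge0// exprn_ge0// ltW.
  have vQ j : (n <= 3 * `|j|.+1)%N -> v j <= 3 / Q ^+ 3.
    by move=> h; rewrite /v; case: ifP => // _; exact: wt_third.
  case: p => k x; apply: ler_mul3_pairs => //.
  have [h1|h1] := leqP n (3 * `|x|.+1); first by rewrite vQ.
  have [h2|h2] := leqP n (3 * `|k - x|.+1); first by rewrite (vQ (k - x)) ?orbT.
  by rewrite (vQ (k - i)) ?orbT//=; clear -h1 h2 ni; lia.
apply: (@le_trans _ _ (\sum_(p <- s) 3 / Q ^+ 3 * (v (p.1 - p.2) * v (p.1 - i) +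
    v p.2 * v (p.1 - i) + v p.2 * v (p.1 - p.2)))).
  by apply: ler_sum => p _.
rewrite -mulr_sumr !big_split/=.
have S0 : 0 <= \sum_(x <- window L) v x by exact: sumr_ge0.
have Q8 : 0 <= 8 * Q by rewrite mulr_ge0// ltW.
have b1 : \sum_(p <- s) v (p.1 - p.2) * v (p.1 - i) <= (8 * Q) ^+ 2.
  rewrite -(sE (fun k x => v (k - x) * v (k - i))) expr2.
  apply: (@le_trans _ _ (\sum_(k <- window L) 8 * Q * v (k - i))).
    apply: ler_sum => k _; rewrite -mulr_suml ler_wpM2r//.
    exact: (shift (fun x => k - x)).
  rewrite -mulr_sumr ler_wpM2l//.
  exact: (shift (fun x => x - i)).
have b2 : \sum_(p <- s) v p.2 * v (p.1 - i) <= (8 * Q) ^+ 2.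
  rewrite -(sE (fun k x => v x * v (k - i))) expr2.
  apply: (@le_trans _ _ (\sum_(k <- window L) 8 * Q * v (k - i))).
    by apply: ler_sum => k _; rewrite -mulr_suml ler_wpM2r.
  rewrite -mulr_sumr ler_wpM2l//.
  exact: (shift (fun x => x - i)).
have b3 : \sum_(p <- s) v p.2 * v (p.1 - p.2) <= (8 * Q) ^+ 2.
  rewrite -(sE (fun k x => v x * v (k - x))) expr2 exchange_big/=.
  apply: (@le_trans _ _ (\sum_(x <- window L) v x * (8 * Q))).
    apply: ler_sum => x _; rewrite -mulr_sumr ler_wpM2l//.
    exact: (shift (fun k => k - x)).
  by rewrite -mulr_suml ler_wpM2r.
have -> : 576 / Q = 3 / Q ^+ 3 * (3 * (8 * Q) ^+ 2).
  by field; rewrite gt_eqF.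
have Q3 : 0 <= 3 / Q ^+ 3 by rewrite divr_ge0// exprn_ge0// ltW.
apply: ler_wpM2l => //.
have three (z : R) : 3 * z = z + z + z by ring.
by apply: (le_trans (lerD (lerD b1 b2) b3)); rewrite three.
Qed.

End cubic_bound.

Section cubic_sum.
Context {R : realType}.
Local Notation C := R[i].
Local Notation wt := (@wt R).
Implicit Types a : int -> C.

Definition wmass a (n : nat) : R :=
  \sum_(j <- window n) wt `|j|%N ^+ 3 * sqn (a j).

Definition wsextic a (n : nat) : R :=
  \sum_(j <- window n) wt `|j|%N ^+ 2 * sqn (a j) * wmass a `|j|%N ^+ 2.

Lemma sum_pairs_le_window N (F : int -> R) : (forall j, 0 <= F j) ->
  \sum_(n < N) (F n.+1%:Z + F (- n.+1%:Z)) <= \sum_(j <- window N) F j.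
Proof.
move=> F0; elim: N => [|N IH]; first by rewrite big_ord0 big_window0.
by rewrite big_ord_recr/= big_windowS lerD2r.
Qed.

Lemma ler_sum_window_shift (L N : nat) (phi : int -> int) (h : int -> R) :
  injective phi -> (forall j, 0 <= h j) -> (forall j, (N < `|j|)%N -> h j = 0) ->
  \sum_(x <- window L) h (phi x) <= \sum_(j <- window N) h j.
Proof.
move=> inj h0 hN; apply: ler_sum_inj => //.
- exact: uniq_window.
- exact: uniq_window.
- by move=> x y _ _; exact: inj.
- by move=> j; rewrite mem_window -ltnNge; exact: hN.
Qed.

(** The triple product charged to x when |x| is largest, with 1 / [wt n] already weakened to 1 /
    [wt |x|]. Summing over y and z then rebuilds the square of the weighted mass up to |x|. *)
Let kappa (T : int -> R) (x y z : int) : R :=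
  if (`|y| <= `|x|)%N && (`|z| <= `|x|)%N then T x / wt `|x|%N * (T y * T z) else 0.

Let kappa_ge0 T x y z : (forall j, 0 <= T j) -> 0 <= kappa T x y z.
Proof.
move=> T0; rewrite /kappa; case: ifP => // _.
by rewrite !mulr_ge0 ?invr_ge0 ?wt_ge0.
Qed.

Let kappa_split T n x y z : (forall j, 0 <= T j) ->
  (`|x| <= n)%N -> (`|y| <= n)%N -> (`|z| <= n)%N ->
  (wt n)^-1 * (T x * T y * T z) <=
  kappa T x y z + kappa T y x z + kappa T z x y.
Proof.
move=> T0 xn yn zn.
have wn : 0 < wt n by exact: wt_gt0.
have key u v w : (`|u| <= n)%N -> (`|v| <= `|u|)%N -> (`|w| <= `|u|)%N ->
    (wt n)^-1 * (T u * (T v * T w)) <= kappa T u v w.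
  move=> un vu wu; rewrite /kappa vu wu /= [T u / _]mulrC -mulrA.
  rewrite ler_wpM2r ?mulr_ge0// lef_pV2 ?posrE ?wt_gt0//.
  exact: wt_le.
have k1 := kappa_ge0 x y z T0; have k2 := kappa_ge0 y x z T0.
have k3 := kappa_ge0 z x y T0.
have [yx|xy] := leqP `|y| `|x|.
  have [zx|xz] := leqP `|z| `|x|.
    by have := key x y z xn yx zx; rewrite mulrA; lra.
  have := key z x y zn (ltnW xz) ltac:(lia).
  have -> : T z * (T x * T y) = T x * T y * T z by ring.
  lra.
have [zy|yz] := leqP `|z| `|y|.
  have := key y x z yn (ltnW xy) zy.
  have -> : T y * (T x * T z) = T x * T y * T z by ring.
  lra.
have := key z x y zn ltac:(lia) (ltnW yz).
have -> : T z * (T x * T y) = T x * T y * T z by ring.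
lra.
Qed.

Let sum_kappa a N : let T := fun j => if (`|j| <= N)%N then wt `|j|%N ^+ 3 * sqn (a j) else 0 in
  \sum_(x <- window N) \sum_(y <- window N) \sum_(z <- window N) kappa T x y z =
  wsextic a N.
Proof.
move=> T; rewrite /wsextic; apply: eq_big_seq => x; rewrite mem_window => xN.
have DE : \sum_(y <- window N) (if (`|y| <= `|x|)%N then T y else 0) = wmass a `|x|%N.
  rewrite (@big_window_support _ N `|x|%N).
    apply: eq_big_seq => y; rewrite mem_window => yx.
    by rewrite yx /T ifT// (leq_trans yx).
  move=> j /orP[jN|xj]; last by rewrite leqNgt xj.
  by rewrite /T [(`|j| <= N)%N]leqNgt jN; case: ifP.
transitivity (T x / wt `|x|%N * wmass a `|x|%N ^+ 2).
  rewrite expr2 -!DE mulr_suml mulr_sumr; apply: eq_bigr => y _.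
  rewrite mulr_sumr mulr_sumr; apply: eq_bigr => z _.
  rewrite /kappa; case: (`|y| <= `|x|)%N; case: (`|z| <= `|x|)%N => /=;
    by rewrite ?mul0r ?mulr0.
congr (_ * _); rewrite /T xN; have := @wt_gt0 R `|x|%N.
set w := wt _ => w0; by field; rewrite gt_eqF.
Qed.

(** For |i| = n + 1 the bound of [tau_bound] sums over triples (x, k - x, k - i). Such a triple
    determines x, k and i, so summing over n as well meets each triple of frequencies at most once.
    Charging every triple to its largest entry gives the sextic functional three times. *)
Lemma cubic_sum_bound : exists2 K : R, 0 < K & forall a (L N : nat),
  (N.*2 <= L)%N -> \sum_(n < N) (sqn (cubic L (trunc n a) n.+1%:Z) +
    sqn (cubic L (trunc n a) (- n.+1%:Z))) / n.+1%:R ^+ 2 <= K * wsextic a N.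
Proof.
(* 4 is the square of the factor 2 in [modc_cubic], and 576 comes from [tau_bound]. *)
have [K K0 KE] : exists2 K : R, 0 < K & K = 4 * 576.
  by exists (4 * 576); [apply: mulr_gt0; rewrite ltr0n|reflexivity].
exists (K * 3); first by rewrite mulr_gt0.
move=> a L N NL; pose T := fun j => if (`|j| <= N)%N then wt `|j|%N ^+ 3 * sqn (a j) else 0.
have T0 j : 0 <= T j.
  by rewrite /T; case: ifP => // _; rewrite mulr_ge0 ?sqn_ge0// exprn_ge0// wt_ge0.
pose H x y z := kappa T x y z + kappa T y x z + kappa T z x y.
have H0 x y z : 0 <= H x y z by rewrite /H !addr_ge0// kappa_ge0.
have kN x y z : (N < `|x|)%N || ((N < `|y|)%N || (N < `|z|)%N) -> kappa T x y z = 0.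
  move=> h; have T0' j : (N < `|j|)%N -> T j = 0.
    by move=> jN; rewrite /T leqNgt jN.
  rewrite /kappa; case: ifP => // _.
  by case/or3P: h => /T0' ->; rewrite ?mul0r ?mulr0 ?mul0r.
have HN x y z : (N < `|x|)%N || ((N < `|y|)%N || (N < `|z|)%N) -> H x y z = 0.
  by case/or3P => h; rewrite /H !kN ?addr0// h ?orbT.
have step (n : nat) i : (n < N)%N -> `|i|%N = n.+1 ->
    sqn (cubic L (trunc n a) i) / n.+1%:R ^+ 2 <=
    K * \sum_(k <- window L) \sum_(x <- window L) H x (k - x) (k - i).
  move=> nN ni; pose r := fun j => modc (trunc n a j).
  have r0 j : 0 <= r j by exact: modc_ge0.
  have rn j : (n.+1 <= `|j|)%N -> r j = 0.
    by move=> h; rewrite /r /trunc leqNgt h modc0.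
  have cn j : (n.+1 <= `|j|)%N -> trunc n a j = 0.
    by move=> h; rewrite /trunc leqNgt h.
  have nL : (n.+1 <= L)%N by lia.
  have h1 := @modc_cubic _ L n.+1 (trunc n a) i cn.
  have h2 := @tau_bound _ L n.+1 i r (ltn0Sn n) nL ni r0 rn.
  rewrite -sqr_modc -expr_div_n.
  set tau := \sum_(k <- _) _ in h1; rewrite -/tau in h2.
  have n0 : 0 < n.+1%:R :> R by rewrite ltr0n.
  have h3 : modc (cubic L (trunc n a) i) / n.+1%:R <= 2 * tau.
    by rewrite ler_pdivrMr// mulrAC.
  have t0 : 0 <= modc (cubic L (trunc n a) i) / n.+1%:R.
    by rewrite divr_ge0 ?modc_ge0.
  have h4 : (modc (cubic L (trunc n a) i) / n.+1%:R) ^+ 2 <= 4 * tau ^+ 2.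
    have -> : 4 * tau ^+ 2 = (2 * tau) ^+ 2 by ring.
    by rewrite ler_sqr ?nnegrE//; exact: le_trans t0 h3.
  apply: (le_trans h4).
  apply: (@le_trans _ _ (4 * (576 / wt n * \sum_(k <- window L)
      \sum_(x <- window L) wsq r x * wsq r (k - x) * wsq r (k - i)))).
    by rewrite ler_pM2l.
  have -> : forall S : R, 4 * (576 / wt n * S) = K * ((wt n)^-1 * S).
    by move=> S; rewrite KE; ring.
  rewrite ler_pM2l// mulr_sumr; apply: ler_sum => k _.
  rewrite mulr_sumr; apply: ler_sum => x _.
  have wsqE j : wsq r j = if (`|j| <= n)%N then T j else 0.
    rewrite /wsq /r /trunc /T; case: ifP => jn; last by rewrite modc0 expr0n mulr0.
    by rewrite sqr_modc ifT// (leq_trans jn)// ltnW.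
  rewrite !wsqE.
  case: ifPn => xn; last by rewrite !mul0r mulr0.
  case: ifPn => yn; last by rewrite mulr0 mul0r mulr0.
  case: ifPn => zn; last by rewrite !mulr0.
  exact: kappa_split.
have stepE (n : 'I_N) : (sqn (cubic L (trunc n a) n.+1%:Z) +
    sqn (cubic L (trunc n a) (- n.+1%:Z))) / n.+1%:R ^+ 2 <=
    K * \sum_(k <- window L) \sum_(x <- window L)
     (H x (k - x) (k - n.+1%:Z) + H x (k - x) (k - - n.+1%:Z)).
  rewrite mulrDl.
  have := step n n.+1%:Z (ltn_ord n) erefl.
  have := step n (- n.+1%:Z) (ltn_ord n) ltac:(by rewrite abszN).
  move=> e1 e2; apply: (le_trans (lerD e2 e1)).
  rewrite -mulrDr ler_pM2l// -big_split/=; apply: ler_sum => k _.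
  by rewrite -big_split.
apply: (@le_trans _ _ (\sum_(n < N) K * \sum_(k <- window L) \sum_(x <- window L)
     (H x (k - x) (k - n.+1%:Z) + H x (k - x) (k - - n.+1%:Z)))).
  by apply: ler_sum => n _; exact: stepE.
rewrite -mulr_sumr.
rewrite -mulrA.
rewrite ler_pM2l// exchange_big/=.
under eq_bigr do rewrite exchange_big/=.
apply: (@le_trans _ _ (\sum_(k <- window L) \sum_(x <- window L)
    \sum_(z <- window N) H x (k - x) z)).
  apply: ler_sum => k _; apply: ler_sum => x _.
  apply: (le_trans (@sum_pairs_le_window N (fun i => H x (k - x) (k - i)) _)) => //.
  apply: (@ler_sum_window_shift N N (fun i => k - i) (fun z => H x (k - x) z)) => //.
    by move=> i j; lia.
  by move=> j jN; apply: HN; rewrite jN !orbT.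
rewrite exchange_big/=.
apply: (@le_trans _ _ (\sum_(x <- window L) \sum_(y <- window N) \sum_(z <- window N) H x y z)).
  apply: ler_sum => x _.
  apply: (@ler_sum_window_shift L N (fun k => k - x) (fun y => \sum_(z <- window N) H x y z)).
  - by move=> i j; lia.
  - by move=> j; apply: sumr_ge0.
  - by move=> j jN; rewrite big1// => z _; apply: HN; rewrite jN orbT.
rewrite (@big_window_support _ L N); last first.
  move=> j h; rewrite big1// => y _; rewrite big1// => z _; apply: HN.
  by case: (ltnP N `|j|) h => // ? ; lia.
have E : forall F1 F2 F3 : int -> int -> int -> R,
   \sum_(x <- window N) \sum_(y <- window N) \sum_(z <- window N)
     (F1 x y z + F2 x y z + F3 x y z) =
   \sum_(x <- window N) \sum_(y <- window N) \sum_(z <- window N) F1 x y z +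
   \sum_(x <- window N) \sum_(y <- window N) \sum_(z <- window N) F2 x y z +
   \sum_(x <- window N) \sum_(y <- window N) \sum_(z <- window N) F3 x y z.
  move=> F1 F2 F3; rewrite -!big_split/=; apply: eq_bigr => x _.
  rewrite -!big_split/=; apply: eq_bigr => y _.
  by rewrite -!big_split.
rewrite /H (E (fun x y z => kappa T x y z) (fun x y z => kappa T y x z)
  (fun x y z => kappa T z x y)) (sum_kappa a N).
have -> : \sum_(x <- window N) \sum_(y <- window N) \sum_(z <- window N) kappa T y x z
   = wsextic a N by rewrite exchange_big; exact: sum_kappa.
have -> : \sum_(x <- window N) \sum_(y <- window N) \sum_(z <- window N) kappa T z x y
   = wsextic a N.
  rewrite -(sum_kappa a N).
  transitivity (\sum_(x <- window N) \sum_(z <- window N) \sum_(y <- window N)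
      kappa T z x y); last exact: exchange_big.
  by apply: eq_bigr => x _; exact: exchange_big.
lra.
Qed.

End cubic_sum.

(** * Deterministic summability of the momentum term *)

Section momentum_sum.
Context {R : realType}.
Local Notation C := R[i].
Implicit Types a : int -> C.

Lemma inv_sqr_step n : (n.+1%:R ^+ 2)^-1 <= 2 * (n.+1%:R^-1 - n.+2%:R^-1) :> R.
Proof.
have h : n.+2%:R = n.+1%:R + 1 :> R by rewrite -natr1.
have x1 : 1 <= n.+1%:R :> R by rewrite ler1n.
rewrite h; set x := n.+1%:R in x1 *.
have -> : 2 * (x^-1 - (x + 1)^-1) = 2 / (x * (x + 1)).
  by field; apply/andP; split; rewrite gt_eqF//; lra.
rewrite -[leLHS]mul1r ler_pdivrMr; last by rewrite exprn_gt0//; lra.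
rewrite mulrAC ler_pdivlMr; last by rewrite mulr_gt0//; lra.
have : 0 <= x * (x - 1) by rewrite mulr_ge0//; lra.
have -> : x * (x + 1) = x ^+ 2 + x by ring.
have -> : x * (x - 1) = x ^+ 2 - x by ring.
lra.
Qed.

Lemma sum_inv_sqr N : \sum_(n < N) (n.+1%:R ^+ 2)^-1 <= 2 :> R.
Proof.
suff : \sum_(n < N) (n.+1%:R ^+ 2)^-1 <= 2 * (1 - N.+1%:R^-1) :> R.
  move=> h; apply: (le_trans h); rewrite -[leRHS]mulr1 ler_pM2l// gerBl.
elim: N => [|N IH]; first by rewrite big_ord0 invr1 subrr mulr0.
rewrite big_ord_recr/= (le_trans (lerD IH (inv_sqr_step N)))// -mulrDr.
by rewrite addrA subrK.
Qed.

Lemma rmassS n a : rmass n.+1 a =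
  rmass n a + (sqn (a n.+1%:Z) + sqn (a (- n.+1%:Z))).
Proof. exact: big_windowS. Qed.

Lemma rmass_trunc L n a : (n <= L)%N -> rmass L (trunc n a) = rmass n a.
Proof.
move=> nL; rewrite /rmass (@big_window_support _ L n).
  by apply: eq_big_seq => j; rewrite mem_window /trunc => ->.
move=> j h; rewrite /trunc ifF ?sqn0//; apply/negbTE; rewrite -ltnNge.
by case/orP: h => //; exact: leq_ltn_trans.
Qed.

(** Mode j contributes |j| |a_j|^2 at the steps n >= |j|, and the tail of the series of 1 / (n +
    1)^2 is of order 1 / |j|; the factor |j| cancels and only the mass remains. *)
Lemma momentum_sum a L N : (N <= L)%N ->
  \sum_(n < N) `|rmomentum L (trunc n a)| / n.+1%:R ^+ 2 <= 2 * rmass N a.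
Proof.
pose p n := \sum_(j <- window n) `|j|%N%:R * sqn (a j).
have pE n : (n <= L)%N -> `|rmomentum L (trunc n a)| <= p n.
  move=> nL; rewrite (le_trans (ler_norm_sum _ _ _))//.
  rewrite (@big_window_support _ L n).
    apply: ler_sum_seq => j; rewrite mem_window /trunc => ->.
    by rewrite normrM (ger0_norm (sqn_ge0 _)) -intr_norm.
  move=> j h; rewrite /trunc ifF ?sqn0 ?mulr0 ?normr0//; apply/negbTE; rewrite -ltnNge.
  by case/orP: h => //; exact: leq_ltn_trans.
have p0 n : 0 <= p n by apply: sumr_ge0 => j _; rewrite mulr_ge0 ?sqn_ge0.
move=> NL.
(* The added term is the boundary term of a summation by parts. *)
suff : \sum_(n < N) `|rmomentum L (trunc n a)| / n.+1%:R ^+ 2 +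
    2 * p N / N.+1%:R <= 2 * rmass N a.
  by apply: le_trans; rewrite lerDl divr_ge0// mulr_ge0.
elim: N NL => [|N IH] NL.
  rewrite big_ord0 add0r /p big_window0 mul0r mulr0 mul0r.
  by rewrite mulr_ge0// rmass_ge0.
rewrite big_ord_recr/= rmassS /p big_windowS -/(p N) abszN absz_nat.
have {}IH := IH (ltnW NL).
set S := \sum_(i < N) _ in IH *; set r := sqn _ + sqn _.
have r0 : 0 <= r by rewrite addr_ge0 ?sqn_ge0.
have h1 : `|rmomentum L (trunc N a)| / N.+1%:R ^+ 2 <= p N * (2 * (N.+1%:R^-1 - N.+2%:R^-1)).
  by apply: ler_pM; rewrite ?invr_ge0 ?exprn_ge0//; [exact: pE (ltnW NL)|exact: inv_sqr_step].
rewrite -mulrDr -/r.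
have h2 : N.+1%:R * r / N.+2%:R <= r.
  rewrite mulrAC ler_piMl// ler_pdivrMr ?ltr0n// mul1r ler_nat.
  exact: leqnSn.
have -> : 2 * (p N + N.+1%:R * r) / N.+2%:R =
   2 * (p N * N.+2%:R^-1) + 2 * (N.+1%:R * r / N.+2%:R) by ring.
move: IH h1; have -> : 2 * p N / N.+1%:R = 2 * (p N * N.+1%:R^-1) by ring.
have -> : p N * (2 * (N.+1%:R^-1 - N.+2%:R^-1)) =
  2 * (p N * N.+1%:R^-1) - 2 * (p N * N.+2%:R^-1) by ring.
set u := N.+1%:R^-1; set v := N.+2%:R^-1; set w := _ * v in h2 *.
move: (p N) => t; set z := `|_| / _; lra.
Qed.

End momentum_sum.

(** * One-step exponential estimate after averaging over symmetries *)

Section exponential_bounds.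
Context {R : realType}.
Implicit Types (x y G : R).

Lemma expR_sub1_le y : expR y - 1 <= y * expR y.
Proof.
have := expR_ge1Dx (- y); rewrite expRN => h.
have e0 := expR_gt0 y; have ee : expR y * (expR y)^-1 = 1 by rewrite divff// gt_eqF.
move: h ee e0; set e := expR y; set f := e^-1 => h ee e0.
have : e * (1 - y) <= e * f by rewrite ler_pM2l.
by rewrite ee; lra.
Qed.

(** For y >= 0, e^y + e^{-y} - 2 = e^{-y} (e^y - 1)^2, and e^y - 1 <= y e^y. *)
Lemma expR_sum_sym y : expR y + expR (- y) <= 2 + y ^+ 2 * expR `|y|.
Proof.
wlog y0 : y / 0 <= y.
  move=> H; have [y0|y0] := leP 0 y; first exact: H.
  have := H (- y); rewrite opprK sqrrN normrN addrC; apply.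
  by rewrite oppr_ge0 ltW.
rewrite ger0_norm// expRN.
have e0 := expR_gt0 y; have h := expR_sub1_le y.
have e1 : 0 <= expR y - 1 by have := expR_ge1Dx y; lra.
have ee : expR y * (expR y)^-1 = 1 by rewrite divff// gt_eqF.
have f0 : 0 < (expR y)^-1 by rewrite invr_gt0.
move: h ee e0 e1 f0; set e := expR y; set f := e^-1 => h ee e0 e1 f0.
have h2 : (e - 1) ^+ 2 <= (y * e) ^+ 2 by rewrite ler_sqr ?nnegrE ?mulr_ge0// ltW.
have h3 : f * (e - 1) ^+ 2 <= f * (y * e) ^+ 2 by rewrite ler_pM2l.
have : f * (e - 1) ^+ 2 = e + f - 2.
  have -> : f * (e - 1) ^+ 2 = (e * f) * e - 2 * (e * f) + f by ring.
  by rewrite ee; ring.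
have : f * (y * e) ^+ 2 = y ^+ 2 * e.
  have -> : f * (y * e) ^+ 2 = (e * f) * (y ^+ 2 * e) by ring.
  by rewrite ee mul1r.
lra.
Qed.

Lemma le_expR x : x <= expR x.
Proof. by have := expR_ge1Dx x; lra. Qed.

Lemma le_sqr_expR x : 0 <= x -> x ^+ 2 <= 4 * expR x.
Proof.
move=> x0; have h := le_expR (x / 2).
have -> : x ^+ 2 = 4 * (x / 2) ^+ 2 by field.
rewrite ler_pM2l// {2}(_ : x = x / 2 + x / 2); last by field.
rewrite expRD -expr2 ler_sqr// ?nnegrE ?expR_ge0//; lra.
Qed.

(** Here l and l' are the linear terms before and after the exchange of the two modes, a is the
    antisymmetric term, b the momentum term. After averaging, l and a enter only through their
    squares; b has no symmetry and enters to first order. The factor exp(2 t) is set apart because t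
    has no upper bound. *)
Lemma symmetrized_exp_bound (G a b l l' t p q : R) :
  0 <= G -> 0 <= t -> 0 <= p -> 0 <= q ->
  l ^+ 2 <= t * G -> l' ^+ 2 <= t * G ->
  `|a| <= G / 64 -> a ^+ 2 <= q * G ^+ 2 ->
  `|b| <= G / 64 -> `|b| <= p * G ->
  expR (l + (a + b)) + expR (- l + (a + b)) +
    (expR (l' + (- a + b)) + expR (- l' + (- a + b))) <=
  4 * (expR (2 * t) * (1 + (8 * t + 4 * p + 64 * q) * expR (G / 2))).
Proof.
move=> G0 t0 p0 q0 lG l'G aG aG2 bG bpG.
have G8 : G <= 8 * expR (G / 8) by have := le_expR (G / 8); lra.
have key x : x ^+ 2 <= t * G ->
    expR x + expR (- x) <= 2 * (expR (2 * t) * (1 + 8 * t * expR (G / 4))).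
  (* AM-GM in the form t G <= (2 t + G / 8)^2: the part 2 t is left to the compensator, the part G /
     8 to the Gaussian moment. *)
  move=> xG; have xn : `|x| <= 2 * t + G / 8.
    rewrite -ler_sqr ?nnegrE//; last by lra.
    rewrite real_normK ?num_real// (le_trans xG)//.
    have -> : (2 * t + G / 8) ^+ 2 = t * G + ((2 * t - G / 8) ^+ 2) by field.
    by rewrite lerDl sqr_ge0.
  apply: (le_trans (expR_sum_sym x)).
  have e1 : expR `|x| <= expR (2 * t) * expR (G / 8) by rewrite -expRD ler_expR.
  have e2 : expR (G / 4) = expR (G / 8) * expR (G / 8).
    by rewrite -expRD; congr expR; field.
  have e3 : 1 <= expR (2 * t) by have := expR_ge1Dx (2 * t); lra.
  have e4 : x ^+ 2 * expR `|x| <= (t * G) * (expR (2 * t) * expR (G / 8)).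
    by apply: ler_pM => //; rewrite ?sqr_ge0 ?expR_ge0.
  have e5 : t * G * (expR (2 * t) * expR (G / 8)) <=
      t * (8 * expR (G / 8)) * (expR (2 * t) * expR (G / 8)).
    rewrite ler_wpM2r ?mulr_ge0 ?expR_ge0// ler_wpM2l//.
  rewrite e2.
  have e6 : 0 <= t * (8 * expR (G / 8)) * (expR (2 * t) * expR (G / 8)).
    by rewrite !mulr_ge0 ?expR_ge0.
  have -> : 2 * (expR (2 * t) * (1 + 8 * t * (expR (G / 8) * expR (G / 8)))) =
    2 * expR (2 * t) + 2 * (t * (8 * expR (G / 8)) * (expR (2 * t) * expR (G / 8))).
    by ring.
  lra.
have kl := key _ lG; have kl' := key _ l'G.
set u := 1 + 8 * t * expR (G / 4) in kl kl' *.
have u0 : 0 <= u by rewrite addr_ge0// !mulr_ge0 ?expR_ge0.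
set E := expR (2 * t) in kl kl' *.
have E0 : 0 < E by exact: expR_gt0.
have -> : expR (l + (a + b)) + expR (- l + (a + b)) +
    (expR (l' + (- a + b)) + expR (- l' + (- a + b))) =
  (expR l + expR (- l)) * (expR a * expR b) +
  (expR l' + expR (- l')) * (expR (- a) * expR b).
  by rewrite !expRD; ring.
have ab0 : 0 <= expR a * expR b by rewrite mulr_ge0 ?expR_ge0.
have ab0' : 0 <= expR (- a) * expR b by rewrite mulr_ge0 ?expR_ge0.
apply: (@le_trans _ _ (2 * (E * u) * (expR a * expR b) +
   2 * (E * u) * (expR (- a) * expR b))).
  by apply: lerD; rewrite ler_wpM2r.
set h := expR (G / 64).
have h1 : 1 <= h by rewrite /h; have := expR_ge1Dx (G / 64); lra.
have bh : expR b <= 1 + p * G * h.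
  have := expR_sub1_le b => bb.
  have : b * expR b <= `|b| * h.
    apply: (@le_trans _ _ (`|b| * expR b)).
      by rewrite ler_wpM2r ?expR_ge0// ler_norm.
    rewrite ler_wpM2l// ler_expR (le_trans (ler_norm b))//.
  have : `|b| * h <= p * G * h by rewrite ler_wpM2r// ltW// expR_gt0.
  lra.
have ah : expR a + expR (- a) <= 2 * (1 + q * G ^+ 2 * h).
  have := expR_sum_sym a => aa.
  have : a ^+ 2 * expR `|a| <= q * G ^+ 2 * h.
    by apply: ler_pM; rewrite ?sqr_ge0 ?expR_ge0// ler_expR.
  have : 0 <= q * G ^+ 2 * h by rewrite !mulr_ge0 ?sqr_ge0 ?expR_ge0.
  lra.
have bh' : expR b <= h by rewrite ler_expR (le_trans (ler_norm b)).
have ah' : expR a + expR (- a) <= 2 * h.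
  have : expR a <= h by rewrite ler_expR (le_trans (ler_norm a)).
  have : expR (- a) <= h by rewrite ler_expR (le_trans (ler_norm (- a)))// normrN.
  lra.
set v := expR b in bh bh' *; set w := expR a + expR (- a) in ah ah' *.
have v0 : 0 < v by exact: expR_gt0.
have w0 : 0 <= w by rewrite addr_ge0 ?expR_ge0.
have -> : 2 * (E * u) * (expR a * v) + 2 * (E * u) * (expR (- a) * v) =
  2 * (E * (u * v * w)) by rewrite /w; ring.
have -> : 4 * (E * (1 + (8 * t + 4 * p + 64 * q) * expR (G / 2))) =
  2 * (E * (2 * (1 + (8 * t + 4 * p + 64 * q) * expR (G / 2)))) by ring.
rewrite ler_pM2l// ler_pM2l//.
(* The exponent G / 2 is spent as two factors [H], which absorb the powers of G and the factors
   [h]. *)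
set H := expR (G / 4) in u u0 kl kl' *.
have HH : expR (G / 2) = H * H by rewrite -expRD; congr expR; field.
have H1 : 1 <= H by rewrite /H; have := expR_ge1Dx (G / 4); lra.
have h4 : h * h <= H by rewrite -expRD ler_expR; lra.
have hH : h <= H by rewrite ler_expR; lra.
have GH : G <= 4 * H by have := le_expR (G / 4); rewrite -/H; lra.
have GH2 : G ^+ 2 <= 64 * H.
  have := @le_sqr_expR (G / 4); rewrite -/H.
  have -> : (G / 4) ^+ 2 = G ^+ 2 / 16 by field.
  by move=> /(_ ltac:(lra)); lra.
have hp : 0 < h by lra.
rewrite HH.
(* [u v w = (u - 1) v w + (v - 1) w + w] *)
have s1 : (u - 1) * (v * w) <= 8 * t * H * (2 * H).
  rewrite (_ : u - 1 = 8 * t * H); last by rewrite /u; ring.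
  rewrite ler_wpM2l ?mulr_ge0//; first by lra.
  have : v * w <= h * (2 * h) by apply: ler_pM => //; exact: ltW.
  lra.
have s2 : (v - 1) * w <= p * (4 * H) * (2 * H).
  have : (v - 1) * w <= p * G * h * w by rewrite ler_wpM2r//; lra.
  have : p * G * h * w <= p * G * h * (2 * h).
    by rewrite ler_wpM2l// !mulr_ge0// ltW.
  have : p * G * (2 * (h * h)) <= p * (4 * H) * (2 * H).
    have pG0 : 0 <= p * G by exact: mulr_ge0.
    have hh0 : 0 <= h * h by rewrite mulr_ge0// ltW.
    have pGH : p * G <= p * (4 * H) by rewrite ler_wpM2l.
    by apply: ler_pM => //; lra.
  lra.
have s3 : w <= 2 + q * (64 * H) * (2 * H).
  have : q * G ^+ 2 * h <= q * (64 * H) * H.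
    have qG0 : 0 <= q * G ^+ 2 by rewrite mulr_ge0 ?sqr_ge0.
    have qGH : q * G ^+ 2 <= q * (64 * H) by rewrite ler_wpM2l.
    by apply: ler_pM => //; lra.
  lra.
have -> : u * v * w = (u - 1) * (v * w) + (v - 1) * w + w by ring.
have : 8 * t * H * (2 * H) + p * (4 * H) * (2 * H) + (2 + q * (64 * H) * (2 * H)) =
  2 * (1 + (8 * t + 4 * p + 64 * q) * (H * H)) by ring.
lra.
Qed.

End exponential_bounds.

(** * Lyapunov estimate for one step of the sextic functional *)

Section lyapunov.
Context {R : realType}.

Lemma le_cube_expR (x : R) : 0 <= x -> x ^+ 3 <= 27 * expR x.
Proof.
move=> x0; have h := le_expR (x / 3).
have -> : x ^+ 3 = 27 * (x / 3) ^+ 3 by field.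
rewrite ler_pM2l// (_ : expR x = expR (x / 3) ^+ 3).
  by rewrite lerXn2r ?nnegrE ?expR_ge0//; lra.
by rewrite -expRM_natl; congr expR; field.
Qed.

(** With y = q^4 this is the decrease of y^{-1/2} over a unit step, whose derivative has size
    y^{-3/2} / 2. *)
Lemma weight_gap2 (p q : R) : 1 <= p -> p <= q -> q ^+ 4 = p ^+ 4 + 1 ->
  (q ^+ 2)^-1 + (2 * q ^+ 6)^-1 <= (p ^+ 2)^-1.
Proof.
move=> p1 pq e; have p0 : 0 < p by lra.
have q0 : 0 < q by lra.
have [p0' q0'] : 0 <= p /\ 0 <= q by split; exact: ltW.
have x0 : 0 < p ^+ 2 by rewrite exprn_gt0.
have y0 : 0 < q ^+ 2 by rewrite exprn_gt0.
have xy : p ^+ 2 <= q ^+ 2 by rewrite lerXn2r.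
have e' : (q ^+ 2) ^+ 2 = (p ^+ 2) ^+ 2 + 1 by rewrite -!exprM.
have -> : q ^+ 6 = (q ^+ 2) ^+ 3 by rewrite -exprM.
move: x0 y0 xy e'; set x := p ^+ 2; set y := q ^+ 2 => x0 y0 xy e'.
have -> : y^-1 + (2 * y ^+ 3)^-1 = (2 * y ^+ 2 + 1) / (2 * y ^+ 3).
  by field; rewrite gt_eqF.
rewrite ler_pdivrMr ?mulr_gt0 ?exprn_gt0// [x^-1 * _]mulrC ler_pdivlMr//.
have h : 0 <= y ^+ 2 * (y - x) by rewrite mulr_ge0 ?sqr_ge0 ?subr_ge0.
have h2 : 0 <= (y - x) ^+ 2 * y by rewrite mulr_ge0 ?sqr_ge0// ltW.
have h3 : (y - x) * (y + x) = 1 by rewrite (_ : _ * _ = y ^+ 2 - x ^+ 2); [rewrite e'; ring|ring].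
have -> : (2 * y ^+ 2 + 1) * x = 2 * y ^+ 2 * x + x by ring.
have -> : 2 * y ^+ 3 = 2 * y ^+ 2 * x + 2 * y ^+ 2 * (y - x) by ring.
rewrite lerD2l.
have : x * ((y - x) * (y + x)) <= 2 * y ^+ 2 * (y - x).
  have -> : x * ((y - x) * (y + x)) = (y - x) * (x * (y + x)) by ring.
  have -> : 2 * y ^+ 2 * (y - x) = (y - x) * (y * (y + y)) by ring.
  rewrite ler_wpM2l ?subr_ge0//; apply: ler_pM; lra.
by rewrite h3 mulr1.
Qed.

(** The analogue for y^{-3/4}, with 1/4 in place of the factor 3/4 of its derivative. *)
Lemma weight_gap3 (p q : R) : 1 <= p -> p <= q -> q ^+ 4 = p ^+ 4 + 1 ->
  (q ^+ 3)^-1 + (4 * q ^+ 7)^-1 <= (p ^+ 3)^-1.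
Proof.
move=> p1 pq e; have p0 : 0 < p by lra.
have q0 : 0 < q by lra.
have [p0' q0'] : 0 <= p /\ 0 <= q by split; exact: ltW.
have h3 : p ^+ 3 <= q ^+ 3 by rewrite lerXn2r.
have h2 : p * p ^+ 2 <= q * q ^+ 2.
  by apply: ler_pM; rewrite ?sqr_ge0// lerXn2r.
have -> : (q ^+ 3)^-1 + (4 * q ^+ 7)^-1 = (4 * q ^+ 4 + 1) / (4 * q ^+ 7).
  by field; rewrite gt_eqF.
rewrite ler_pdivrMr ?mulr_gt0 ?exprn_gt0//.
rewrite [(p ^+ 3)^-1 * _]mulrC ler_pdivlMr ?exprn_gt0//.
have g : 1 <= 4 * q ^+ 3 * (q - p).
  have e1 : (q - p) * (q ^+ 3 + q ^+ 2 * p + q * p ^+ 2 + p ^+ 3) = 1.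
    by rewrite (_ : _ * _ = q ^+ 4 - p ^+ 4); [rewrite e; ring|ring].
  rewrite -[leLHS]e1.
  have -> : 4 * q ^+ 3 * (q - p) = (q - p) * (4 * q ^+ 3) by ring.
  rewrite ler_wpM2l ?subr_ge0//.
  have : q ^+ 2 * p <= q ^+ 2 * q by rewrite ler_wpM2l ?sqr_ge0.
  have : q * p ^+ 2 <= q * q ^+ 2 by rewrite ler_wpM2l// lerXn2r.
  have -> : q ^+ 2 * q = q ^+ 3 by ring.
  have -> : q * q ^+ 2 = q ^+ 3 by ring.
  lra.
have -> : (4 * q ^+ 4 + 1) * p ^+ 3 = 4 * q ^+ 4 * p ^+ 3 + p ^+ 3 by ring.
have -> : 4 * q ^+ 7 = 4 * q ^+ 4 * p ^+ 3 + 4 * q ^+ 4 * (q ^+ 3 - p ^+ 3) by ring.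
rewrite lerD2l (le_trans h3)//.
have d : q ^+ 2 * (q - p) <= q ^+ 3 - p ^+ 3.
  have -> : q ^+ 3 - p ^+ 3 = (q ^+ 2 + q * p + p ^+ 2) * (q - p) by ring.
  rewrite ler_wpM2r ?subr_ge0// -addrA lerDl addr_ge0 ?sqr_ge0// mulr_ge0// ltW//.
have q3 : 0 <= q ^+ 3 by rewrite exprn_ge0// ltW.
have q4 : 0 <= 4 * q ^+ 4 by rewrite mulr_ge0// exprn_ge0// ltW.
apply: (@le_trans _ _ (4 * q ^+ 4 * (q ^+ 2 * (q - p)))); last by rewrite ler_wpM2l.
have -> : 4 * q ^+ 4 * (q ^+ 2 * (q - p)) = q ^+ 3 * (4 * q ^+ 3 * (q - p)) by ring.
by rewrite -[leLHS]mulr1 ler_wpM2l.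
Qed.

(* G, G ^ 2 and G ^ 3 are at most 1728 * exp (G / 4), with 1728 = 27 * 64, and
   the factor e comes from Z <= 1 + G / 4 in the proof of lyapunov_bound. *)
Definition lyap_const : R := 1728 * expR 1.

(** The terms in D^2 / q^6 and D / q^7 have the shape of the two terms of [lyap_gap], which will pay
    for them; the last one is summable, since q^8 = (n + 2)^2 at q = [wt n.+1]. *)
Definition lyap_eta (c A B q D : R) : R :=
  lyap_const * (4 * c * D ^+ 2 / q ^+ 6 + 4 * A * D / q ^+ 7 +
    (16 * c + 4 * A + 2 * B) / q ^+ 8).

(** A lower bound for what the two Lyapunov terms lose from n to n + 1 when D stays the same, by
    [weight_gap2] and [weight_gap3]. *)
Definition lyap_gap (A B q D : R) : R :=
  A * D ^+ 2 / (2 * q ^+ 6) + B * D / (4 * q ^+ 7).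

(** To be read with p = [wt n], q = [wt n.+1], D the weighted mass up to n and rho the mass of the
    new pair. All terms containing rho are gathered in [Z]. In exp(Z) <= 1 + Z exp(Z), the
    exponential is bounded through the small mass ([ZG]), while the prefactor keeps coefficients
    that decay in q ([ZW]). *)
Lemma lyapunov_bound (c A B m p q D rho G : R) :
  1 <= p -> p <= q -> q ^+ 4 = p ^+ 4 + 1 ->
  0 <= c -> 0 <= A -> 0 <= B ->
  m <= 1 -> (8 * c + 6 * A) * m <= 1 / 4 -> B * m <= 1 ->
  0 <= D -> D <= p ^+ 3 * m -> 0 <= rho -> rho <= m ->
  rho * q ^+ 8 <= 2 * G -> 0 <= G ->
  expR (c * (q ^+ 2 * rho * (D + q ^+ 3 * rho) ^+ 2) +
     A * (D + q ^+ 3 * rho) ^+ 2 / q ^+ 2 + B * (D + q ^+ 3 * rho) / q ^+ 3) <=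
  expR (A * D ^+ 2 / p ^+ 2 + B * D / p ^+ 3 - lyap_gap A B q D) *
  (1 + lyap_eta c A B q D * expR (G / 2)).
Proof.
set eta := lyap_eta _ _ _ _ _; set gap := lyap_gap _ _ _ _.
move=> p1 pq e c0 A0 B0 m1 hm hB D0 Dm r0 rm rG G0.
have q0 : 0 < q by lra.
have p0 : 0 < p by lra.
have q1 : 1 <= q by lra.
have m0 : 0 <= m by lra.
have q0' : 0 <= q by lra.
have qn0 : q != 0 by rewrite gt_eqF.
have pn0 : p != 0 by rewrite gt_eqF.
have qk k : 0 < q ^+ k by rewrite exprn_gt0.
have qk1 k : 1 <= q ^+ k by rewrite exprn_ege1.
pose Z := c * (q ^+ 2 * rho * (D + q ^+ 3 * rho) ^+ 2) + 2 * A * q * D * rho +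
  A * (q ^+ 4 * rho ^+ 2) + B * rho.
have Z0 : 0 <= Z.
  have x1 : 0 <= q ^+ 2 * rho * (D + q ^+ 3 * rho) ^+ 2.
    by rewrite mulr_ge0 ?sqr_ge0// mulr_ge0// ltW.
  have x2 : 0 <= 2 * A * q * D * rho by rewrite !mulr_ge0// ltW.
  have x3 : 0 <= A * (q ^+ 4 * rho ^+ 2).
    by rewrite mulr_ge0// mulr_ge0 ?sqr_ge0// ltW.
  by rewrite !addr_ge0// mulr_ge0.
have LZ : c * (q ^+ 2 * rho * (D + q ^+ 3 * rho) ^+ 2) +
     A * (D + q ^+ 3 * rho) ^+ 2 / q ^+ 2 + B * (D + q ^+ 3 * rho) / q ^+ 3 <=
     A * D ^+ 2 / p ^+ 2 + B * D / p ^+ 3 - gap + Z.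
  have g2 := weight_gap2 p1 pq e; have g3 := weight_gap3 p1 pq e.
  have AD : 0 <= A * D ^+ 2 by rewrite mulr_ge0 ?sqr_ge0.
  have BD : 0 <= B * D by rewrite mulr_ge0.
  have := ler_wpM2l AD g2; have := ler_wpM2l BD g3.
  rewrite /gap /lyap_gap /Z; set X := c * _.
  have -> : A * (D + q ^+ 3 * rho) ^+ 2 / q ^+ 2 =
    A * D ^+ 2 * (q ^+ 2)^-1 + 2 * A * q * D * rho + A * (q ^+ 4 * rho ^+ 2).
    by field.
  have -> : B * (D + q ^+ 3 * rho) / q ^+ 3 = B * D * (q ^+ 3)^-1 + B * rho.
    by field.
  rewrite !mulrDr; lra.
have r2 : rho <= 2 * G / q ^+ 8 by rewrite ler_pdivlMr.
have rr : 0 <= 2 * G / q ^+ 8 by rewrite divr_ge0 ?mulr_ge0// ltW.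
have inv_le j k : (j <= k)%N -> (q ^+ k)^-1 <= (q ^+ j)^-1.
  by move=> jk; rewrite lef_pV2 ?posrE//; exact: ler_weXn2l.
(* The critical count: D is at most q^3 m and q^8 rho at most 2 G, so no power of q is left. The
   terms in c and A add up to (8 c + 6 A) m G, and B rho is at most 1. *)
have ZG : Z <= 1 + G / 4.
  have Dq : D <= q ^+ 3 * m.
    rewrite (le_trans Dm)// ler_wpM2r// lerXn2r ?nnegrE// ltW//.
  have qr : q ^+ 3 * rho <= q ^+ 3 * m by rewrite ler_wpM2l// ltW.
  have s1 : D + q ^+ 3 * rho <= 2 * (q ^+ 3 * m) by lra.
  have s0 : 0 <= D + q ^+ 3 * rho by rewrite addr_ge0// mulr_ge0// ltW.
  have s2 : (D + q ^+ 3 * rho) ^+ 2 <= (2 * (q ^+ 3 * m)) ^+ 2.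
    by rewrite lerXn2r ?nnegrE//; lra.
  have qr0 : 0 <= q ^+ 2 * rho by rewrite mulr_ge0// ltW.
  have z1 : q ^+ 2 * rho * (D + q ^+ 3 * rho) ^+ 2 <= 8 * (m * G).
    apply: (le_trans (ler_wpM2l qr0 s2)).
    have -> : q ^+ 2 * rho * (2 * (q ^+ 3 * m)) ^+ 2 =
      4 * (m ^+ 2 * (rho * q ^+ 8)) by ring.
    have mm : m ^+ 2 <= m by rewrite expr2 ler_piMl.
    have : m ^+ 2 * (rho * q ^+ 8) <= m * (2 * G).
      by apply: ler_pM => //; rewrite ?sqr_ge0// mulr_ge0// ltW.
    lra.
  have q48 : q ^+ 4 * rho <= 2 * G.
    apply: le_trans rG; rewrite mulrC ler_wpM2l//; exact: ler_weXn2l.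
  have z2 : q * D * rho <= m * (2 * G).
    have : q * D * rho <= q * (q ^+ 3 * m) * rho.
      by rewrite ler_wpM2r// ler_wpM2l// ltW.
    have -> : q * (q ^+ 3 * m) * rho = m * (q ^+ 4 * rho) by ring.
    have := ler_wpM2l m0 q48; lra.
  have z3 : q ^+ 4 * rho ^+ 2 <= m * (2 * G).
    have -> : q ^+ 4 * rho ^+ 2 = rho * (q ^+ 4 * rho) by ring.
    by apply: ler_pM => //; rewrite mulr_ge0// ltW.
  have z4 : B * rho <= 1 by apply: le_trans hB; rewrite ler_wpM2l.
  have := ler_wpM2l c0 z1; have := ler_wpM2l A0 z2; have := ler_wpM2l A0 z3.
  have := ler_wpM2r G0 hm.
  rewrite /Z.
  have -> : 2 * A * q * D * rho = 2 * (A * (q * D * rho)) by ring.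
  set Y1 := c * (q ^+ 2 * _ * _); set Y2 := A * (q * _ * _); set Y3 := A * (_ * _).
  have -> : c * (8 * (m * G)) = 8 * (c * (m * G)) by ring.
  have -> : A * (m * (2 * G)) = 2 * (A * (m * G)) by ring.
  have -> : (8 * c + 6 * A) * m * G = 8 * (c * (m * G)) + 6 * (A * (m * G)) by ring.
  lra.
have Zeta : Z * expR Z <= eta * expR (G / 2).
  pose H := expR (G / 4).
  have H0 : 0 < H by exact: expR_gt0.
  have GH : G <= 1728 * H by have := le_expR (G / 4); rewrite -/H; lra.
  have GH2 : G ^+ 2 <= 1728 * H.
    have := @le_sqr_expR _ (G / 4) ltac:(lra); rewrite -/H.
    have -> : (G / 4) ^+ 2 = G ^+ 2 / 16 by field.
    by lra.
  have GH3 : G ^+ 3 <= 1728 * H.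
    have := @le_cube_expR (G / 4) ltac:(lra); rewrite -/H.
    have -> : (G / 4) ^+ 3 = G ^+ 3 / 64 by field.
    by lra.
  pose W := 4 * c * D ^+ 2 / q ^+ 6 + 4 * A * D / q ^+ 7 +
     (16 * c + 4 * A + 2 * B) / q ^+ 8.
  have ZW : Z <= W * (1728 * H).
    set h := 1728 * H in GH GH2 GH3 *.
    have i8 : 0 <= (q ^+ 8)^-1 by rewrite invr_ge0 ltW.
    have z1 : q ^+ 2 * rho * (D + q ^+ 3 * rho) ^+ 2 <=
        4 * D ^+ 2 / q ^+ 6 * h + 16 / q ^+ 8 * h.
      have a1 : (D + q ^+ 3 * rho) ^+ 2 <= 2 * D ^+ 2 + 2 * (q ^+ 3 * rho) ^+ 2.
        have -> : 2 * D ^+ 2 + 2 * (q ^+ 3 * rho) ^+ 2 =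
          (D + q ^+ 3 * rho) ^+ 2 + (D - q ^+ 3 * rho) ^+ 2 by ring.
        by rewrite lerDl sqr_ge0.
      have qr0 : 0 <= q ^+ 2 * rho by rewrite mulr_ge0// ltW.
      apply: (le_trans (ler_wpM2l qr0 a1)); rewrite mulrDr; apply: lerD.
        have -> : q ^+ 2 * rho * (2 * D ^+ 2) = 2 * q ^+ 2 * D ^+ 2 * rho by ring.
        apply: (@le_trans _ _ (2 * q ^+ 2 * D ^+ 2 * (2 * G / q ^+ 8))).
          by rewrite ler_wpM2l// !mulr_ge0 ?sqr_ge0.
        have -> : 2 * q ^+ 2 * D ^+ 2 * (2 * G / q ^+ 8) = 4 * D ^+ 2 / q ^+ 6 * G.
          by field.
        by rewrite ler_wpM2l// divr_ge0 ?mulr_ge0 ?sqr_ge0// ltW.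
      have -> : q ^+ 2 * rho * (2 * (q ^+ 3 * rho) ^+ 2) = 2 * q ^+ 8 * rho ^+ 3.
        by ring.
      have r3 : rho ^+ 3 <= (2 * G / q ^+ 8) ^+ 3 by rewrite lerXn2r ?nnegrE.
      apply: (@le_trans _ _ (2 * q ^+ 8 * (2 * G / q ^+ 8) ^+ 3)).
        by rewrite ler_wpM2l// mulr_ge0// ltW.
      have -> : 2 * q ^+ 8 * (2 * G / q ^+ 8) ^+ 3 = 16 / q ^+ 16 * G ^+ 3 by field.
      apply: ler_pM => //; rewrite ?divr_ge0 ?exprn_ge0// ?(ltW (qk _))//.
      by rewrite ler_wpM2l// inv_le.
    have z2 : q * D * rho <= 2 * D / q ^+ 7 * h.
      apply: (@le_trans _ _ (q * D * (2 * G / q ^+ 8))).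
        by rewrite ler_wpM2l// mulr_ge0// ltW.
      have -> : q * D * (2 * G / q ^+ 8) = 2 * D / q ^+ 7 * G by field.
      by rewrite ler_wpM2l// divr_ge0 ?mulr_ge0// ltW.
    have z3 : q ^+ 4 * rho ^+ 2 <= 4 / q ^+ 8 * h.
      have r2' : rho ^+ 2 <= (2 * G / q ^+ 8) ^+ 2 by rewrite lerXn2r ?nnegrE.
      apply: (@le_trans _ _ (q ^+ 4 * (2 * G / q ^+ 8) ^+ 2)).
        by rewrite ler_wpM2l// ltW.
      have -> : q ^+ 4 * (2 * G / q ^+ 8) ^+ 2 = 4 / q ^+ 12 * G ^+ 2 by field.
      apply: ler_pM => //; rewrite ?divr_ge0 ?exprn_ge0// ?(ltW (qk _))//.
      by rewrite ler_wpM2l// inv_le.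
    have z4 : rho <= 2 / q ^+ 8 * h.
      apply: (le_trans r2); have -> : 2 * G / q ^+ 8 = 2 / q ^+ 8 * G by ring.
      by rewrite ler_wpM2l// divr_ge0// ltW.
    have := ler_wpM2l c0 z1; have := ler_wpM2l A0 z2; have := ler_wpM2l A0 z3.
    have := ler_wpM2l B0 z4; rewrite /W /Z.
    have -> : 2 * A * q * D * rho = 2 * (A * (q * D * rho)) by ring.
    set Y1 := c * (q ^+ 2 * _ * _); set Y2 := A * (q * _ * _); set Y3 := A * (_ * _).
    have -> : (4 * c * D ^+ 2 / q ^+ 6 + 4 * A * D / q ^+ 7 +
       (16 * c + 4 * A + 2 * B) / q ^+ 8) * h =
      c * (4 * D ^+ 2 / q ^+ 6 * h + 16 / q ^+ 8 * h) +
      2 * (A * (2 * D / q ^+ 7 * h)) + A * (4 / q ^+ 8 * h) +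
      B * (2 / q ^+ 8 * h) by ring.
    lra.
  have eZ : expR Z <= expR 1 * H by rewrite /H -expRD ler_expR.
  have HH : expR (G / 2) = H * H by rewrite -expRD; congr expR; field.
  apply: (@le_trans _ _ (W * (1728 * H) * (expR 1 * H))).
    by apply: ler_pM => //; exact: expR_ge0.
  rewrite HH /eta /lyap_eta -/W /lyap_const le_eqVlt; apply/orP; left; apply/eqP; ring.
apply: (@le_trans _ _ (expR (A * D ^+ 2 / p ^+ 2 + B * D / p ^+ 3 - gap + Z))).
  by rewrite ler_expR.
rewrite expRD ler_wpM2l ?expR_ge0//.
have := expR_sub1_le Z; lra.
Qed.

(** The constant 8 makes half of A absorb 4 c, and 16 makes a quarter of B absorb 4 A, each after
    multiplication by K [lyap_const]; only the term in q^{-8} remains. *)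
Lemma lyapunov_gap (K c A B q D : R) : 0 < q -> 0 <= K -> 0 <= c -> 0 <= D ->
  8 * (K * lyap_const) * c <= A -> 16 * (K * lyap_const) * A <= B ->
  expR (- lyap_gap A B q D) * (1 + lyap_eta c A B q D * K) <=
  expR (K * lyap_const * (16 * c + 4 * A + 2 * B) / q ^+ 8).
Proof.
move=> q0 K0 c0 D0 cA AB.
have qn0 : q != 0 by rewrite gt_eqF.
have qk k : 0 <= (q ^+ k)^-1 by rewrite invr_ge0 exprn_ge0// ltW.
apply: (@le_trans _ _ (expR (- lyap_gap A B q D) * expR (lyap_eta c A B q D * K))).
  by rewrite ler_wpM2l ?expR_ge0// expR_ge1Dx.
rewrite -expRD ler_expR /lyap_eta /lyap_gap.
have h1 : 0 <= D ^+ 2 / q ^+ 6 by rewrite mulr_ge0 ?sqr_ge0.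
have h2 : 0 <= D / q ^+ 7 by rewrite mulr_ge0.
have := ler_wpM2r h1 cA; have := ler_wpM2r h2 AB.
set k := lyap_const.
have -> : A * D ^+ 2 / (2 * q ^+ 6) = A * (D ^+ 2 / q ^+ 6) / 2 by field.
have -> : B * D / (4 * q ^+ 7) = B * (D / q ^+ 7) / 4 by field.
have -> : k * (4 * c * D ^+ 2 / q ^+ 6 + 4 * A * D / q ^+ 7 +
     (16 * c + 4 * A + 2 * B) / q ^+ 8) * K =
  8 * (K * k) * c * (D ^+ 2 / q ^+ 6) / 2 +
  16 * (K * k) * A * (D / q ^+ 7) / 4 +
  K * k * (16 * c + 4 * A + 2 * B) / q ^+ 8 by field.
lra.
Qed.

End lyapunov.

(** * Integration against densities, and symmetries of product measures *)

Section density_integral.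
Local Open Scope ereal_scope.
Context d (T : measurableType d) {R : realType}.
Variables (mu nu : {measure set T -> \bar R}) (h : T -> R).
Hypotheses (mh : measurable_fun setT h) (h0 : forall x, (0 <= h x)%R).
Hypothesis nuE : forall A, measurable A -> nu A = \int[mu]_(x in A) (h x)%:E.
Import HBNNSimple.

Let integral_indic_density (E : set T) : measurable E ->
  \int[nu]_x (\1_E x)%:E = \int[mu]_x ((\1_E x)%:E * (h x)%:E).
Proof.
move=> mE; rewrite integral_indic//= setIT nuE// integral_mkcond.
apply: eq_integral => x _; rewrite patchE indicE; case: ifPn => xE.
  by rewrite mul1e.
by rewrite mul0e.
Qed.

Let mhE (A : set T) : measurable_fun A (EFin \o h).
Proof. exact/measurable_EFinP/measurable_funTS. Qed.

Let integral_nnsfun_density (f : {nnsfun T >-> R}) :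
  \int[nu]_x (f x)%:E = \int[mu]_x ((f x)%:E * (h x)%:E).
Proof.
under [LHS]eq_integral do rewrite fimfunE -fsumEFin//.
rewrite [LHS]ge0_integral_fsum//; last 2 first.
  - by move=> r; exact/measurable_EFinP/measurable_funM.
  - by move=> n x _; rewrite EFinM nnfun_muleindic_ge0.
under [RHS]eq_integral.
  move=> x xD; rewrite fimfunE -fsumEFin// ge0_mule_fsuml; last first.
    by move=> r; rewrite EFinM nnfun_muleindic_ge0.
  over.
rewrite [RHS]ge0_integral_fsum//; last 2 first.
  - move=> r; apply: emeasurable_funM => //.
    exact/measurable_EFinP/measurable_funM.
  - move=> n x _; rewrite EFinM mule_ge0//; last by rewrite lee_fin.
    by rewrite nnfun_muleindic_ge0.
apply: eq_fsbigr => r _; have [r0|r0] := leP 0%R r; last first.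
  rewrite !integral0_eq// => x _; rewrite preimage_nnfun0// indic0 mulr0//.
  by rewrite mul0e.
under eq_integral do rewrite EFinM.
rewrite ge0_integralZl//; last first.
  exact/measurable_EFinP.
under [RHS]eq_integral do rewrite EFinM -muleA.
rewrite ge0_integralZl//.
- by rewrite integral_indic_density.
- apply: emeasurable_funM => //.
  exact/measurable_EFinP.
- by move=> x _; rewrite mule_ge0// lee_fin.
Qed.

Lemma ge0_integral_density (f : T -> \bar R) :
  measurable_fun setT f -> (forall x, 0 <= f x) ->
  \int[nu]_x f x = \int[mu]_x (f x * (h x)%:E).
Proof.
move=> mf f0; pose f_ := nnsfun_approx measurableT mf.
transitivity (limn (fun n => \int[nu]_x (f_ n x)%:E)).
  rewrite -monotone_convergence//=.
  - apply: eq_integral => x _; apply/esym/cvg_lim => //.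
    exact: cvg_nnsfun_approx.
  - by move=> n; exact/measurable_EFinP/measurable_funTS.
  - by move=> *; rewrite lee_fin.
  - by move=> x _ a b ab; rewrite lee_fin; exact/lefP/nd_nnsfun_approx.
transitivity (limn (fun n => \int[mu]_x ((f_ n x)%:E * (h x)%:E))).
  by congr (limn _); apply/funext => n; exact: integral_nnsfun_density.
rewrite -monotone_convergence//=.
- apply: eq_integral => x _; apply/cvg_lim => //; apply: cvgeZr => //.
  exact: cvg_nnsfun_approx.
- move=> n; apply: emeasurable_funM => //.
  exact/measurable_EFinP/measurable_funTS.
- by move=> n x _; rewrite mule_ge0// lee_fin.
- move=> x _ a b ab; rewrite lee_wpmul2r// lee_fin//.
  exact/lefP/nd_nnsfun_approx.
Qed.

End density_integral.

Section product_measure_facts.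
Local Open Scope ereal_scope.
Context {R : realType}.

Lemma integral_preserving d (T : measurableType d)
    (m : {measure set T -> \bar R}) (s : T -> T) :
  measurable_fun setT s ->
  (forall A, measurable A -> m (s @^-1` A) = m A) ->
  forall f : T -> \bar R, measurable_fun setT f -> (forall x, 0 <= f x) ->
  \int[m]_x f (s x) = \int[m]_x f x.
Proof.
move=> ms ims f mf f0.
transitivity (\int[pushforward m s]_x f x).
  by rewrite ge0_integral_pushforward// => x _; exact: f0.
by apply: eq_measure_integral => A mA _; exact: ims.
Qed.

(** The pushforward agrees with the product measure on rectangles, which determine it. *)
Lemma product_measure_preserving d1 d2 (T1 : measurableType d1)
    (T2 : measurableType d2)
    (m1 : {sigma_finite_measure set T1 -> \bar R})
    (m2 : {sigma_finite_measure set T2 -> \bar R}) s1 s2 :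
  measurable_fun setT s1 -> measurable_fun setT s2 ->
  (forall A, measurable A -> m1 (s1 @^-1` A) = m1 A) ->
  (forall A, measurable A -> m2 (s2 @^-1` A) = m2 A) ->
  forall A, measurable A ->
  (m1 \x m2) ((fun x => (s1 x.1, s2 x.2)) @^-1` A) = (m1 \x m2) A.
Proof.
move=> ms1 ms2 i1 i2 A mA.
have ms : measurable_fun [set: T1 * T2] (fun x => (s1 x.1, s2 x.2)).
  by apply/measurable_fun_pair; exact: measurableT_comp.
rewrite -[LHS]/(pushforward (m1 \x m2) (fun x => (s1 x.1, s2 x.2)) A).
apply/esym.
apply: (product_measure_unique (m' := (pushforward (m1 \x m2)
  (fun x => (s1 x.1, s2 x.2)) : {measure set (T1 * T2) -> \bar R}))) => //.
move=> B C mB mC.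
rewrite /= /pushforward -[X in (m1 \x m2) X]/((s1 @^-1` B) `*` (s2 @^-1` C)).
rewrite product_measure1E.
- by apply: f_equal2; [exact: i1|exact: i2].
- by rewrite -[X in measurable X]setTI; exact: ms1.
- by rewrite -[X in measurable X]setTI; exact: ms2.
Qed.

Lemma product_measure_swap d (T : measurableType d)
    (m : {sigma_finite_measure set T -> \bar R}) A : measurable A ->
  (m \x m) ((fun x => (x.2, x.1)) @^-1` A) = (m \x m) A.
Proof.
move=> mA.
have ms : measurable_fun [set: T * T] (fun x : T * T => (x.2, x.1)).
  by apply/measurable_fun_pair.
rewrite -[LHS]/(pushforward (m \x m) (fun x : T * T => (x.2, x.1)) A).
apply/esym.
apply: (product_measure_unique (m' := (pushforward (m \x m)
  (fun x : T * T => (x.2, x.1)) : {measure set (T * T) -> \bar R}))) => //.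
move=> B C mB mC.
transitivity ((m \x m) (C `*` B)); last by rewrite product_measure1E// muleC.
change ((m \x m) ((fun x : T * T => (x.2, x.1)) @^-1` (B `*` C)) =
  (m \x m) (C `*` B)).
apply: f_equal.
by apply/seteqP; split => x [].
Qed.

End product_measure_facts.

(** * The real Gaussian of variance 1/2 *)

Section gaussian_facts.
Context {R : realType}.
Local Notation gau := (normal_prob (0 : R) (Num.sqrt 2^-1)).

Let s0 : Num.sqrt 2^-1 != 0 :> R.
Proof. by rewrite gt_eqF// sqrtr_gt0. Qed.

Lemma normal_prob_opp (s : R) (A : set R) : s != 0 -> measurable A ->
  normal_prob 0 s (-%R @^-1` A) = normal_prob 0 s A.
Proof.
move=> sn0 mA; rewrite /normal_prob.
rewrite [RHS](eq_measure_integral (pushforward (@lebesgue_measure R)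
  (-%R : _ -> measurableTypeR R))); last first.
  by move=> B mB _; apply/esym; exact: lebesgue_measureN.
rewrite ge0_integral_pushforward//.
- apply: eq_integral => x _ /=; congr EFin.
  by rewrite !normal_pdfE// /= /normal_fun !subr0 sqrrN.
- apply/measurable_EFinP/measurable_funTS; exact: measurable_normal_pdf.
- by move=> x _; rewrite lee_fin normal_pdf_ge0.
Qed.

(** The density is proportional to exp(-x^2), so its product with exp(x^2 / 2) is a multiple of the
    standard normal density. This is the source of the factor exp(G / 2) in all one-step
    estimates. *)
Lemma integral_normal_expR_sqr : exists K : R,
  (\int[gau]_x (expR (x ^+ 2 / 2))%:E = K%:E)%E.
Proof.
exists (normal_peak (Num.sqrt 2^-1) / normal_peak (1 : R)).
rewrite (@ge0_integral_density _ (measurableTypeR R) R lebesgue_measure _ (normal_pdf 0 (Num.sqrt 2^-1))).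
- transitivity (\int[@lebesgue_measure R]_x
    ((normal_peak (Num.sqrt 2^-1) / normal_peak (1 : R))%:E * (normal_pdf 0 1 x)%:E))%E.
    apply: eq_integral => x _; rewrite -!EFinM; congr EFin.
    rewrite !normal_pdfE ?oner_eq0//= [RHS]mulrA divfK//; last first.
      by rewrite gt_eqF// normal_peak_gt0// oner_eq0.
    rewrite mulrCA; congr (_ * _); rewrite /normal_fun -expRD; congr expR.
    by rewrite sqr_sqrtr// !subr0; field.
  rewrite ge0_integralZl//=.
  + by rewrite integral_normal_pdf mule1.
  + by apply/measurable_EFinP; exact: measurable_normal_pdf.
  + by move=> x _; rewrite lee_fin normal_pdf_ge0.
  + by rewrite lee_fin divr_ge0// normal_peak_ge0.
- exact: measurable_normal_pdf.
- by move=> x; exact: normal_pdf_ge0.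
- by [].
- apply/measurable_EFinP; apply: measurableT_comp => //.
  by apply: measurable_funM => //; exact: measurable_funX.
- by move=> x; rewrite lee_fin expR_ge0.
Qed.

End gaussian_facts.

(** * Independence of a new mode from the past modes *)

Section past_events.
Context {R : realType} {d} {Om : measurableType d} (P : probability Om R).
Context {d'} {E : measurableType d'} (I : choiceType) (X : I -> Om -> E).
Hypothesis mX : forall i, measurable_fun setT (X i).
Hypothesis indX : independent_family P X.

(** The pi-system of cylinder events that generates the sigma-algebra of the coordinates in s. *)
Definition past_events (s : seq I) : set (set Om) :=
  [set A | exists B : I -> set E, (forall i, measurable (B i)) /\
     A = \bigcap_(i in [set` s]) X i @^-1` B i].

Lemma measurable_past_events s A : past_events s A -> measurable A.
Proof.
move=> [B [mB ->]]; apply: fin_bigcap_measurable; first exact: finite_seq.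
by move=> i _; rewrite -[X in measurable X]setTI; exact: mX.
Qed.

Lemma setI_closed_past_events s : setI_closed (past_events s).
Proof.
move=> _ _ [B [mB ->]] [C [mC ->]]; exists (fun i => B i `&` C i); split.
  by move=> i; exact: measurableI.
by rewrite -bigcapI.
Qed.

Lemma past_eventsT s : past_events s setT.
Proof.
exists (fun=> setT); split => //.
by rewrite bigcapT.
Qed.

Lemma sigma_past_measurable s A : <<s past_events s >> A -> measurable A.
Proof.
apply: smallest_sub A; first exact: sigma_algebra_measurable.
exact: measurable_past_events.
Qed.

Lemma measurable_past s i : i \in s ->
  measurable_fun [set: g_sigma_algebraType (past_events s)] (X i).
Proof.
move=> si _ C mC; rewrite setTI; apply: sub_sigma_algebra.
exists (fun j => if j == i then C else setT); split.
  by move=> j; case: ifP.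
apply/seteqP; split => w /=.
  by move=> XC j /= js; case: eqP => [->|].
by move=> /(_ i si); rewrite /= eqxx.
Qed.

(** In A, both sides are finite measures that agree on the pi-system [past_events]; uniqueness
    extends the equality to the generated sigma-algebra. *)
Lemma independent_past s i : uniq s -> i \notin s ->
  forall A C, <<s past_events s >> A -> measurable C ->
  P (A `&` X i @^-1` C) = (P A * P (X i @^-1` C))%E.
Proof.
move=> us ins A C sA mC.
have mXC : measurable (X i @^-1` C).
  by rewrite -[X in measurable X]setTI; exact: mX.
pose c := fine (P (X i @^-1` C)).
have PE : P (X i @^-1` C) = c%:E by rewrite fineK// fin_num_measure.
have c0 : 0 <= c by rewrite fine_ge0.
have -> : P (A `&` X i @^-1` C) = mrestr P mXC A by [].
transitivity (mscale (NngNum c0) P A); last by rewrite /mscale/= PE muleC.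
apply: (@g_sigma_algebra_measure_unique _ _ _ (past_events s)
  (@measurable_past_events s) (fun=> setT)) => //=.
- by move=> _; exact: past_eventsT.
- by rewrite bigcup_const.
- exact: setI_closed_past_events.
- move=> _ [B [mB ->]]; rewrite /mrestr /mscale/=.
  have -> : \bigcap_(j in [set` s]) X j @^-1` B j `&` X i @^-1` C =
      \bigcap_(j in [set` i :: s]) X j @^-1` (if j == i then C else B j).
    apply/seteqP; split => w /=.
      move=> [h1 h2] j /=; rewrite inE; case: eqP => [-> //|_ /= js].
      exact: h1.
    move=> h; split; last by have := h i; rewrite /= inE eqxx; apply.
    move=> j /= js; have := h j; rewrite /= inE js orbT => /(_ isT).
    by case: eqP => // ji; rewrite -ji js in ins.
  rewrite indX//=; last 2 first.
    by rewrite ins.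
    by move=> j; case: ifP.
  rewrite big_cons eqxx PE indX//; congr (_ * _)%E.
  apply: eq_big_seq => j js; case: eqP => // ji.
  by rewrite -ji js in ins.
- by move=> _; rewrite /mrestr setTI (le_lt_trans (probability_le1 _ _)) ?ltry.
Qed.

End past_events.

Section tower.
Context {R : realType} {d} {Om : measurableType d} (P : probability Om R).
Context {d'} {E : measurableType d'} (I : choiceType) (X : I -> Om -> E).
Hypothesis mX : forall i, measurable_fun setT (X i).
Hypothesis indX : independent_family P X.
Variable nu : {sigma_finite_measure set E -> \bar R}.

(** The joint law of the past and of [X i] is a product, so Tonelli lets the new coordinate be
    integrated with the past frozen. *)
Lemma tower (s : seq I) (i : I) :
  (forall C, measurable C -> P (X i @^-1` C) = nu C) ->
  uniq s -> i \notin s ->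
  forall F : g_sigma_algebraType (past_events X s) * E -> \bar R,
  measurable_fun setT F -> (forall x, (0 <= F x)%E) ->
  (\int[P]_w F (w, X i w) = \int[P]_w \int[nu]_z F (w, z))%E.
Proof.
move=> nuE us ins F mF F0.
pose G := g_sigma_algebraType (past_events X s).
(* The past is [Om] itself with a coarser sigma-algebra, so the variable describing it is the
   identity. *)
pose idG : Om -> G := fun w => w.
have midG : measurable_fun setT idG.
  move=> _ A mA; rewrite setTI; exact: sigma_past_measurable mA.
pose h : Om -> G * E := fun w => (w, X i w).
have mh : measurable_fun setT h by apply/measurable_fun_pair.
pose f : {mfun Om >-> G} := HB.pack idG (isMeasurableFun.Build _ _ _ _ idG midG).
transitivity (\int[pushforward P h]_x F x)%E.
  by rewrite ge0_integral_pushforward// => x _; exact: F0.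
transitivity (\int[distribution P f \x nu]_x F x)%E.
  apply: eq_measure_integral => A mA _; apply/esym.
  apply: (product_measure_unique (m' := (pushforward P h :
    {measure set (G * E) -> \bar R}))) => // B C mB mC.
  by rewrite -nuE//; apply: (independent_past mX indX us ins).
rewrite fubini_tonelli1//.
rewrite /distribution ge0_integral_pushforward//.
  exact: measurable_fun_fubini_tonelli_F.
by move=> w _; rewrite /fubini_F; apply: integral_ge0.
Qed.

End tower.

(** The integral of a nonnegative function is a supremum over the simple functions below it, so the
    comparison holds for arbitrary functions. *)
Lemma ge0_le_integralT d (T : measurableType d) (R : realType)
    (m : {measure set T -> \bar R}) (f g : T -> \bar R) :
  (forall x, (0 <= f x)%E) -> (forall x, (f x <= g x)%E) ->
  (\int[m]_x f x <= \int[m]_x g x)%E.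
Proof.
move=> f0 fg; have g0 x : (0 <= g x)%E by exact: le_trans (fg x).
rewrite !ge0_integralTE//; apply: ereal_sup_le => _ [h hf <-].
by exists h => // x; exact: le_trans (fg x).
Qed.

(** * Laws of one complex mode and of a pair of modes, with their symmetries *)

Section gaussian_law.
Context {R : realType}.

Let measurable_id_R :
  measurable_fun [set: measurableTypeR R] (fun x : measurableTypeR R => x : R).
Proof. by move=> _ A mA; rewrite setTI. Qed.

Let idR : {mfun (measurableTypeR R) >-> R} :=
  HB.pack (fun x : measurableTypeR R => x : R)
    (isMeasurableFun.Build _ _ _ _ _ measurable_id_R).

(* normal_prob carries the display of the Lebesgue sigma-algebra generators; it
   is transported to the default display of R used in products. *)
Definition gauss : probability R R :=
  distribution (normal_prob (0 : R) (Num.sqrt 2^-1)) idR.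

Definition cgauss : probability (R * R)%type R :=
  (gauss \x gauss)%E.

Lemma complex_gaussian_law d (Om : measurableType d) (P : probability Om R)
    (Z : Om -> R[i]) : complex_gaussian P Z ->
  measurable_fun setT (fun w => toRR (Z w)) /\
  forall C, measurable C -> P ((fun w => toRR (Z w)) @^-1` C) = cgauss C.
Proof.
move=> [[mX lX] [mY lY] ind].
have mZ : measurable_fun [set: Om] (fun w => toRR (Z w)).
  by apply/measurable_fun_pair.
split => // C mC; rewrite /cgauss; apply/esym.
pose m' : {measure set (R * R) -> \bar R} := pushforward P (fun w => toRR (Z w)).
apply: (@product_measure_unique _ _ _ _ R gauss gauss (m' mZ)) => // A B mA mB.
transitivity (P ((fun w => complex.Re (Z w)) @^-1` A) *
  P ((fun w => complex.Im (Z w)) @^-1` B))%E; first by rewrite -ind.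
by rewrite lX// lY.
Qed.

Lemma gauss_opp (A : set R) : measurable A -> gauss (-%R @^-1` A) = gauss A.
Proof. by move=> mA; apply: normal_prob_opp => //; rewrite gt_eqF// sqrtr_gt0. Qed.

Lemma integral_gauss_expR_sqr : exists K : R,
  (\int[gauss]_x (expR (x ^+ 2 / 2))%:E = K%:E)%E.
Proof.
have [K KE] := @integral_normal_expR_sqr R; exists K; rewrite -KE.
rewrite /gauss /distribution ge0_integral_pushforward//.
apply/measurable_EFinP; apply: measurableT_comp => //.
by apply: measurable_funM => //; exact: measurable_funX.
Qed.

Lemma cgauss_opp (A : set (R * R)) : measurable A ->
  cgauss ((fun z => (- z.1, - z.2)) @^-1` A) = cgauss A.
Proof.
by move=> mA; apply: product_measure_preserving => //; exact: gauss_opp.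
Qed.

Definition nrm2 (z : R * R) := z.1 ^+ 2 + z.2 ^+ 2.

Lemma measurable_nrm2 : measurable_fun setT nrm2.
Proof.
by apply: measurable_funD; apply: measurable_funX.
Qed.

Lemma integral_cgauss_expR_nrm2 : exists K : R,
  (\int[cgauss]_z (expR (nrm2 z / 2))%:E = K%:E)%E.
Proof.
have [K KE] := integral_gauss_expR_sqr; exists (K * K).
have mg : measurable_fun setT (fun x : R => (expR (x ^+ 2 / 2))%:E).
  apply/measurable_EFinP; apply: measurableT_comp => //.
  by apply: measurable_funM => //; exact: measurable_funX.
rewrite /cgauss fubini_tonelli1//=; last first.
  apply/measurable_EFinP; apply: measurableT_comp => //.
  by apply: measurable_funM => //; exact: measurable_nrm2.
rewrite /fubini_F.
transitivity (\int[gauss]_x ((expR (x ^+ 2 / 2))%:E * K%:E))%E.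
  apply: eq_integral => x _; rewrite -KE -ge0_integralZl//.
  apply: eq_integral => y _ /=.
  by rewrite /nrm2/= mulrDl expRD.
rewrite ge0_integralZr//; first by rewrite KE.
rewrite -KE; apply: integral_ge0 => x _; by rewrite lee_fin expR_ge0.
Qed.

End gaussian_law.

Section pair_average.
Context {R : realType}.
Local Notation E := (R * R)%type.

(** Law of (g_n, g_-n). *)
Definition pgauss : probability (E * E)%type R :=
  (@cgauss R \x @cgauss R)%E.

Definition popp (g : E * E) : E * E :=
  ((- g.1.1, - g.1.2), (- g.2.1, - g.2.2)).
Definition pswap (g : E * E) : E * E := (g.2, g.1).
Definition pnrm2 (g : E * E) : R := nrm2 g.1 + nrm2 g.2.

Let mopp : measurable_fun setT (fun z : E => (- z.1, - z.2)).
Proof. by apply/measurable_fun_pair; apply: measurableT_comp. Qed.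

Let mpopp : measurable_fun setT popp.
Proof.
by apply/measurable_fun_pair; exact: (measurableT_comp mopp).
Qed.

Let mpswap : measurable_fun setT pswap.
Proof. exact/measurable_fun_pair. Qed.

Lemma measurable_pnrm2 : measurable_fun setT pnrm2.
Proof.
by apply: measurable_funD; apply: measurableT_comp => //; exact: measurable_nrm2.
Qed.

Lemma integral_popp (f : E * E -> \bar R) :
  measurable_fun setT f -> (forall g, (0 <= f g)%E) ->
  (\int[pgauss]_g f (popp g) = \int[pgauss]_g f g)%E.
Proof.
move=> mf f0; apply: (@integral_preserving R _ _ pgauss popp mpopp _ f mf f0).
move=> A mA.
exact: (@product_measure_preserving R _ _ _ _ (@cgauss R) (@cgauss R)
  _ _ mopp mopp (@cgauss_opp R) (@cgauss_opp R) A mA).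
Qed.

Lemma integral_pswap (f : E * E -> \bar R) :
  measurable_fun setT f -> (forall g, (0 <= f g)%E) ->
  (\int[pgauss]_g f (pswap g) = \int[pgauss]_g f g)%E.
Proof.
move=> mf f0; apply: (@integral_preserving R _ _ pgauss pswap mpswap _ f mf f0).
move=> A mA; exact: (@product_measure_swap R _ _ (@cgauss R) A mA).
Qed.

Lemma integral_pgauss_expR : exists K : R, 0 <= K /\
  (\int[pgauss]_g (expR (pnrm2 g / 2))%:E = K%:E)%E.
Proof.
have [K KE] := @integral_cgauss_expR_nrm2 R; exists (K * K).
split; first by rewrite -expr2 sqr_ge0.
have mg : measurable_fun setT (fun x : E => (expR (nrm2 x / 2))%:E).
  apply/measurable_EFinP; apply: measurableT_comp => //.
  by apply: measurable_funM => //; exact: measurable_nrm2.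
rewrite /pgauss fubini_tonelli1//=; last first.
  apply/measurable_EFinP; apply: measurableT_comp => //.
  by apply: measurable_funM => //; exact: measurable_pnrm2.
rewrite /fubini_F.
transitivity (\int[@cgauss R]_x ((expR (nrm2 x / 2))%:E * K%:E))%E.
  apply: eq_integral => x _; rewrite -KE -ge0_integralZl//.
  apply: eq_integral => y _ /=.
  by rewrite /pnrm2/= mulrDl expRD.
rewrite ge0_integralZr//; first by rewrite KE.
rewrite -KE; apply: integral_ge0 => x _; by rewrite lee_fin expR_ge0.
Qed.

(** Sum over the four-element group generated by the commuting involutions [popp] and [pswap]. *)
Definition sym4 (f : E * E -> R) g :=
  f g + f (popp g) + (f (pswap g) + f (popp (pswap g))).

Lemma integral_sym4 (f : E * E -> R) :
  measurable_fun setT f -> (forall g, 0 <= f g) ->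
  (\int[pgauss]_g (sym4 f g)%:E = 4%:E * \int[pgauss]_g (f g)%:E)%E.
Proof.
move=> mf f0.
have mfo : measurable_fun setT (fun g => f (popp g)) by exact: measurableT_comp.
have mfs : measurable_fun setT (fun g => f (pswap g)) by exact: measurableT_comp.
have mfos : measurable_fun setT (fun g => f (popp (pswap g))).
  exact: (measurableT_comp mfo).
under eq_integral do rewrite /sym4 !EFinD.
rewrite ge0_integralD//; first last.
- by apply: emeasurable_funD; exact/measurable_EFinP.
- by move=> g _; rewrite -EFinD lee_fin addr_ge0.
- by apply: emeasurable_funD; exact/measurable_EFinP.
- by move=> g _; rewrite -EFinD lee_fin addr_ge0.
rewrite !ge0_integralD//; try exact/measurable_EFinP; try by move=> *; rewrite /= lee_fin.
rewrite (integral_popp (f := EFin \o f))//;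
  try exact/measurable_EFinP; try by move=> *; rewrite /= lee_fin.
rewrite (integral_pswap (f := EFin \o (f \o popp)))//;
  try exact/measurable_EFinP; try by move=> *; rewrite /= lee_fin.
rewrite (integral_pswap (f := EFin \o f))//;
  try exact/measurable_EFinP; try by move=> *; rewrite /= lee_fin.
rewrite (integral_popp (f := EFin \o f))//;
  try exact/measurable_EFinP; try by move=> *; rewrite /= lee_fin.
have : (0 <= \int[pgauss]_g (f g)%:E)%E.
  by apply: integral_ge0 => g _; rewrite lee_fin.
(* The integral may be infinite, in which case both sides are [+oo]. *)
rewrite /=; case: (integral _ _ _) => [r| |] // r0.
  by rewrite -!EFinD -EFinM; congr EFin; ring.
  by rewrite mulry gtr0_sg// mul1e.
Qed.

(** The symmetries preserve [pgauss], so it is enough to bound the sum over the group pointwise,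
    where the cancellations are visible. *)
Lemma pair_average (K : R) :
  (\int[pgauss]_g (expR (pnrm2 g / 2))%:E = K%:E)%E ->
  forall (f : E * E -> R) (A eta : R), 0 <= A -> 0 <= eta ->
  measurable_fun setT f -> (forall g, 0 <= f g) ->
  (forall g, sym4 f g <= 4 * (A * (1 + eta * expR (pnrm2 g / 2)))) ->
  (\int[pgauss]_g (f g)%:E <= (A * (1 + eta * K))%:E)%E.
Proof.
move=> KE f A eta A0 eta0 mf f0 fA.
have me : measurable_fun setT (fun g : E * E => (expR (pnrm2 g / 2))%:E).
  apply/measurable_EFinP; apply: measurableT_comp => //.
  by apply: measurable_funM => //; exact: measurable_pnrm2.
rewrite -(@lee_pmul2l _ 4%:E) ?lte_fin//.
rewrite -integral_sym4//.
apply: (@le_trans _ _ (\int[pgauss]_g ((4 * A)%:E * (1%:E + eta%:E * (expR (pnrm2 g / 2))%:E))%E)%E).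
  apply: ge0_le_integralT => g.
    by rewrite lee_fin /sym4 !addr_ge0.
  by have := fA g; rewrite mulrA -lee_fin; exact.
rewrite ge0_integralZl//; first last.
- by rewrite lee_fin mulr_ge0.
- by move=> g _; rewrite -EFinM -EFinD lee_fin addr_ge0// mulr_ge0// expR_ge0.
- by apply: emeasurable_funD => //; apply: measurable_funeM.
rewrite ge0_integralD//; first last.
- exact: measurable_funeM.
- by move=> g _; rewrite -EFinM lee_fin mulr_ge0// expR_ge0.
rewrite integral_cst//; set t := (X in (1 * X + _)%E).
have -> : t = 1%E by exact: probability_setT.
rewrite mule1 ge0_integralZl// KE.
rewrite -[leLHS]/((4 * A * (1 + eta * K))%:E).
by rewrite -[leRHS]/((4 * (A * (1 + eta * K)))%:E) mulrA.
Qed.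

End pair_average.

(** * Conditional averaging over one pair of modes *)

Section cylinder.
Context {R : realType}.
Local Notation E := (R * R)%type.
Implicit Types (x : int -> E).

(* F depends measurably on the coordinates of index at most n; quantifying over
   all measurable spaces avoids an infinite product sigma-algebra. *)
Definition cylinder_measurable (n : nat) (F : (int -> E) -> R) : Prop :=
  forall d (T : measurableType d) (X : int -> T -> E),
  (forall j, (`|j| <= n)%N -> measurable_fun setT (X j)) ->
  measurable_fun setT (fun t => F (X ^~ t)).

Definition upd (n : int) (u : E) x : int -> E :=
  fun j => if j == n then u else x j.

Definition upd2 (n : nat) (g : E * E) x : int -> E :=
  upd n%:Z g.1 (upd (- n%:Z) g.2 x).

Context {d} {Om : measurableType d} (P : probability Om R) (X : int -> Om -> E).
Hypothesis mX : forall i, measurable_fun setT (X i).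
Hypothesis indX : independent_family P X.
Hypothesis lawX :
  forall i C, measurable C -> P (X i @^-1` C) = @cgauss R C.

(** The two new coordinates are integrated one at a time by [tower], and Tonelli joins the two
    integrals into one over the pair. *)
Lemma pair_tower n (F : (int -> E) -> R) :
  cylinder_measurable n.+1 F -> (forall x, 0 <= F x) ->
  (\int[P]_w (F (X ^~ w))%:E =
   \int[P]_w \int[pgauss]_g (F (upd2 n.+1 g (X ^~ w)))%:E)%E.
Proof.
move=> mF F0; set p : int := n.+1%:Z.
(* Mode -p is integrated first, so its past contains p in addition to the lower modes. *)
pose s := window n; pose s2 := p :: s.
have ps : p \notin s by rewrite mem_window; lia.
have us2 : uniq s2 by rewrite cons_uniq ps; exact: uniq_window.
have ms2 : - p \notin s2 by rewrite inE mem_window; lia.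
transitivity (\int[P]_w \int[@cgauss R]_v (F (upd (- p) v (X ^~ w)))%:E)%E.
  pose F1 : g_sigma_algebraType (past_events X s2) * E -> \bar R :=
    fun wv => (F (upd (- p) wv.2 (X ^~ (wv.1 : Om))))%:E.
  transitivity (\int[P]_w F1 (w, X (- p) w))%E.
    apply: eq_integral => w _; rewrite /F1/=; congr (F _)%:E.
    by apply/funext => j; rewrite /upd; case: eqP => [->|].
  rewrite (tower mX indX (@lawX (- p)) us2 ms2)//; last 2 first.
  + rewrite /F1; apply/measurable_EFinP.
    apply: (mF _ _ (fun j (wv : g_sigma_algebraType (past_events X s2) * E) =>
      if j == - p then wv.2 else X j wv.1)) => j jn.
    have [_|jp] := eqVneq j (- p); first exact: measurable_snd.
    have mXj : measurable_fun [set: g_sigma_algebraType (past_events X s2)] (X j).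
      apply: measurable_past; rewrite inE mem_window; apply/orP.
      have [?|?] := leqP (absz j) n; [by right|left].
      apply/eqP; move: jp => /eqP; rewrite /p; lia.
    exact: (measurableT_comp mXj).
  + by move=> x; rewrite lee_fin.
pose T := (g_sigma_algebraType (past_events X s) * E)%type.
have mF2 : measurable_fun [set: T * E]
    (fun wuv => (F (upd2 n.+1 (wuv.1.2, wuv.2) (X ^~ (wuv.1.1 : Om))))%:E).
  apply/measurable_EFinP.
  apply: (mF _ _ (fun j (wuv : T * E) =>
      if j == p then wuv.1.2 else if j == - p then wuv.2 else X j wuv.1.1)) => j jn.
  have [_|jp] := eqVneq j p.
    by apply: (measurableT_comp (f := snd)) => //; exact: measurable_fst.
  have [_|jmp] := eqVneq j (- p); first exact: measurable_snd.
  have mXj : measurable_fun [set: g_sigma_algebraType (past_events X s)] (X j).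
    apply: measurable_past; rewrite mem_window.
    by move: jp jmp jn => /eqP + /eqP; rewrite /p; lia.
  by apply: (measurableT_comp mXj); apply: (measurableT_comp (f := fst)).
pose F2 : T -> \bar R := fun wu =>
  (\int[@cgauss R]_v (F (upd2 n.+1 (wu.2, v) (X ^~ (wu.1 : Om))))%:E)%E.
transitivity (\int[P]_w F2 (w, X p w))%E.
  apply: eq_integral => w _; rewrite /F2/=; apply: eq_integral => v _.
  congr (F _)%:E; apply/funext => j; rewrite /upd2 /upd/=.
  by case: (j =P p) => [->|//]; case: eqP => //; rewrite /p; lia.
rewrite (tower mX indX (@lawX p) (uniq_window n) ps)//; last 2 first.
- apply: (measurable_fun_fubini_tonelli_F
    (fun wuv : T * E => (F (upd2 n.+1 (wuv.1.2, wuv.2) (X ^~ (wuv.1.1 : Om))))%:E)) => //.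
  by move=> x; rewrite lee_fin.
- by move=> x; apply: integral_ge0 => v _; rewrite lee_fin.
apply: eq_integral => w _; rewrite /pgauss [RHS]fubini_tonelli1//; last first.
  by move=> x; rewrite lee_fin.
  apply/measurable_EFinP.
  apply: (mF _ _ (fun j (uv : E * E) =>
      if j == p then uv.1 else if j == - p then uv.2 else X j w)) => j jn.
  by have [_|_] := eqVneq j p; [exact: measurable_fst|
     have [_|_] := eqVneq j (- p); [exact: measurable_snd|exact: measurable_cst]].
Qed.

(** The abstract supermartingale step: averaging turns the Gaussian factor into its moment [K], and
    [A x * (1 + eta x * K) <= F' x] closes the step. *)
Lemma pair_step n (K : R) (F F' A eta : (int -> E) -> R) :
  (\int[pgauss]_g (expR (pnrm2 g / 2))%:E = K%:E)%E ->
  cylinder_measurable n.+1 F -> (forall x, 0 <= F x) ->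
  (forall x, 0 <= A x) -> (forall x, 0 <= eta x) ->
  (forall x g, sym4 (fun g => F (upd2 n.+1 g x)) g <=
     4 * (A x * (1 + eta x * expR (pnrm2 g / 2)))) ->
  (forall x, A x * (1 + eta x * K) <= F' x) ->
  (\int[P]_w (F (X ^~ w))%:E <= \int[P]_w (F' (X ^~ w))%:E)%E.
Proof.
move=> KE mF F0 A0 eta0 FA AF'.
rewrite (pair_tower mF F0); apply: ge0_le_integralT => w.
  by apply: integral_ge0 => g _; rewrite lee_fin.
apply: (@le_trans _ _ (A (X ^~ w) * (1 + eta (X ^~ w) * K))%:E).
  apply: pair_average => //.
  apply: (mF _ _ (fun j (uv : E * E) =>
      if j == n.+1%:Z then uv.1 else if j == - n.+1%:Z then uv.2 else X j w)) => j jn.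
  by have [_|_] := eqVneq j n.+1%:Z; [exact: measurable_fst|
    have [_|_] := eqVneq j (- n.+1%:Z); [exact: measurable_snd|exact: measurable_cst]].
by rewrite lee_fin.
Qed.

End cylinder.

(** * Measurability of the functionals of the coefficients *)

Section complex_measurability.
Context {R : realType}.
Local Notation C := R[i].

Definition cmeasurable d (T : measurableType d) (F : T -> C) : Prop :=
  measurable_fun setT (fun t => complex.Re (F t)) /\
  measurable_fun setT (fun t => complex.Im (F t)).

Section closure.
Context d (T : measurableType d).
Implicit Types F G : T -> C.

Lemma cmeasurable_cst z : cmeasurable (fun _ : T => z).
Proof. by split; exact: measurable_cst. Qed.

Lemma cmeasurableM F G : cmeasurable F -> cmeasurable G ->
  cmeasurable (fun t => F t * G t).
Proof.
move=> [F1 F2] [G1 G2]; split.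
  under eq_fun do rewrite ReM.
  by apply: measurable_funB; exact: measurable_funM.
under eq_fun do rewrite ImM.
by apply: measurable_funD; exact: measurable_funM.
Qed.

Lemma cmeasurable_conj F : cmeasurable F -> cmeasurable (fun t => (F t)^*).
Proof.
move=> [F1 F2]; split; first by under eq_fun do rewrite Re_conj.
by under eq_fun do rewrite Im_conj; exact: measurable_funN.
Qed.

Lemma cmeasurable_sum (I : Type) (s : seq I) (F : I -> T -> C) :
  (forall i, cmeasurable (F i)) -> cmeasurable (fun t => \sum_(i <- s) F i t).
Proof.
move=> mF; split.
  under eq_fun do rewrite Re_sum.
  by apply: measurable_sum => i; have [] := mF i.
under eq_fun do rewrite Im_sum.
by apply: measurable_sum => i; have [] := mF i.
Qed.

Lemma measurable_sqn F : cmeasurable F -> measurable_fun setT (fun t => sqn (F t)).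
Proof.
by move=> [F1 F2]; apply: measurable_funD; exact: measurable_funX.
Qed.

Section coefficients.
Variable c : T -> int -> C.
Hypothesis mc : forall j, cmeasurable (c ^~ j).

Lemma measurable_conv L k : cmeasurable (fun t => conv L (c t) k).
Proof. by apply: cmeasurable_sum => j; exact: cmeasurableM. Qed.

Lemma measurable_potential L : measurable_fun setT (fun t => potential L (c t)).
Proof.
apply: measurable_funM => //.
have [] // : cmeasurable (fun t => energy L (c t)).
apply: cmeasurable_sum => k; apply: cmeasurableM; first exact: cmeasurable_cst.
by apply: cmeasurableM; [|apply: cmeasurable_conj]; exact: measurable_conv.
Qed.

Lemma measurable_cubic L i : cmeasurable (fun t => cubic L (c t) i).
Proof.
apply: cmeasurable_sum => k; apply: cmeasurableM; first exact: cmeasurable_cst.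
by apply: cmeasurableM; [exact: measurable_conv|exact: cmeasurable_conj].
Qed.

Lemma measurable_rmass L : measurable_fun setT (fun t => rmass L (c t)).
Proof. by apply: measurable_sum => k; exact: measurable_sqn. Qed.

Lemma measurable_rmomentum L : measurable_fun setT (fun t => rmomentum L (c t)).
Proof.
by apply: measurable_sum => k; apply: measurable_funM => //; exact: measurable_sqn.
Qed.

Lemma measurable_wmass n : measurable_fun setT (fun t => wmass (c t) n).
Proof.
by apply: measurable_sum => k; apply: measurable_funM => //; exact: measurable_sqn.
Qed.

Lemma measurable_wsextic n : measurable_fun setT (fun t => wsextic (c t) n).
Proof.
apply: measurable_sum => k; apply: measurable_funM.
  by apply: measurable_funM => //; exact: measurable_sqn.
by apply: measurable_funX; exact: measurable_wmass.
Qed.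

End coefficients.
End closure.

Definition amp (x : int -> R * R) (j : int) : C :=
  Complex ((x j).1 / jap j) ((x j).2 / jap j).

Lemma cmeasurable_trunc_amp n d (T : measurableType d) (X : int -> T -> R * R) :
  (forall j, (`|j| <= n)%N -> measurable_fun setT (X j)) ->
  forall k j, (k <= n)%N -> cmeasurable (fun t => trunc k (amp (X ^~ t)) j).
Proof.
move=> mX k j kn; rewrite /trunc; case: (boolP (`|j| <= k)%N) => jk;
  last exact: cmeasurable_cst.
have mXj := mX j (leq_trans jk kn).
by split; apply: measurable_funM => //; apply: measurableT_comp => //.
Qed.

End complex_measurability.

(** * Replacing a pair of Gaussians adds a pair of Fourier modes *)

Section mode_update.
Context {R : realType}.
Local Notation C := R[i].
Local Notation E := (R * R)%type.
Implicit Types (x : int -> E) (g : E * E).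

Definition zmode (n : nat) (u : E) : C :=
  Complex (u.1 / jap n%:Z) (u.2 / jap n%:Z).

Lemma japN (n : int) : jap (- n) = jap n :> R.
Proof. by rewrite /jap mulrNz sqrrN. Qed.

Lemma sqr_jap (n : nat) : jap n%:Z ^+ 2 = 1 + n%:R ^+ 2 :> R.
Proof. by rewrite sqr_sqrtr// addr_ge0// sqr_ge0. Qed.

Lemma trunc_upd2 n g x : trunc n.+1 (amp (upd2 n.+1 g x)) =
  updc n.+1 (zmode n.+1 g.1) (zmode n.+1 g.2) (trunc n (amp x)).
Proof.
apply/funext => j; rewrite /trunc /updc /amp /upd2 /upd.
have [->|j1] := eqVneq j n.+1%:Z; first by rewrite absz_nat leqnn.
have [->|j2] := eqVneq j (- n.+1%:Z); first by rewrite abszN absz_nat leqnn japN.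
have -> // : (`|j| <= n.+1)%N = (`|j| <= n)%N.
by apply/idP/idP; move/eqP: j1; move/eqP: j2; lia.
Qed.

Lemma trunc_upd2_le n k g x : (k <= n)%N ->
  trunc k (amp (upd2 n.+1 g x)) = trunc k (amp x).
Proof.
move=> kn; apply/funext => j; rewrite /trunc; case: ifP => // jk.
rewrite /amp /upd2 /upd.
have -> : j == n.+1%:Z = false by apply/eqP; lia.
by have -> : j == - n.+1%:Z = false by apply/eqP; lia.
Qed.

Lemma sqn_zmode n u : sqn (zmode n u) = nrm2 u / (1 + n%:R ^+ 2).
Proof.
by rewrite /sqn /zmode /= !expr_div_n sqr_jap -mulrDl.
Qed.

Lemma rmass_upd2 n g x : rmass n.+1 (amp (upd2 n.+1 g x)) =
  rmass n (amp x) + pnrm2 g / (1 + n.+1%:R ^+ 2).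
Proof.
rewrite -(@rmass_trunc _ n.+1)// trunc_upd2 rmass_updc//.
  by rewrite rmass_trunc// !sqn_zmode -mulrDl.
by move=> j h; rewrite /trunc leqNgt h.
Qed.

Lemma pnrm2_popp g : pnrm2 (popp g) = pnrm2 g.
Proof. by rewrite /pnrm2 /nrm2/= !sqrrN. Qed.

Lemma pnrm2_pswap g : pnrm2 (pswap g) = pnrm2 g.
Proof. by rewrite /pnrm2 addrC. Qed.

Lemma pnrm2_ge0 g : 0 <= pnrm2 g.
Proof. by rewrite /pnrm2 /nrm2 !addr_ge0 ?sqr_ge0. Qed.

End mode_update.

(** * First supermartingale: the compensated exponential of the potential *)

Section potential_supermartingale.
Context {R : realType}.
Local Notation C := R[i].
Local Notation E := (R * R)%type.
Variables (L : nat) (lam m K : R).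
Hypotheses (lam0 : 0 <= lam) (K0 : 0 <= K).
Hypothesis small : 192 * (lam * m) <= 1.
Implicit Types (x : int -> E) (g : E * E) (a : int -> C).

Definition cubic2 a (n : nat) : R :=
  (sqn (cubic L (trunc n a) n.+1%:Z) + sqn (cubic L (trunc n a) (- n.+1%:Z)))
  / n.+1%:R ^+ 2.

Definition momentum1 a (n : nat) : R :=
  `|rmomentum L (trunc n a)| / n.+1%:R ^+ 2.

(** The coefficient 8 t + 4 p + 64 q of [symmetrized_exp_bound], with t = 9 lam^2 [cubic2], p = 3
    lam [momentum1] and q = 1 / (n + 1)^2. *)
Definition comp_eta a n : R :=
  8 * (9 * lam ^+ 2 * cubic2 a n) + 4 * (3 * lam * momentum1 a n) +
  64 * (n.+1%:R ^+ 2)^-1.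

(** Exponent dominating the average exp(2 t) (1 + K eta) of one step, by 1 + x <= exp(x). It depends
    on the modes up to n only, hence is known before the pair n + 1 is drawn. *)
Definition compensator a n : R :=
  2 * (9 * lam ^+ 2 * cubic2 a n) + K * comp_eta a n.

(** The mass grows with n, so the cutoff at step n + 1 implies the cutoff at step n: the process is
    killed for good once its mass reaches m. *)
Definition potential_mart (n : nat) x : R :=
  if rmass n (amp x) < m then
    expR (lam * potential L (trunc n (amp x)) -
          \sum_(k < n) compensator (amp x) k)
  else 0.

Lemma potential_mart_ge0 n x : 0 <= potential_mart n x.
Proof. by rewrite /potential_mart; case: ifP => // _; exact: expR_ge0. Qed.

Lemma cubic2_ge0 a n : 0 <= cubic2 a n.
Proof. by rewrite divr_ge0 ?addr_ge0 ?sqn_ge0 ?sqr_ge0. Qed.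

Lemma momentum1_ge0 a n : 0 <= momentum1 a n.
Proof. by rewrite divr_ge0 ?sqr_ge0. Qed.

Lemma comp_eta_ge0 a n : 0 <= comp_eta a n.
Proof.
have h1 := cubic2_ge0 a n; have h2 := momentum1_ge0 a n.
have h3 : 0 <= (n.+1%:R ^+ 2)^-1 :> R by rewrite invr_ge0 sqr_ge0.
have h4 : 0 <= 9 * lam ^+ 2 * cubic2 a n by rewrite mulr_ge0// mulr_ge0// sqr_ge0.
have h5 : 0 <= 3 * lam * momentum1 a n by rewrite mulr_ge0// mulr_ge0.
by rewrite /comp_eta; apply: addr_ge0; [apply: addr_ge0|]; exact: mulr_ge0.
Qed.

Lemma potential_mart_sym4 n x g : (n.+1.*2 <= L)%N ->
  sym4 (fun g => potential_mart n.+1 (upd2 n.+1 g x)) g <=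
  4 * ((potential_mart n x * expR (- K * comp_eta (amp x) n)) *
       (1 + comp_eta (amp x) n * expR (pnrm2 g / 2))).
Proof.
move=> nL; have nL' : (n <= L)%N by lia.
set a := amp x; set N : R := n.+1%:R.
have N1 : 1 <= N by rewrite ler1n.
have mass_g g' : rmass n.+1 (amp (upd2 n.+1 g' x)) =
  rmass n a + pnrm2 g' / (1 + N ^+ 2) by exact: rmass_upd2.
set c := trunc n a.
have c0 j : (n.+1 <= `|j|)%N -> c j = 0 by move=> h; rewrite /c /trunc leqNgt h.
set rho := pnrm2 g / (1 + N ^+ 2).
have rho0 : 0 <= rho by rewrite divr_ge0 ?pnrm2_ge0// addr_ge0// sqr_ge0.
have RHS0 : 0 <= 4 * ((potential_mart n x * expR (- K * comp_eta a n)) *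
       (1 + comp_eta a n * expR (pnrm2 g / 2))).
  have h0 : 0 <= comp_eta a n * expR (pnrm2 g / 2).
    by rewrite mulr_ge0 ?expR_ge0 ?comp_eta_ge0.
  have h1 : 0 <= potential_mart n x * expR (- K * comp_eta a n).
    by rewrite mulr_ge0 ?expR_ge0 ?potential_mart_ge0.
  by apply: mulr_ge0 => //; apply: mulr_ge0 => //; exact: addr_ge0.
rewrite /sym4 /potential_mart !mass_g !pnrm2_popp !pnrm2_pswap -/rho.
(* The mass is invariant under the four symmetries, so the four terms pass the cutoff together or
   all vanish. *)
case: ifPn => [cut|_]; last by rewrite !addr0.
have Mm : rmass n a < m by apply: le_lt_trans cut; rewrite lerDl.
rewrite Mm.
pose S := \sum_(k < n) compensator a k.
have compE g' k : (k <= n)%N -> compensator (amp (upd2 n.+1 g' x)) k = compensator a k.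
  by move=> kn; rewrite /compensator /comp_eta /cubic2 /momentum1 !trunc_upd2_le.
have sumE g' : \sum_(k < n.+1) compensator (amp (upd2 n.+1 g' x)) k =
    S + compensator a n.
  rewrite big_ord_recr/= compE//; congr (_ + _).
  by apply: eq_bigr => k _; rewrite compE// ltnW.
rewrite !sumE !trunc_upd2 -/c.
set B := lam * potential L c - S.
pose lin (g' : E * E) := 3 * lam * (rdot (zmode n.+1 g'.1) (cubic L c n.+1%:Z) +
   rdot (zmode n.+1 g'.2) (cubic L c (- n.+1%:Z))).
pose anti (g' : E * E) := lam * (3 * N * (sqn (zmode n.+1 g'.1) - sqn (zmode n.+1 g'.2)) *
   (rmass n a + rho / 2)).
pose mom := lam * (3 * rmomentum L c * rho).
have expo g' : pnrm2 g' / (1 + N ^+ 2) = rho ->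
    lam * potential L (updc n.+1 (zmode n.+1 g'.1) (zmode n.+1 g'.2) c) -
    (S + compensator a n) = B - compensator a n + (lin g' + (anti g' + mom)).
  move=> rg; rewrite potential_updc//.
  have -> : sqn (zmode n.+1 g'.1) + sqn (zmode n.+1 g'.2) = rho.
    by rewrite !sqn_zmode -mulrDl -/(pnrm2 g').
  rewrite rmass_trunc//.
  by rewrite /lin /anti /mom /B -/N; ring.
rewrite !expo -/rho ?pnrm2_popp ?pnrm2_pswap//.
(* Averaging over the sign kills the linear term to first order, and averaging
   over the exchange of the modes n and -n does the same for [anti]. *)
have linN g' : lin (popp g') = - lin g'.
  rewrite /lin /popp/=.
  have z (u : E) : zmode n.+1 (- u.1, - u.2) = - zmode n.+1 u.
    by rewrite /zmode/= !mulNr.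
  by rewrite (z g'.1) (z g'.2) !rdotNl; ring.
have antiN g' : anti (popp g') = anti g'.
  by rewrite /anti /popp/= !sqn_zmode /nrm2/= !sqrrN.
have antiS : anti (pswap g) = - anti g by rewrite /anti /pswap/=; ring.
have factor (Y u v w y : R) :
    expR (Y + u) + expR (Y + v) + (expR (Y + w) + expR (Y + y)) =
    expR Y * (expR u + expR v + (expR w + expR y)) by rewrite !expRD; ring.
rewrite !linN !antiN antiS factor [expR (B - _)]expRD.
set e := expR B * expR (- compensator a n).
have e0 : 0 <= e by rewrite mulr_ge0 ?expR_ge0.
set t := 9 * lam ^+ 2 * cubic2 a n.
set p := 3 * lam * momentum1 a n.
set q := (N ^+ 2)^-1.
set G := pnrm2 g.
have G0 : 0 <= G by exact: pnrm2_ge0.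
have N20 : 0 < N ^+ 2 by rewrite exprn_gt0//; lra.
have rhoG : rho <= G / N ^+ 2.
  by rewrite ler_wpM2l// lef_pV2 ?posrE ?lerDr// ltr_pwDl// ltW.
have linG g' : pnrm2 g' = G -> lin g' ^+ 2 <= t * G.
  move=> gG; rewrite /lin exprMn.
  apply: (@le_trans _ _ ((3 * lam) ^+ 2 * ((sqn (zmode n.+1 g'.1) + sqn (zmode n.+1 g'.2)) *
      (sqn (cubic L c n.+1%:Z) + sqn (cubic L c (- n.+1%:Z)))))).
    by rewrite ler_wpM2l ?sqr_ge0// rdot_cauchy.
  rewrite !sqn_zmode -mulrDl -/(pnrm2 g') gG -/N -/rho.
  set w := sqn _ + sqn _; have w0 : 0 <= w by rewrite addr_ge0 ?sqn_ge0.
  have -> : t * G = (3 * lam) ^+ 2 * (G / N ^+ 2 * w).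
    by rewrite /t /cubic2 -/c -/w -/N; ring.
  by rewrite ler_wpM2l ?sqr_ge0// ler_wpM2r.
(* Origin of 192 = 3 * 64: both [anti] and [mom] are at most 3 lam m G and must stay below G /
   64. *)
have lm : 3 * lam * m <= 1 / 64 by move: small; lra.
have m0 : 0 <= m by apply: ltW; apply: le_lt_trans Mm; exact: rmass_ge0.
have GN : G / N <= G by rewrite ler_pdivrMr ?ler_peMr//; lra.
have GN0 : 0 <= G / N by rewrite divr_ge0//; lra.
have NrhoG : N * rho <= G / N.
  have -> : G / N = N * (G / N ^+ 2) by field; rewrite gt_eqF//; lra.
  by rewrite ler_wpM2l//; lra.
have Nrho0 : 0 <= N * rho by rewrite mulr_ge0//; lra.
have lm0 : 0 <= 3 * lam * m by rewrite !mulr_ge0.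
have antiG : `|anti g| <= 3 * lam * m * (G / N).
  rewrite /anti.
  have d1 : `|sqn (zmode n.+1 g.1) - sqn (zmode n.+1 g.2)| <= rho.
    have -> : rho = sqn (zmode n.+1 g.1) + sqn (zmode n.+1 g.2).
      by rewrite !sqn_zmode -mulrDl -/(pnrm2 g).
    have := sqn_ge0 (zmode n.+1 g.1); have := sqn_ge0 (zmode n.+1 g.2).
    by move=> ? ?; rewrite ler_norml; lra.
  have d2 : `|rmass n a + rho / 2| <= m.
    by have := rmass_ge0 n a; move: cut => ? ?; rewrite ger0_norm; lra.
  rewrite !normrM (ger0_norm lam0) (@ger0_norm _ 3)// (@ger0_norm _ N); last by lra.
  apply: (@le_trans _ _ (lam * (3 * N * rho * m))).
    have n3 : 0 <= 3 * N by lra.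
    apply: ler_wpM2l => //; apply: ler_pM => //; first by apply: mulr_ge0.
    by apply: ler_wpM2l.
  have -> : lam * (3 * N * rho * m) = 3 * lam * m * (N * rho) by ring.
  by rewrite ler_wpM2l.
have aG : `|anti g| <= G / 64.
  apply: (le_trans antiG); apply: (le_trans (ler_pM lm0 GN0 lm GN)).
  by rewrite mul1r mulrC.
(* [anti] is only of order G / N, but its square has the summable factor 1 / N^2. *)
have aG2 : anti g ^+ 2 <= q * G ^+ 2.
  rewrite -(real_normK (num_real (anti g))).
  have -> : q * G ^+ 2 = (G / N) ^+ 2 by rewrite /q; field; rewrite gt_eqF//; lra.
  rewrite lerXn2r ?nnegrE//; apply: (le_trans antiG).
  by rewrite ler_piMl//; lra.
have P1 : `|rmomentum L c| <= N * m.
  apply: (le_trans (@norm_rmomentum _ L n c _)).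
    by move=> j h; exact: c0.
  have -> : rmass L c = rmass n a by exact: rmass_trunc.
  have nN : n%:R <= N by rewrite /N ler_nat.
  by apply: ler_pM => //; [exact: rmass_ge0|exact: ltW].
have momG : `|mom| <= 3 * lam * `|rmomentum L c| * rho.
  have -> : mom = 3 * lam * rho * rmomentum L c by rewrite /mom; ring.
  have r0 : 0 <= 3 * lam * rho by rewrite mulr_ge0// mulr_ge0.
  by rewrite normrM (ger0_norm r0) mulrAC.
have bG : `|mom| <= G / 64.
  apply: (le_trans momG).
  apply: (@le_trans _ _ (3 * lam * (N * m) * rho)).
    by rewrite ler_wpM2r// ler_wpM2l// mulr_ge0.
  have -> : 3 * lam * (N * m) * rho = 3 * lam * m * (N * rho) by ring.
  apply: (le_trans (ler_wpM2l lm0 NrhoG)).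
  apply: (le_trans (ler_pM lm0 GN0 lm GN)).
  by rewrite mul1r mulrC.
have bpG : `|mom| <= p * G.
  apply: (le_trans momG).
  have -> : p * G = 3 * lam * `|rmomentum L c| * (G / N ^+ 2).
    by rewrite /p /momentum1 -/c -/N; ring.
  by rewrite ler_wpM2l// !mulr_ge0.
have t0 : 0 <= t.
  have := cubic2_ge0 a n; rewrite /t => ?.
  by apply: mulr_ge0 => //; apply: mulr_ge0 => //; exact: sqr_ge0.
have p0 : 0 <= p.
  have := momentum1_ge0 a n; rewrite /p => ?.
  by apply: mulr_ge0 => //; exact: mulr_ge0.
have q0 : 0 <= q by rewrite invr_ge0 ltW.
have key := symmetrized_exp_bound G0 t0 p0 q0 (linG g erefl)
  (linG (pswap g) (pnrm2_pswap g)) aG aG2 bG bpG.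
apply: (le_trans (ler_wpM2l e0 key)).
have -> : comp_eta a n = 8 * t + 4 * p + 64 * q by [].
rewrite /e /compensator -/t.
have -> : comp_eta a n = 8 * t + 4 * p + 64 * q by [].
set eta := 8 * t + 4 * p + 64 * q.
have -> : - (2 * t + K * eta) = - (2 * t) + - K * eta by ring.
rewrite (expRD (- (2 * t))).
have tt : expR (- (2 * t)) * expR (2 * t) = 1 by rewrite -expRD addNr expR0.
(* The part 2 t of the compensator cancels the factor exp(2 t) of the one-step estimate; the part K
   eta is spent in [potential_mart_step_le]. *)
set f := 1 + eta * _; set u := expR (- K * eta).
rewrite le_eqVlt; apply/orP; left; apply/eqP.
have -> : expR B * (expR (- (2 * t)) * u) * (4 * (expR (2 * t) * f)) =
  (expR (- (2 * t)) * expR (2 * t)) * (4 * (expR B * u * f)) by ring.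
by rewrite tt mul1r.
Qed.

Lemma potential_mart_step_le n x :
  (potential_mart n x * expR (- K * comp_eta (amp x) n)) * (1 + comp_eta (amp x) n * K) <=
  potential_mart n x.
Proof.
rewrite -mulrA ler_piMr ?potential_mart_ge0//.
apply: (@le_trans _ _ (expR (- K * comp_eta (amp x) n) * expR (comp_eta (amp x) n * K))).
  by rewrite ler_wpM2l ?expR_ge0// expR_ge1Dx.
by rewrite -expRD mulNr [K * _]mulrC addNr expR0.
Qed.

Lemma potential_mart_measurable n : cylinder_measurable n (potential_mart n).
Proof.
move=> d T X mX.
have mt k j : (k <= n)%N -> cmeasurable (fun t => trunc k (amp (X ^~ t)) j).
  by move=> kn; exact: (cmeasurable_trunc_amp mX).
apply: measurable_fun_ifT.
- apply: measurable_fun_ltr => //.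
  under eq_fun do rewrite -(@rmass_trunc _ n n)//.
  by apply: measurable_rmass => j; exact: mt.
- apply: measurableT_comp => //; apply: measurable_funB.
    by apply: measurable_funM => //; apply: measurable_potential => j; exact: mt.
  apply: measurable_sum => k; have kn := ltnW (ltn_ord k).
  have mc : measurable_fun setT (fun t => cubic2 (amp (X ^~ t)) k).
    apply: measurable_funM => //; apply: measurable_funD;
      by apply: measurable_sqn; apply: measurable_cubic => j; exact: mt.
  have mm : measurable_fun setT (fun t => momentum1 (amp (X ^~ t)) k).
    apply: measurable_funM => //; apply: measurableT_comp => //.
    by apply: measurable_rmomentum => j; exact: mt.
  have mcl : measurable_fun setT (fun t => 9 * lam ^+ 2 * cubic2 (amp (X ^~ t)) k).
    exact: measurable_funM.
  apply: measurable_funD; first exact: measurable_funM.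
  apply: measurable_funM => //; apply: measurable_funD => //.
  apply: measurable_funD; first exact: measurable_funM.
  by apply: measurable_funM => //; exact: measurable_funM.
- exact: measurable_cst.
Qed.

End potential_supermartingale.

(** * Second supermartingale: exponential integrability of the sextic functional *)

Section sextic_supermartingale.
Context {R : realType}.
Local Notation C := R[i].
Local Notation E := (R * R)%type.
Local Notation wt := (@wt R).
Variables (m K c A B : R).
Hypotheses (K0 : 0 <= K) (c0 : 0 <= c).
Hypotheses (cA : 8 * (K * lyap_const) * c <= A).
Hypotheses (AB : 16 * (K * lyap_const) * A <= B).
Hypotheses (m1 : m <= 1) (smallA : (8 * c + 6 * A) * m <= 1 / 4).
Hypothesis smallB : B * m <= 1.
Implicit Types (x : int -> E) (g : E * E) (a : int -> C).

(** The remainder of [lyapunov_gap] at step n, of order (n + 2)^{-2}. *)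
Definition lyap_drift (n : nat) : R :=
  K * lyap_const * (16 * c + 4 * A + 2 * B) / wt n.+1 ^+ 8.

Definition lyap a n : R :=
  A * wmass a n ^+ 2 / wt n ^+ 2 + B * wmass a n / wt n ^+ 3.

Definition sextic_mart (n : nat) x : R :=
  if rmass n (amp x) < m then
    expR (c * wsextic (amp x) n + lyap (amp x) n - \sum_(k < n) lyap_drift k)
  else 0.

Lemma sextic_mart_ge0 n x : 0 <= sextic_mart n x.
Proof. by rewrite /sextic_mart; case: ifP => // _; exact: expR_ge0. Qed.

Lemma lyap_const_ge0 : 0 <= @lyap_const R.
Proof. by rewrite /lyap_const mulr_ge0 ?expR_ge0 ?ler0n. Qed.

Lemma lyapA_ge0 : 0 <= A.
Proof.
have k0 := lyap_const_ge0; apply: le_trans cA.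
by apply: mulr_ge0 => //; apply: mulr_ge0 => //; exact: mulr_ge0.
Qed.

Lemma lyapB_ge0 : 0 <= B.
Proof.
have k0 := lyap_const_ge0; have A0 := lyapA_ge0; apply: le_trans AB.
by apply: mulr_ge0 => //; apply: mulr_ge0 => //; exact: mulr_ge0.
Qed.

Lemma wmass_ge0 a n : 0 <= wmass a n.
Proof.
by apply: sumr_ge0 => j _; rewrite mulr_ge0 ?sqn_ge0// exprn_ge0// wt_ge0.
Qed.

Lemma wmass_le a n : wmass a n <= wt n ^+ 3 * rmass n a.
Proof.
rewrite /wmass /rmass mulr_sumr; apply: ler_sum_seq => j; rewrite mem_window => jn.
by rewrite ler_wpM2r ?sqn_ge0// lerXn2r ?nnegrE ?wt_ge0// wt_le.
Qed.

Lemma eq_trunc_wmass n a b : trunc n a = trunc n b ->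
  forall k, (k <= n)%N -> wmass a k = wmass b k.
Proof.
move=> ab k kn; apply: eq_big_seq => j; rewrite mem_window => jk.
have := congr1 (fun f => f j) ab; rewrite /trunc (leq_trans jk kn).
by move=> ->.
Qed.

Lemma eq_trunc_wsextic n a b : trunc n a = trunc n b -> wsextic a n = wsextic b n.
Proof.
move=> ab; apply: eq_big_seq => j; rewrite mem_window => jn.
have := congr1 (fun f => f j) ab; rewrite /trunc jn => ->.
by rewrite (eq_trunc_wmass ab jn).
Qed.

Lemma sqn_upd2 n g x :
  sqn (amp (upd2 n.+1 g x) n.+1%:Z) + sqn (amp (upd2 n.+1 g x) (- n.+1%:Z)) =
  pnrm2 g / (1 + n.+1%:R ^+ 2).
Proof.
have := rmass_upd2 n g x; rewrite rmassS.
have -> : rmass n (amp (upd2 n.+1 g x)) = rmass n (amp x).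
  by rewrite -(@rmass_trunc _ n n)// trunc_upd2_le// rmass_trunc.
by move/addrI.
Qed.

Lemma wmass_upd2 n g x : wmass (amp (upd2 n.+1 g x)) n.+1 =
  wmass (amp x) n + wt n.+1 ^+ 3 * (pnrm2 g / (1 + n.+1%:R ^+ 2)).
Proof.
rewrite /wmass big_windowS abszN absz_nat -mulrDr sqn_upd2; congr (_ + _).
exact: (eq_trunc_wmass (trunc_upd2_le g x (leqnn n))).
Qed.

Lemma wsextic_upd2 n g x : wsextic (amp (upd2 n.+1 g x)) n.+1 =
  wsextic (amp x) n + wt n.+1 ^+ 2 * (pnrm2 g / (1 + n.+1%:R ^+ 2)) *
   (wmass (amp x) n + wt n.+1 ^+ 3 * (pnrm2 g / (1 + n.+1%:R ^+ 2))) ^+ 2.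
Proof.
rewrite /wsextic big_windowS abszN absz_nat -mulrDl -mulrDr sqn_upd2.
rewrite -wmass_upd2; congr (_ + _).
exact: (eq_trunc_wsextic (trunc_upd2_le g x (leqnn n))).
Qed.

Lemma lyap_eta_ge0 q D : 0 <= q -> 0 <= D -> 0 <= lyap_eta c A B q D.
Proof.
move=> q0 D0; have A0 := lyapA_ge0; have B0 := lyapB_ge0.
have h k : 0 <= (q ^+ k)^-1 by rewrite invr_ge0 exprn_ge0.
apply: mulr_ge0; first exact: lyap_const_ge0.
apply: addr_ge0; first apply: addr_ge0; apply: mulr_ge0 => //.
- by apply: mulr_ge0; [exact: mulr_ge0|exact: sqr_ge0].
- by rewrite !mulr_ge0.
- by rewrite !addr_ge0// mulr_ge0.
Qed.

Lemma sextic_mart_upd2_le n x g : sextic_mart n.+1 (upd2 n.+1 g x) <=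
  sextic_mart n x * expR (- lyap_gap A B (wt n.+1) (wmass (amp x) n)) * expR (- lyap_drift n) *
  (1 + lyap_eta c A B (wt n.+1) (wmass (amp x) n) * expR (pnrm2 g / 2)).
Proof.
set D := wmass (amp x) n; set G := pnrm2 g.
have A0 := lyapA_ge0; have B0 := lyapB_ge0.
have G0 : 0 <= G by exact: pnrm2_ge0.
have D0 : 0 <= D by exact: wmass_ge0.
have eta0 : 0 <= lyap_eta c A B (wt n.+1) D by apply: lyap_eta_ge0 => //; exact: wt_ge0.
rewrite {1}/sextic_mart rmass_upd2 -/G.
set rho := G / (1 + n.+1%:R ^+ 2).
have den0 : 0 < 1 + n.+1%:R ^+ 2 :> R by rewrite ltr_pwDl// sqr_ge0.
have rho0 : 0 <= rho by rewrite divr_ge0// ltW.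
case: ifPn => [cut|_]; last first.
  apply: mulr_ge0; first by rewrite !mulr_ge0 ?sextic_mart_ge0 ?expR_ge0.
  by apply: addr_ge0 => //; apply: mulr_ge0 => //; exact: expR_ge0.
have Mm : rmass n (amp x) < m by apply: le_lt_trans cut; rewrite lerDl.
have rm : rho <= m by have := rmass_ge0 n (amp x); lra.
rewrite /sextic_mart Mm wsextic_upd2 /lyap wmass_upd2 -/G -/rho -/D big_ord_recr/=.
set S := \sum_(k < n) lyap_drift k; set W := wsextic _ _.
have p1 := @wt_ge1 R n; have pq := @wt_le R _ _ (leqnSn n).
have e : wt n.+1 ^+ 4 = wt n ^+ 4 + 1 by rewrite !wt4 -natr1.
have Dm : D <= wt n ^+ 3 * m.
  apply: (le_trans (wmass_le _ _)).
  by rewrite ler_wpM2l ?exprn_ge0 ?wt_ge0// ltW.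
(* With y = n + 1 this is (y + 1)^2 <= 2 (1 + y^2). *)
have rG : rho * wt n.+1 ^+ 8 <= 2 * G.
  rewrite (exprM _ 4 2) wt4 /rho mulrAC ler_pdivrMr// mulrAC mulrC.
  rewrite ler_wpM2r//.
  have h : n.+2%:R = n.+1%:R + 1 :> R by rewrite -natr1.
  have x1 : 1 <= n.+1%:R :> R by rewrite ler1n.
  rewrite h; set y := n.+1%:R in x1 *.
  have : 0 <= (y - 1) ^+ 2 by exact: sqr_ge0.
  have -> : (y - 1) ^+ 2 = y ^+ 2 - 2 * y + 1 by ring.
  have -> : (y + 1) ^+ 2 = y ^+ 2 + 2 * y + 1 by ring.
  lra.
have key := lyapunov_bound p1 pq e c0 A0 B0 m1 smallA smallB D0 Dm rho0 rm rG G0.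
set T := c * (W + _) + _ - _.
have -> : T = (c * W - S - lyap_drift n) + (c * (wt n.+1 ^+ 2 * rho * (D + wt n.+1 ^+ 3 * rho) ^+ 2) +
  A * (D + wt n.+1 ^+ 3 * rho) ^+ 2 / wt n.+1 ^+ 2 +
  B * (D + wt n.+1 ^+ 3 * rho) / wt n.+1 ^+ 3) by rewrite /T; ring.
rewrite expRD; apply: (le_trans (ler_wpM2l (expR_ge0 _) key)).
rewrite mulrA -expRD -!expRD le_eqVlt; apply/orP; left; apply/eqP.
congr (expR _ * _); ring.
Qed.

(** The bound depends on g only through [pnrm2 g], so it is the same for the four symmetric copies;
    no cancellation is involved. *)
Lemma sextic_mart_sym4 n x g :
  sym4 (fun g => sextic_mart n.+1 (upd2 n.+1 g x)) g <=
  4 * ((sextic_mart n x * expR (- lyap_gap A B (wt n.+1) (wmass (amp x) n)) *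
         expR (- lyap_drift n)) *
       (1 + lyap_eta c A B (wt n.+1) (wmass (amp x) n) * expR (pnrm2 g / 2))).
Proof.
rewrite /sym4.
have h1 := sextic_mart_upd2_le n x g.
have h2 := sextic_mart_upd2_le n x (popp g).
have h3 := sextic_mart_upd2_le n x (pswap g).
have h4 := sextic_mart_upd2_le n x (popp (pswap g)).
rewrite !(pnrm2_popp, pnrm2_pswap) in h2 h3 h4.
set U := _ * (1 + _) in h1 h2 h3 h4 *.
lra.
Qed.

Lemma sextic_mart_step_le n x :
  (sextic_mart n x * expR (- lyap_gap A B (wt n.+1) (wmass (amp x) n)) *
         expR (- lyap_drift n)) *
  (1 + lyap_eta c A B (wt n.+1) (wmass (amp x) n) * K) <= sextic_mart n x.
Proof.
have h := @lyapunov_gap _ K c A B (wt n.+1) (wmass (amp x) n) (wt_gt0 _)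
  K0 c0 (wmass_ge0 _ _) cA AB.
set u := expR (- lyap_gap _ _ _ _) in h *; set v := 1 + _ in h *.
have -> : sextic_mart n x * u * expR (- lyap_drift n) * v = sextic_mart n x * (expR (- lyap_drift n) * (u * v)).
  by ring.
rewrite ler_piMr ?sextic_mart_ge0//.
apply: (le_trans (ler_wpM2l (expR_ge0 _) h)).
by rewrite -expRD addNr expR0.
Qed.

Lemma sextic_mart_measurable n : cylinder_measurable n (sextic_mart n).
Proof.
move=> d T X mX.
have mt j : cmeasurable (fun t => trunc n (amp (X ^~ t)) j).
  exact: (cmeasurable_trunc_amp mX).
have truncK a : trunc n (trunc n a) = trunc n a.
  by apply/funext => j; rewrite /trunc; case: ifP => // ->.
have mw : measurable_fun setT (fun t => wmass (amp (X ^~ t)) n).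
  under eq_fun do rewrite -(eq_trunc_wmass (truncK _) (leqnn n)).
  exact: measurable_wmass.
apply: measurable_fun_ifT.
- apply: measurable_fun_ltr => //.
  under eq_fun do rewrite -(@rmass_trunc _ n n)//.
  exact: measurable_rmass.
- apply: measurableT_comp => //; apply: measurable_funB => //.
  apply: measurable_funD.
    apply: measurable_funM => //.
    under eq_fun do rewrite -(eq_trunc_wsextic (truncK _)).
    exact: measurable_wsextic.
  apply: measurable_funD; apply: measurable_funM => //; apply: measurable_funM => //.
  exact: measurable_funX.
- exact: measurable_cst.
Qed.

End sextic_supermartingale.

(** * Calculus on the torus, componentwise in the complex plane *)

Section torus_calculus.
Context {R : realType}.
Local Notation C := R[i].
Implicit Types (F G : R -> C) (f g : R -> R).

Let mT : measurable (Tset : set R).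
Proof. exact: measurable_itv. Qed.

Let integrableT f : continuous f ->
  (@lebesgue_measure R).-integrable (Tset : set R) (EFin \o f).
Proof.
move=> cf; apply: continuous_compact_integrable; first exact: segment_compact.
by apply: continuous_subspaceT => x; exact: cf.
Qed.

Lemma intTD f g : continuous f -> continuous g ->
  intT (fun x => f x + g x) = intT f + intT g.
Proof.
move=> cf cg; rewrite /intT -mulrDr; congr (_ * _).
by rewrite RintegralD//; exact: integrableT.
Qed.

Lemma intTZ r f : continuous f -> intT (fun x => r * f x) = r * intT f.
Proof.
move=> cf; rewrite /intT mulrCA; congr (_ * _).
by rewrite RintegralZl//; exact: integrableT.
Qed.

Lemma intT_ge0 f : (forall x, 0 <= f x) -> 0 <= intT f.
Proof.
move=> f0; rewrite /intT mulr_ge0 ?invr_ge0 ?mulr_ge0 ?pi_ge0//.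
by apply: Rintegral_ge0 => x _.
Qed.

Definition ccont F : Prop :=
  continuous (fun x => complex.Re (F x)) /\ continuous (fun x => complex.Im (F x)).

Lemma ccontD F G : ccont F -> ccont G -> ccont (fun x => F x + G x).
Proof.
move=> [F1 F2] [G1 G2]; split => x.
  by under eq_fun do rewrite ReD; apply: cvgD; [exact: F1|exact: G1].
by under eq_fun do rewrite ImD; apply: cvgD; [exact: F2|exact: G2].
Qed.

Lemma ccontZ z F : ccont F -> ccont (fun x => z * F x).
Proof.
move=> [F1 F2]; split => x.
  under eq_fun do rewrite ReM.
  by apply: cvgB; apply: cvgMr; [exact: F1|exact: F2].
under eq_fun do rewrite ImM.
by apply: cvgD; apply: cvgMr; [exact: F2|exact: F1].
Qed.

Lemma ccont0 : ccont (fun=> 0).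
Proof. by split => x; exact: cvg_cst. Qed.

Lemma ccont_sum (I : Type) (s : seq I) (F : I -> R -> C) :
  (forall i, ccont (F i)) -> ccont (fun x => \sum_(i <- s) F i x).
Proof.
move=> cF; elim: s => [|i s IH].
  by rewrite (_ : (fun _ => _) = fun=> 0); [exact: ccont0|apply/funext => x; rewrite big_nil].
rewrite (_ : (fun _ => _) = fun x => F i x + \sum_(j <- s) F j x).
  exact: ccontD.
by apply/funext => x; rewrite big_cons.
Qed.

Lemma cintTD F G : ccont F -> ccont G ->
  cintT (fun x => F x + G x) = cintT F + cintT G.
Proof.
move=> [F1 F2] [G1 G2]; apply: complex_ext; rewrite ?ReD ?ImD /=.
  by under eq_fun do rewrite ReD; exact: intTD.
by under eq_fun do rewrite ImD; exact: intTD.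
Qed.

Lemma cintTZ z F : ccont F -> cintT (fun x => z * F x) = z * cintT F.
Proof.
move=> [F1 F2]; apply: complex_ext; rewrite ?ReM ?ImM /=.
  under eq_fun do rewrite ReM -mulNr.
  rewrite intTD; first by rewrite !intTZ// mulNr.
  - by move=> x; apply: cvgMr; exact: F1.
  - by move=> x; apply: cvgMr; exact: F2.
under eq_fun do rewrite ImM.
rewrite intTD; first by rewrite !intTZ.
- by move=> x; apply: cvgMr; exact: F2.
- by move=> x; apply: cvgMr; exact: F1.
Qed.

Lemma cintT_sum (I : Type) (s : seq I) (F : I -> R -> C) :
  (forall i, ccont (F i)) ->
  cintT (fun x => \sum_(i <- s) F i x) = \sum_(i <- s) cintT (F i).
Proof.
move=> cF; elim: s => [|i s IH].
  rewrite big_nil (_ : (fun _ => _) = fun=> 0 * 0).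
    rewrite (cintTZ 0 ccont0) mul0r//.
  by apply/funext => x; rewrite big_nil mul0r.
rewrite big_cons -IH -cintTD//; last exact: ccont_sum.
by congr cintT; apply/funext => x; rewrite big_cons.
Qed.

Lemma expiD (s t : R) : expi (s + t) = expi s * expi t.
Proof.
by apply: complex_ext; rewrite ?ReM ?ImM /= ?cosD ?sinD//; rewrite addrC [sin s * _]mulrC.
Qed.

Lemma expi0 : expi (0 : R) = 1.
Proof. by rewrite /expi cos0 sin0. Qed.

Lemma expi_conj (t : R) : (expi t)^* = expi (- t).
Proof. by apply: complex_ext; rewrite ?Re_conj ?Im_conj /= ?cosN ?sinN. Qed.

Lemma expi_2pi (k : int) : expi (k%:~R * (2 * pi)) = 1 :> C.
Proof.
have nat_case (n : nat) : expi (n%:R * (2 * pi)) = 1 :> C.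
  elim: n => [|n IH]; first by rewrite mul0r expi0.
  rewrite -natr1 mulrDl mul1r expiD IH mul1r mulr_natl /expi cos2pi sin2pi//.
case: k => n; first exact: nat_case.
by rewrite NegzE mulrNz mulNr -expi_conj (nat_case n.+1) conjC1.
Qed.

Let is_derive_mulc (k x : R) : is_derive x 1 (fun y => k * y) k.
Proof.
rewrite -[X in is_derive _ _ _ X]mulr1.
exact: is_deriveZ.
Qed.

Let is_derive_cosk (k x : R) : is_derive x 1 (fun y => cos (k * y)) (- (k * sin (k * x))).
Proof.
rewrite (_ : - _ = (- sin (k * x)) * k); last by ring.
exact: (@is_derive1_comp R cos (fun y => k * y) x _ _ (is_derive_cos _)
  (is_derive_mulc k x)).
Qed.

Let is_derive_sink (k x : R) : is_derive x 1 (fun y => sin (k * y)) (k * cos (k * x)).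
Proof.
rewrite [k * cos _]mulrC.
exact: (@is_derive1_comp R sin (fun y => k * y) x _ _ (is_derive_sin _)
  (is_derive_mulc k x)).
Qed.

Lemma ccont_expi (k : R) : ccont (fun x => expi (k * x)).
Proof.
by split => x /=; apply: differentiable_continuous; apply/derivable1_diffP;
  apply: ex_derive.
Qed.

Definition cderive F (x : R) (D : C) : Prop :=
  is_derive x 1 (fun y : R => complex.Re (F y)) (complex.Re D) /\
  is_derive x 1 (fun y : R => complex.Im (F y)) (complex.Im D).

Lemma dxE F x D : cderive F x D -> dx F x = D.
Proof.
move=> [d1 d2]; apply: complex_ext; rewrite /= derive1E.
  by rewrite (@derive_val _ _ _ _ _ _ _ d1).
by rewrite (@derive_val _ _ _ _ _ _ _ d2).
Qed.

Lemma cderiveZ z F x D : cderive F x D -> cderive (fun y => z * F y) x (z * D).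
Proof.
move=> [d1 d2]; split; rewrite ?ReM ?ImM.
  under eq_fun do rewrite ReM.
  by apply: is_deriveB.
under eq_fun do rewrite ImM.
by apply: is_deriveD.
Qed.

Lemma cderive_sum (I : Type) (s : seq I) (F : I -> R -> C) x (D : I -> C) :
  (forall i, cderive (F i) x (D i)) ->
  cderive (fun y => \sum_(i <- s) F i y) x (\sum_(i <- s) D i).
Proof.
move=> dF; elim: s => [|i s [IH1 IH2]].
  rewrite big_nil; split; rewrite (_ : (fun _ => _) = cst 0);
    try exact: is_derive_cst; by apply/funext => y; rewrite big_nil.
have [d1 d2] := dF i.
rewrite big_cons; split; rewrite ?ReD ?ImD.
  rewrite (_ : (fun _ => _) = (fun y => complex.Re (F i y)) \+
    (fun y => complex.Re (\sum_(j <- s) F j y))); first exact: is_deriveD.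
  by apply/funext => y; rewrite big_cons ReD.
rewrite (_ : (fun _ => _) = (fun y => complex.Im (F i y)) \+
  (fun y => complex.Im (\sum_(j <- s) F j y))); first exact: is_deriveD.
by apply/funext => y; rewrite big_cons ImD.
Qed.

Lemma cderive_expi (k x : R) :
  cderive (fun y => expi (k * y)) x (Complex 0 k * expi (k * x)).
Proof.
split; rewrite ?ReM ?ImM /= ?mul0r ?sub0r ?add0r; first exact: is_derive_cosk.
exact: is_derive_sink.
Qed.

Let intT_derive (f g : R -> R) : continuous g -> (forall x : R, is_derive x 1 f (g x)) ->
  f (2 * pi) = f 0 -> intT g = 0.
Proof.
move=> cg df f2pi; rewrite /intT /Rintegral (continuous_FTC2 (F := f)).
- by rewrite f2pi -EFinB subrr/= mulr0.
- by rewrite mulr_gt0// pi_gt0.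
- by apply: continuous_subspaceT => x; exact: cg.
- have cf x : {for x, continuous f}.
    by apply: differentiable_continuous; apply/derivable1_diffP; apply: ex_derive.
  split.
  + by move=> x _; apply: ex_derive.
  + by apply: cvg_at_right_filter; exact: cf.
  + by apply: cvg_at_left_filter; exact: cf.
- by move=> x _; rewrite derive1E; apply: derive_val.
Qed.

(** For k different from 0, k cos(k x) and - k sin(k x) have the periodic primitives sin(k x) and
    cos(k x). *)
Lemma cintT_expi (k : int) :
  cintT (fun x => expi (k%:~R * x)) = if k == 0 then 1 else 0 :> C.
Proof.
case: eqP => [->|/eqP k0].
  have i1 : intT (fun=> 1) = 1 :> R.
    have mTE : (@lebesgue_measure R) (Tset : set R) = (2 * pi)%:E.
      by rewrite /Tset lebesgue_measure_itv/= lte_fin mulr_gt0 ?pi_gt0//= oppr0 addr0.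
    rewrite /intT Rintegral_cst// mul1r (_ : fine _ = 2 * pi); last first.
      exact: (congr1 fine mTE).
    by rewrite mulVf// gt_eqF// mulr_gt0// pi_gt0.
  apply: complex_ext => /=.
    by under eq_fun do rewrite mul0r cos0.
  under eq_fun do rewrite mul0r sin0 -(mul0r 1).
  by rewrite intTZ ?mul0r// => x; exact: cvg_cst.
have kr : k%:~R != 0 :> R by rewrite intr_eq0.
have [cc cs] := ccont_expi k%:~R.
have e2 := expi_2pi k.
have ec : cos (k%:~R * (2 * pi)) = 1 :> R by have := congr1 (@complex.Re R) e2.
have es : sin (k%:~R * (2 * pi)) = 0 :> R by have := congr1 (@complex.Im R) e2.
apply: complex_ext => /=.
  have : k%:~R * intT (fun x : R => cos (k%:~R * x)) = 0.
    rewrite -(intTZ _ cc) /=; apply: (@intT_derive (fun x => sin (k%:~R * x))).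
    - by move=> x; apply: cvgMr; exact: cc.
    - by move=> x; exact: is_derive_sink.
    - by rewrite es mulr0 sin0.
  by move/eqP; rewrite mulf_eq0 (negbTE kr) => /eqP.
have : - k%:~R * intT (fun x : R => sin (k%:~R * x)) = 0.
  rewrite -(intTZ _ cs) /=; apply: (@intT_derive (fun x => cos (k%:~R * x))).
  - by move=> x; apply: cvgMr; exact: cs.
  - by move=> x; rewrite mulNr; exact: is_derive_cosk.
  - by rewrite ec mulr0 cos0.
by move/eqP; rewrite mulf_eq0 oppr_eq0 (negbTE kr) => /eqP.
Qed.

End torus_calculus.

(** * Parseval, and [fN] as a potential of the Fourier coefficients *)

Section fourier.
Context {R : realType}.
Local Notation C := R[i].
Implicit Types (v : R -> C) (a : int -> C).

Definition trig N a (x : R) : C := \sum_(n <- window N) a n * expi (n%:~R * x).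

Lemma PlowE N v : Plow N v = trig N (fcoef v).
Proof. by apply/funext => x; rewrite /trig big_window_ord. Qed.

Lemma cintT_pairing (s t : seq int) (F G : int -> C) :
  uniq t -> {subset s <= t} ->
  cintT (fun x => (\sum_(k <- s) F k * expi (k%:~R * x))^* *
    (\sum_(l <- t) G l * expi (l%:~R * x))) =
  \sum_(k <- s) (F k)^* * G k.
Proof.
move=> ut st.
transitivity (cintT (fun x => \sum_(k <- s) \sum_(l <- t)
    ((F k)^* * G l) * expi ((l - k)%:~R * x))).
  congr cintT; apply/funext => x.
  rewrite rmorph_sum mulr_suml; apply: eq_bigr => k _.
  rewrite mulr_sumr; apply: eq_bigr => l _.
  rewrite rmorphM/= expi_conj intrD mulrNz mulrDl mulNr expiD.
  by ring.
rewrite cintT_sum => [|k]; last first.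
  by apply: ccont_sum => l; apply: ccontZ; exact: ccont_expi.
apply: eq_big_seq => k ks.
rewrite cintT_sum => [|l]; last by apply: ccontZ; exact: ccont_expi.
rewrite (bigD1_seq k) ?st//= cintTZ; last exact: ccont_expi.
rewrite cintT_expi subrr eqxx mulr1 big1 ?addr0// => l lk.
by rewrite cintTZ; [rewrite cintT_expi subr_eq0 (negbTE lk) mulr0|exact: ccont_expi].
Qed.

Lemma L2norm2_Plow N v : L2norm2 (Plow N v) = rmass N (fcoef v).
Proof.
rewrite PlowE /L2norm2 /rmass.
have := cintT_pairing (fcoef v) (fcoef v) (uniq_window N) (fun _ => id).
move/(congr1 (@complex.Re R)) => /=.
rewrite Re_sum; under [RHS]eq_bigr do rewrite mulrC mulr_conj_Re.
move=> <-; congr intT; apply/funext => x.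
by rewrite mulrC mulr_conj_Re -sqr_modc modcE.
Qed.

Lemma sum_conv N L a (F : int -> C) : (N.*2 <= L)%N ->
  \sum_(x <- window N) \sum_(y <- window N) a x * a y * F (x + y) =
  \sum_(k <- window L) conv L (trunc N a) k * F k.
Proof.
move=> NL; set c := trunc N a.
have cN j : (N < `|j|)%N -> c j = 0 by move=> h; rewrite /c /trunc leqNgt h.
transitivity (\sum_(x <- window L) \sum_(k <- window L) c x * c (k - x) * F k).
  rewrite [RHS](@big_window_support _ L N); last first.
    move=> j /orP[h|/cN h]; rewrite big1// => k _.
      by rewrite cN ?mul0r//; lia.
    by rewrite h !mul0r.
  apply: eq_big_seq => x; rewrite mem_window => xN.
  transitivity (\sum_(y <- window N) c x * c y * F (x + y)).
    by apply: eq_big_seq => y; rewrite mem_window => yN; rewrite /c /trunc xN yN.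
  rewrite -(@big_window_shift _ L N x (fun y => c x * c y * F (x + y))).
  - by apply: eq_bigr => k _; rewrite [x + _]addrC subrK.
  - by move=> j /cN ->; rewrite mulr0 mul0r.
  - by lia.
rewrite exchange_big/=; apply: eq_bigr => k _.
by rewrite /conv mulr_suml.
Qed.

Lemma trig_sqr N L a x : (N.*2 <= L)%N ->
  trig N a x ^+ 2 = trig L (conv L (trunc N a)) x.
Proof.
move=> NL; rewrite /trig -(sum_conv a (fun k => expi (k%:~R * x)) NL).
rewrite expr2 mulr_suml; apply: eq_bigr => n _.
rewrite mulr_sumr; apply: eq_bigr => k _.
by rewrite intrD mulrDl expiD; ring.
Qed.

Lemma dx_trig N a x :
  dx (trig N a) x = \sum_(n <- window N) a n * (Complex 0 n%:~R * expi (n%:~R * x)).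
Proof.
apply: dxE; apply: cderive_sum => n; apply: cderiveZ; exact: cderive_expi.
Qed.

Let natr_imM (n : nat) (r : R) : n%:R * Complex 0 r = Complex 0 (n%:R * r) :> C.
Proof.
by apply: complex_ext; rewrite ?ReM ?ImM Re_natr Im_natr/= !(mulr0, mul0r) ?subrr ?addr0.
Qed.

(** This is w w' = (w^2)' / 2 written on coefficients; the square has coefficients [conv]. *)
Lemma trig_mul_dx N L a x : (N.*2 <= L)%N ->
  trig N a x * dx (trig N a) x =
  \sum_(k <- window L) (Complex 0 (k%:~R / 2) * conv L (trunc N a) k) * expi (k%:~R * x).
Proof.
move=> NL; rewrite dx_trig.
have E1 : trig N a x * \sum_(n <- window N) a n * (Complex 0 n%:~R * expi (n%:~R * x)) =
  \sum_(k <- window N) \sum_(n <- window N)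
    Complex 0 n%:~R * (a k * a n * expi ((k + n)%:~R * x)).
  rewrite /trig mulr_suml; apply: eq_bigr => k _; rewrite mulr_sumr.
  apply: eq_bigr => n _; rewrite intrD mulrDl expiD; ring.
have E2 : \sum_(k <- window N) \sum_(n <- window N)
    Complex 0 n%:~R * (a k * a n * expi ((k + n)%:~R * x)) =
    \sum_(k <- window N) \sum_(n <- window N)
    Complex 0 k%:~R * (a k * a n * expi ((k + n)%:~R * x)).
  rewrite exchange_big/=; apply: eq_bigr => k _; apply: eq_bigr => n _.
  by rewrite [n + k]addrC [a n * a k]mulrC.
(* The derivative may fall on either factor; averaging the two expressions makes k + n appear. *)
have half (z w : C) : z = w -> z = (z + w) / 2.
  by move=> ->; field.
rewrite E1 (half _ _ E2) -big_split/=.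
transitivity (\sum_(k <- window N) \sum_(n <- window N)
   a k * a n * (Complex 0 ((k + n)%:~R / 2) * expi ((k + n)%:~R * x))).
  rewrite mulr_suml; apply: eq_bigr => k _; rewrite -big_split/= mulr_suml.
  apply: eq_bigr => n _.
  have -> : Complex 0 ((k + n)%:~R / 2) = (Complex 0 n%:~R + Complex 0 k%:~R) / 2 :> C.
    have -> : (Complex 0 n%:~R + Complex 0 k%:~R : C) = 2 * Complex 0 ((k + n)%:~R / 2).
      rewrite (natr_imM 2); apply: complex_ext => /=; first by rewrite addr0.
      by rewrite intrD; field.
    by rewrite mulrAC mulfV ?mul1r// pnatr_eq0.
  by ring.
rewrite (sum_conv a (fun k => Complex 0 (k%:~R / 2) * expi (k%:~R * x)) NL).
by apply: eq_bigr => k _; ring.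
Qed.

(** Parseval pairs the conjugate of w^2 with (w^2)' / 2, and (- 3 i / 2) (i k / 2) = 3 k / 4. *)
Lemma fN_potential N L v : (N.*2 <= L)%N ->
  fN N v = potential L (trunc N (fcoef v)).
Proof.
move=> NL; rewrite /fN PlowE; set a := fcoef v; set c := trunc N a.
set W := conv L c.
have -> : cintT (fun x => ((trig N a x)^*) ^+ 2 * trig N a x * dx (trig N a) x) =
    \sum_(k <- window L) (W k)^* * (Complex 0 (k%:~R / 2) * W k).
  rewrite -(cintT_pairing W (fun k => Complex 0 (k%:~R / 2) * W k)
     (uniq_window L) (fun _ => id)).
  congr cintT; apply/funext => x.
  by rewrite -mulrA (trig_mul_dx _ _ NL) -rmorphXn (trig_sqr _ _ NL).
rewrite /potential /energy mulr_sumr !Re_sum mulr_sumr; apply: eq_bigr => k _.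
rewrite -/W.
have i2 : - (3%:R * Complex 0 1 / 2%:R) = Complex 0 (- (3 / 2)) :> C.
  have -> : (3%:R * Complex 0 1 : C) = 2%:R * Complex 0 (3 / 2).
    by rewrite (natr_imM 3) (natr_imM 2); congr Complex; field.
  rewrite mulrAC mulfV ?mul1r ?pnatr_eq0//.
  by apply: complex_ext; rewrite ?ReN ?ImN /= ?oppr0.
have -> : - (3%:R * Complex 0 1 / 2%:R) * ((W k)^* * (Complex 0 (k%:~R / 2) * W k)) =
  (Complex 0 (- (3 / 2)) * Complex 0 (k%:~R / 2)) * (W k * (W k)^*).
  by rewrite i2; ring.
rewrite ReM mulr_conj_Re mulr_conj_Im mulr0 subr0.
rewrite [in RHS]ReM Re_intr Im_intr mulr_conj_Re mul0r subr0 ReM /=.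
by field.
Qed.

End fourier.

(** * The uniform bound on the Gaussian probability space *)

Section gaussian_bound.
Context {R : realType}.
Local Notation E := (R * R)%type.
Context {d} {Om : measurableType d} (P : probability Om R) (X : int -> Om -> E).
Hypothesis mX : forall i, measurable_fun setT (X i).
Hypothesis indX : independent_family P X.
Hypothesis lawX :
  forall i C, measurable C -> P (X i @^-1` C) = @cgauss R C.

(** The p-th power of the cut-off exponential, as a function of the Fourier coefficients alone. *)
Definition cutexp (p m : R) (N : nat) (a : int -> R[i]) : R :=
  if rmass N a < m then expR (p * potential N.*2 (trunc N a)) else 0.

Lemma potential_trunc0 L (a : int -> R[i]) : potential L (trunc 0 a) = 0.
Proof.
have c0 j : (0 < `|j|)%N -> trunc 0 a j = 0 by move=> h; rewrite /trunc leqNgt h.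
rewrite /potential /energy Re_sum big1 ?mulr0// => k _.
have [->|k0] := eqVneq k 0; first by rewrite mul0r.
rewrite (@conv_support _ _ _ 0) ?mul0r ?mulr0//.
by rewrite double0 absz_gt0.
Qed.

Lemma integral_le_cst (f : Om -> R) (r : R) :
  (forall w, 0 <= f w) -> (forall w, f w <= r) ->
  (\int[P]_w (f w)%:E <= r%:E)%E.
Proof.
move=> f0 fr; apply: (@le_trans _ _ (\int[P]_w r%:E)%E).
  by apply: ge0_le_integralT => w; rewrite lee_fin.
rewrite integral_cst//.
set t := (X in (_ * X)%E); have -> : t = 1%E by exact: probability_setT.
by rewrite mule1.
Qed.

(** The window [N.*2] contains all frequencies of the convolution at every step n <= N. The
    induction starts from mode 0 alone, whose potential is zero. *)
Lemma potential_mart_integral_le1 (K lam m : R) (N n : nat) :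
  0 <= K -> (\int[pgauss]_g (expR (pnrm2 g / 2))%:E = K%:E)%E ->
  0 <= lam -> 192 * (lam * m) <= 1 -> (n <= N)%N ->
  (\int[P]_w (potential_mart N.*2 lam m K n (X ^~ w))%:E <= 1%:E)%E.
Proof.
move=> K0 KE lam0 small; elim: n => [|n IH] nN.
  apply: integral_le_cst => w; first exact: potential_mart_ge0.
  rewrite /potential_mart; case: ifP => // _.
  by rewrite potential_trunc0 mulr0 big_ord0 subr0 expR0.
apply: le_trans (IH (ltnW nN)).
apply: (pair_step mX indX lawX KE
  (A := fun x => potential_mart N.*2 lam m K n x * expR (- K * comp_eta N.*2 lam (amp x) n))
  (eta := fun x => comp_eta N.*2 lam (amp x) n)).
- exact: potential_mart_measurable.
- by move=> x; exact: potential_mart_ge0.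
- by move=> x; rewrite mulr_ge0 ?potential_mart_ge0 ?expR_ge0.
- by move=> x; exact: comp_eta_ge0.
- by move=> x g; apply: potential_mart_sym4 => //; lia.
- by move=> x; exact: potential_mart_step_le.
Qed.

(** At n = 0 the mass is below m <= 1, so the functional, the squared weighted mass and the weighted
    mass are each at most 1, whence c + A + B. *)
Lemma sextic_mart_integral_le (K m c A B : R) (n : nat) :
  0 <= K -> (\int[pgauss]_g (expR (pnrm2 g / 2))%:E = K%:E)%E ->
  0 <= c -> 8 * (K * lyap_const) * c <= A -> 16 * (K * lyap_const) * A <= B ->
  m <= 1 -> (8 * c + 6 * A) * m <= 1 / 4 -> B * m <= 1 ->
  (\int[P]_w (sextic_mart m K c A B n (X ^~ w))%:E <= (expR (c + A + B))%:E)%E.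
Proof.
move=> K0 KE c0 cA AB m1 sA sB; elim: n => [|n IH].
  apply: integral_le_cst => w; first exact: sextic_mart_ge0.
  rewrite /sextic_mart; case: ifPn => [|_]; last exact: expR_ge0.
  have w1 : wt 0 = 1 :> R by rewrite /wt !sqrtr1.
  rewrite /rmass big_window0 => Mm; set s := sqn _ in Mm.
  have s0 : 0 <= s by exact: sqn_ge0.
  have D : wmass (amp (X ^~ w)) 0 = s by rewrite /wmass big_window0 absz0 w1 expr1n mul1r.
  have W : wsextic (amp (X ^~ w)) 0 = s * s ^+ 2.
    by rewrite /wsextic big_window0 absz0 w1 expr1n mul1r D.
  rewrite /lyap D W w1 !expr1n !divr1 big_ord0 subr0 ler_expR -addrA.
  have A0 := lyapA_ge0 K0 c0 cA; have B0 := lyapB_ge0 K0 c0 cA AB.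
  have s1 : s <= 1 by lra.
  have s2 : s ^+ 2 <= 1 by rewrite expr_le1.
  have s3 : s * s ^+ 2 <= 1 by rewrite -exprS expr_le1.
  by rewrite lerD ?lerD// -[leRHS]mulr1 ler_wpM2l.
apply: le_trans IH.
apply: (pair_step mX indX lawX KE
  (A := fun x => sextic_mart m K c A B n x * expR (- lyap_gap A B (wt n.+1) (wmass (amp x) n))
     * expR (- lyap_drift K c A B n))
  (eta := fun x => lyap_eta c A B (wt n.+1) (wmass (amp x) n))).
- exact: sextic_mart_measurable.
- by move=> x; exact: sextic_mart_ge0.
- by move=> x; rewrite !mulr_ge0 ?sextic_mart_ge0 ?expR_ge0.
- by move=> x; apply: (lyap_eta_ge0 K0 c0 cA AB); [exact: wt_ge0|exact: wmass_ge0].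
- by move=> x g; exact: sextic_mart_sym4.
- by move=> x; exact: sextic_mart_step_le.
Qed.

Lemma sum_lyap_drift_le (K c A B : R) (n : nat) :
  0 <= K * lyap_const * (16 * c + 4 * A + 2 * B) ->
  \sum_(k < n) lyap_drift K c A B k <= K * lyap_const * (16 * c + 4 * A + 2 * B) * 2.
Proof.
set T := K * lyap_const * _ => T0; rewrite -mulr_sumr.
apply: ler_wpM2l => //; apply: le_trans (sum_inv_sqr n).
apply: ler_sum => k _.
rewrite (exprM _ 4 2) wt4 lef_pV2 ?posrE ?exprn_gt0 ?ltr0n//.
by rewrite lerXn2r ?nnegrE ?ler0n// ler_nat.
Qed.

Lemma gaussian_bound (p : R) : 0 <= p -> exists m C : R, 0 < m /\
  forall N, (\int[P]_w (cutexp p m N (amp (X ^~ w)))%:E <= C%:E)%E.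
Proof.
move=> p0; have [K [K0 KE]] := @integral_pgauss_expR R.
have [Kc Kc0 cubicE] := @cubic_sum_bound R.
pose lam := 2 * p.
(* Total weight of [cubic2] in the compensator: 18 = 2 * 9 and 72 = 8 * 9; [Kc] converts its sum
   into the sextic functional. *)
pose c := (18 + 72 * K) * lam ^+ 2 * Kc.
pose A := 8 * (K * lyap_const) * c.
pose B := 16 * (K * lyap_const) * A.
have lam0 : 0 <= lam by rewrite mulr_ge0.
have c0 : 0 <= c.
  by apply: mulr_ge0; [apply: mulr_ge0; [lra|exact: sqr_ge0]|exact: ltW].
have A0 : 0 <= A by exact: (lyapA_ge0 K0 c0 (lexx A)).
have B0 : 0 <= B by exact: (lyapB_ge0 K0 c0 (lexx A) (lexx B)).
(* [S] adds up all the smallness requirements, so that m = 1 / [S] meets each of them. *)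
pose S := 1 + 192 * lam + 4 * (8 * c + 6 * A) + B.
have S1 : 1 <= S by rewrite /S; lra.
pose m := S^-1.
have m0 : 0 < m by rewrite invr_gt0; lra.
have mS : S * m = 1 by rewrite mulfV// gt_eqF//; lra.
have key r : r <= S -> r * m <= 1 by move=> rS; rewrite -mS ler_wpM2r// ltW.
have m1 : m <= 1 by have := key 1 S1; rewrite mul1r.
have small : 192 * (lam * m) <= 1.
  by rewrite mulrA; apply: key; rewrite /S; lra.
have sA : (8 * c + 6 * A) * m <= 1 / 4.
  have : 4 * (8 * c + 6 * A) * m <= 1 by apply: key; rewrite /S; lra.
  by rewrite -mulrA; set z := (_ + _) * m; lra.
have sB : B * m <= 1 by apply: key; rewrite /S; lra.
pose T := K * lyap_const * (16 * c + 4 * A + 2 * B).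
have T0 : 0 <= T.
  apply: mulr_ge0; first by apply: mulr_ge0 => //; exact: lyap_const_ge0.
  lra.
(* The deterministic parts: 12 K lam times the momentum bound 2 m, 64 K times the bound 2 for the
   inverse squares, and the total drift, at most 2 T. *)
pose C1 := expR (24 * K * lam * m + 128 * K + T * 2).
have C10 : 0 <= C1 by exact: expR_ge0.
exists m, (2^-1 * 1 + 2^-1 * C1 * expR (c + A + B)); split => // N.
have NN2 : (N <= N.*2)%N by rewrite -addnn leq_addr.
have potential_mart0 w : 0 <= potential_mart N.*2 lam m K N (X ^~ w) by exact: potential_mart_ge0.
have sextic_mart0 w : 0 <= sextic_mart m K c A B N (X ^~ w) by exact: sextic_mart_ge0.
have mpotential_mart : measurable_fun setT (fun w => potential_mart N.*2 lam m K N (X ^~ w)).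
  by apply: (@potential_mart_measurable R N.*2 lam m K N d Om X).
have msextic_mart : measurable_fun setT (fun w => sextic_mart m K c A B N (X ^~ w)).
  by apply: (@sextic_mart_measurable R m K c A B N d Om X).
apply: (@le_trans _ _ (\int[P]_w ((2^-1)%:E * (potential_mart N.*2 lam m K N (X ^~ w))%:E +
   (2^-1 * C1)%:E * (sextic_mart m K c A B N (X ^~ w))%:E)%E)%E).
  apply: ge0_le_integralT => w.
    by rewrite lee_fin /cutexp; case: ifP => // _; exact: expR_ge0.
  rewrite -!EFinM -EFinD lee_fin /cutexp /potential_mart /sextic_mart.
  set a := amp (X ^~ w); case: ifPn => [Mm|_]; last by rewrite !mulr0 addr0.
  pose Q := \sum_(k < N) compensator N.*2 lam K a k.
  have QE : Q <= 24 * K * lam * m + 128 * K + c * wsextic a N.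
    rewrite /Q /compensator /comp_eta.
    have -> : \sum_(k < N) (2 * (9 * lam ^+ 2 * cubic2 N.*2 a k) +
        K * (8 * (9 * lam ^+ 2 * cubic2 N.*2 a k) +
          4 * (3 * lam * momentum1 N.*2 a k) + 64 * (k.+1%:R ^+ 2)^-1)) =
      (18 + 72 * K) * lam ^+ 2 * \sum_(k < N) cubic2 N.*2 a k +
      (12 * K * lam * \sum_(k < N) momentum1 N.*2 a k +
       64 * K * \sum_(k < N) (k.+1%:R ^+ 2)^-1).
      rewrite !mulr_sumr -!big_split/=; apply: eq_bigr => k _; ring.
    have e1 := cubicE a N.*2 N (leqnn _).
    have e2 := @momentum_sum R a N.*2 N NN2.
    have e3 := @sum_inv_sqr R N.
    have z1 : 0 <= (18 + 72 * K) * lam ^+ 2 by apply: mulr_ge0; [lra|exact: sqr_ge0].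
    have z2 : 0 <= 12 * K * lam by rewrite mulr_ge0// mulr_ge0.
    have z3 : 0 <= 64 * K by rewrite mulr_ge0.
    have y1 := ler_wpM2l z1 e1.
    have y2 := ler_wpM2l z2 (le_trans e2 (ler_wpM2l (ler0n R 2) (ltW Mm))).
    have y3 := ler_wpM2l z3 e3.
    rewrite [leRHS]addrC; apply: lerD; first by apply: (le_trans y1); rewrite mulrA.
    apply: lerD.
      by apply: (le_trans y2); rewrite le_eqVlt; apply/orP; left; apply/eqP; ring.
    by apply: (le_trans y3); rewrite le_eqVlt; apply/orP; left; apply/eqP; ring.
  have kE := @sum_lyap_drift_le K c A B N T0.
  have lyap0 : 0 <= lyap A B a N.
    rewrite /lyap; have h k : 0 <= (wt N ^+ k)^-1 :> R by rewrite invr_ge0 exprn_ge0// wt_ge0.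
    have D0 := wmass_ge0 a N.
    by apply: addr_ge0; apply: mulr_ge0 => //; apply: mulr_ge0 => //; exact: sqr_ge0.
  set f := potential _ _.
  (* AM-GM, as [lam = 2 p] *)
  have h1 : expR (lam * f - Q) + expR Q >= 2 * expR (p * f).
    have -> : expR (p * f) = expR (p * f - Q / 2) * expR (Q / 2).
      by rewrite -expRD; congr expR; ring.
    have -> : lam * f - Q = (p * f - Q / 2) + (p * f - Q / 2) by rewrite /lam; field.
    have -> : expR Q = expR (Q / 2) * expR (Q / 2) by rewrite -expRD; congr expR; field.
    rewrite (expRD (p * f - Q / 2) (p * f - Q / 2)).
    set u := expR (p * f - Q / 2); set v := expR (Q / 2).
    have := sqr_ge0 (u - v); have -> : (u - v) ^+ 2 = u * u + v * v - 2 * (u * v) by ring.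
    by rewrite subr_ge0.
  have h2 : expR Q <= C1 * expR (c * wsextic a N + lyap A B a N -
      \sum_(k < N) lyap_drift K c A B k).
    rewrite /C1 -expRD ler_expR.
    have arith (q x1 x2 x3 x4 x5 x6 : R) : q <= x1 + x2 + x4 -> x6 <= x3 ->
      0 <= x5 -> q <= x1 + x2 + x3 + (x4 + x5 - x6) by lra.
    exact: arith QE kE lyap0.
  rewrite -/Q; apply: (@le_trans _ _ (2^-1 * (expR (lam * f - Q) + expR Q))).
    by rewrite ler_pdivlMl.
  rewrite mulrDr lerD2l -[2^-1 * C1 * _]mulrA.
  by rewrite ler_wpM2l// invr_ge0.
rewrite ge0_integralD//; first last.
- by apply/measurable_funeM/measurable_EFinP.
- by move=> w _; rewrite -EFinM lee_fin !mulr_ge0.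
- by apply/measurable_funeM/measurable_EFinP.
- by move=> w _; rewrite -EFinM lee_fin mulr_ge0.
rewrite !ge0_integralZl//; try exact/measurable_EFinP; try by move=> *; rewrite lee_fin.
rewrite EFinD; apply: leeD.
  rewrite EFinM lee_pmul2l ?lte_fin//.
  by apply: (potential_mart_integral_le1 K0 KE lam0 small (leqnn N)).
rewrite (EFinM (2^-1 * C1)) lee_wpmul2l ?lee_fin ?mulr_ge0//.
exact: (sextic_mart_integral_le N K0 KE c0 (lexx A) (lexx B) m1 sA sB).
by rewrite lee_fin mulr_ge0.
Qed.

End gaussian_bound.

(** * Transfer to the measure mu, and conclusion *)

Section transfer.
Context {R : realType}.
Local Notation C := R[i].

Lemma cmeasurable_toRR d (T : measurableType d) (F : T -> C) :
  measurable_fun setT (fun t => toRR (F t)) -> cmeasurable F.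
Proof.
move=> mF; split.
  exact: (measurableT_comp (f := fst) (g := fun t => toRR (F t))).
exact: (measurableT_comp (f := snd) (g := fun t => toRR (F t))).
Qed.

Lemma measurable_fcoef (n : int) :
  measurable_fun [set: Hspace R] (fun u : Hspace R => toRR (fcoef u n)).
Proof.
move=> _ B mB; rewrite setTI; apply: sub_sigma_algebra.
by exists n, B.
Qed.

Lemma measurable_cutexp d (T : measurableType d) (c : T -> int -> C) p m N :
  (forall j, cmeasurable (c ^~ j)) ->
  measurable_fun setT (fun t => cutexp p m N (c t)).
Proof.
move=> mc; apply: measurable_fun_ifT.
- by apply: measurable_fun_ltr => //; exact: measurable_rmass.
- apply: measurableT_comp => //; apply: measurable_funM => //.
  apply: measurable_potential => j; rewrite /trunc.
  by case: (`|j| <= N)%N; [exact: mc|exact: cmeasurable_cst].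
- exact: measurable_cst.
Qed.

Lemma cutexp_ge0 p m N (a : int -> C) : 0 <= cutexp p m N a.
Proof. by rewrite /cutexp; case: ifP => // _; exact: expR_ge0. Qed.

(** [cutexp] sees u only through its Fourier coefficients, which under the law of U coincide almost
    surely with the Gaussian amplitudes. *)
Lemma mu_bound (mu : probability (Hspace R) R) (p : R) : is_mu mu -> 0 <= p ->
  exists m r : R, 0 < m /\
  forall N, (\int[mu]_u (cutexp p m N (fcoef (u : Hspace R)))%:E <= r%:E)%E.
Proof.
move=> [d [Om [P [g [U [[gG gI] aeU muE]]]]]] p0.
pose X n w := toRR (g n w).
have mX i : measurable_fun setT (X i) by have [] := complex_gaussian_law (gG i).
have lawX i A : measurable A -> P (X i @^-1` A) = @cgauss R A.
  by have [_] := complex_gaussian_law (gG i); apply.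
have [m [r [m0 bound]]] := gaussian_bound mX gI lawX p0.
exists m, r; split => // N.
have mcut : measurable_fun setT
    (fun u : Hspace R => (cutexp p m N (fcoef u))%:E).
  apply/measurable_EFinP; apply: (@measurable_cutexp _ _ (fun u : Hspace R => fcoef u)) => j.
  exact: cmeasurable_toRR (measurable_fcoef j).
apply: le_trans (bound N).
have cut0 u : (0 <= (cutexp p m N (fcoef (u : Hspace R)))%:E)%E.
  by rewrite lee_fin cutexp_ge0.
rewrite (eq_measure_integral (distribution P U)); last by move=> A mA _; exact: muE.
rewrite le_eqVlt; apply/orP; left; apply/eqP.
transitivity (\int[P]_w (cutexp p m N (fcoef (U w : Hspace R)))%:E)%E.
  exact: (@ge0_integral_pushforward _ _ Om (Hspace R) R U (@measurable_funPT _ _ _ _ U) P setT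
    (fun u => (cutexp p m N (fcoef (u : Hspace R)))%:E) measurableT mcut (fun u _ => cut0 u)).
have mcutU : measurable_fun [set: Om] (fun w => (cutexp p m N (fcoef (U w : Hspace R)))%:E).
  exact: (measurableT_comp mcut).
have mcutX : measurable_fun [set: Om] (fun w => (cutexp p m N (amp (X ^~ w)))%:E).
  apply/measurable_EFinP; apply: (@measurable_cutexp _ _ (fun w => amp (X ^~ w))) => j.
  by split; apply: measurable_funM => //; apply: measurableT_comp => //; exact: mX.
apply: (@ae_eq_integral _ Om R P setT _ _ measurableT mcutU mcutX).
apply: filterS aeU => w Uw _ /=; congr (cutexp _ _ _ _)%:E.
apply/funext => j; rewrite Uw /amp /X /toRR -fmorphV.
by apply: complex_ext; rewrite ?ReM ?ImM /= mulr0 ?subr0 ?add0r.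
Qed.

End transfer.

Theorem theorem1p3 (R : realType) (mu : probability (Hspace R) R)
  (hmu : is_mu mu) (p : R) (hp : 1 <= p) :
  exists m C : R, 0 < m /\
    forall N : nat, dyadic N ->
      ('N[mu]_(p%:E)[(fun u : Hspace R =>
          (\1_[set v : Hspace R | L2norm2 (Plow N v) < m] u
           * expR (fN N u))%:E)] `^ p <= C%:E)%E /\
      ('N[mu]_(p%:E)[(fun u : Hspace R => (PsiN m N u)%:E)] `^ p <= C%:E)%E.
Proof.
have p0 : 0 < p by lra.
have [m [r [m0 bound]]] := mu_bound hmu (ltW p0).
exists m, r; split => // N _.
have indE (u : Hspace R) : \1_[set v : Hspace R | L2norm2 (Plow N v) < m] u =
    ((rmass N (fcoef u) < m)%R : bool)%:R :> R.
  rewrite indicE; congr (nat_of_bool _)%:R.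
  by apply/idP/idP; rewrite inE /= L2norm2_Plow.
have indE' (u : Hspace R) :
    \1_[set v' : R -> R[i] | L2norm2 (Plow N v') < m] (u : R -> R[i]) =
    ((rmass N (fcoef u) < m)%R : bool)%:R :> R.
  rewrite indicE; congr (nat_of_bool _)%:R.
  by apply/idP/idP; rewrite inE /= L2norm2_Plow.
rewrite !powR_Lnorm ?gt_eqF//; split; apply: le_trans (bound N);
    apply: ge0_le_integralT => u; rewrite ?poweR_ge0//.
- rewrite indE poweR_EFin lee_fin (fN_potential _ (leqnn _)) /cutexp.
  case: ifP => _; last by rewrite mul0r normr0 powR0// gt_eqF.
  by rewrite mul1r ger0_norm ?expR_ge0// -expRM mulrC.
- rewrite /PsiN indE' poweR_EFin lee_fin (fN_potential _ (leqnn _)) /cutexp.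
  case: ifP => _; last by rewrite mul0r normr0 powR0// gt_eqF.
  rewrite mul1r ger0_norm ?expR_ge0// -expRM ler_expR mulrC ler_wpM2l ?(ltW p0)//.
  (* The sextic integral is nonnegative and enters with a minus sign, so the same m and the same
     bound serve for [PsiN]. *)
  rewrite gerBl mulr_ge0//; apply: intT_ge0 => x.
  by apply: exprn_ge0; rewrite /cabs -modcE modc_ge0.
Qed.
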